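(* There exist universal constants $C_5, C_6>0$ such that the following holds. Let $n\ge 1$, $p\ge 1$, $m\ge n$ and $2\le s\le np$ be integers, and let $\Phi$ be the random $m\times np$ multichannel circulant matrix defined in the context. Then \[ \mathbb{E}\,\|I-\Phi^*\Phi\|_s \;\le\; \sqrt{\frac{C_5\, s\,\log^2 s\,\log^2(mp)\,\log(np)}{m}} \] whenever $m\ge C_6\, s\,\log^2 s\,\log^2(mp)\,\log(np)$.
   Context: Probe signals: for $i=1,\dots,p$ and $t=1,\dots,m$, the entries $\phi_i(t)$ are independent Gaussian random variables with mean $0$ and variance $1/m$. For each $i$, $\Phi_i$ is the $m\times n$ matrix with entries $\Phi_i(r,c)=\phi_i\big(((n+r-c-1)\bmod m)+1\big)$ for $1\le r\le m$, $1\le c\le n$. Equivalently, $\Phi_i$ consists of the first $n$ columns of the $m\times m$ circulant matrix whose first row is $(\phi_i(n),\phi_i(n-1),\dots,\phi_i(1),\phi_i(m),\dots,\phi_i(n+1))$. The matrix $\Phi=[\Phi_1\ \Phi_2\ \cdots\ \Phi_p]$ is $m\times np$, obtained by concatenating the $\Phi_i$ side by side. For an $N\times N$ matrix $A$ and an integer $s\ge1$, define \[ \|A\|_s=\sup\{|y^*Ax| : \Gamma\subset\{1,\dots,N\},\ |\Gamma|\le s,\ x,y \text{ supported on }\Gamma,\ \|x\|_2=\|y\|_2=1\}. \] Here $^*$ denotes the (conjugate) transpose, and $I$ is the $np\times np$ identity matrix. *)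

(* Defs.v *)
From HB Require Import structures.
From mathcomp Require Import all_boot all_order all_algebra.
From mathcomp Require Import all_classical all_reals all_analysis.
Set Implicit Arguments. Unset Strict Implicit. Unset Printing Implicit Defensive.
Import Order.TTheory GRing.Theory Num.Theory.
Local Open Scope classical_set_scope.
Local Open Scope ring_scope.

(* Mutual independence of a finite family of real random variables:
   the product rule holds for every family of Borel sets (taking B k = setT
   recovers every subfamily). *)
Definition mutually_independent {R : realType} (d : measure_display)
  (T : measurableType d) (P : probability T R) (I : finType)
  (X : I -> T -> R) : Prop :=
  forall B : I -> set R, (forall k, measurable (B k)) ->
    P (\bigcap_(k in [set: I]) (X k @^-1` B k)) =
    (\prod_(k : I) P (X k @^-1` B k))%E.

Definition probe_at {R : realType} (p m : nat) (phi : 'I_p -> 'I_m -> R)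
  (i t : nat) : R :=
  match @insub _ (fun k => k < p)%N _ i, @insub _ (fun k => k < m)%N _ t with
  | Some i', Some t' => phi i' t'
  | _, _ => 0
  end.

(* Multichannel circulant matrix Phi = [Phi_1 ... Phi_p] (0-based indices):
   column c belongs to block i = c %/ n, local column cc = c %% n, and
   Phi_i(r, cc) = phi_i(((n + r - cc - 1) mod m) + 1)  (1-based in the paper),
   i.e. the 0-based sample index (n + r - (cc+1)) %% m. *)
Definition mc_circulant {R : realType} (n p m : nat) (phi : 'I_p -> 'I_m -> R)
  : 'M[R]_(m, n * p) :=
  \matrix_(r < m, c < n * p)
    probe_at phi (c %/ n) ((n + r - (c %% n).+1) %% m).

Definition l2norm {R : realType} (N : nat) (x : 'cV[R]_N) : R :=
  Num.sqrt (\sum_(i < N) x i 0 ^+ 2).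

Definition sparse_norm {R : realType} (N s : nat) (A : 'M[R]_N) : R :=
  sup [set r : R | exists (G : {set 'I_N}) (x y : 'cV[R]_N),
        (#|G| <= s)%N /\
        (forall i, i \notin G -> x i 0 = 0) /\
        (forall i, i \notin G -> y i 0 = 0) /\
        l2norm x = 1 /\ l2norm y = 1 /\
        r = `|(y^T *m A *m x) 0 0| ].

(* Main.v *)
Require Import Defs.
From HB Require Import structures.
From mathcomp Require Import all_boot all_order all_algebra.
From mathcomp Require Import all_classical all_reals all_analysis.
From mathcomp Require Import measurable_realfun.
From mathcomp Require Import ring lra zify.
From mathcomp Require Import complex.
From mathcomp Require cyclic separable cyclotomic.
Set Implicit Arguments. Unset Strict Implicit. Unset Printing Implicit Defensive.
Import Order.TTheory GRing.Theory Num.Theory.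
Local Open Scope classical_set_scope.
Local Open Scope ring_scope.

(* [y^* (I - Phi^* Phi) x] is bilinear, so by polarisation and rounding to a grid
   of mesh [1/(4s)] the sparse norm is at most the maximum of
   [D z = | |Phi z|^2 - |z|^2 |] over a finite net of vectors [z] with
   [|z|_2 <= 2] and [|z|_1 <= 2 sqrt s].  As a quadratic form in the Gaussian
   probes [xi], [D z] splits into a diagonal part, governed by the chi-square
   variables [sum_t xi_i(t)^2 - 1], and an off-diagonal part, which is an average
   of [4 <Phi_S z, Phi_(~S) z>] over uniformly random sets [S] of probe entries.
   For fixed [S], condition on the entries in [S]: what remains is a centred
   Gaussian process in [z], and the discrete Fourier transform, which diagonalises
   circulant matrices, shows that its increments are controlled by
   [(1 + max_z |Phi_S z|^2 + 4 K) * d(z, z')], where [K] bounds the Fourier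
   coefficients of the probes and [d] is a maximum of [2m] Hilbert seminorms that
   are at most 1 on the coordinate vectors.  Maurey's empirical method, here
   derandomised through an exponential potential, gives [d]-nets of the l1 ball,
   and chaining over [log s] scales bounds the conditional expectation.  Since
   [E max_z |Phi_S z|^2 <= 4 + E max_z D z], this yields
   [E max D <= eta * (kappa + E max D) + (diagonal)], and for [eta <= 1/2] the last
   occurrence of [E max D] is absorbed. *)

(** The factors of the rate have separate origins. Maurey's method with [4^j] atoms reaches
    precision of order [2^-j sqrt(s log m)], the logarithm counting the [2m] seminorms, at entropy
    [4^j log(np)]. Precision times root of entropy does not depend on [j], so [log s] scales cost
    [log s sqrt(s log m log(np))], divided by [sqrt m] for the standard deviation of the probes. The
    [p m] Gaussian Fourier coefficients contribute, through [K], a further [sqrt(log(mp))]. Stopping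
    after [log s] scales is possible because the net has log-cardinality of order at most
    [s log(np)]: the last hop is shorter by a factor [s], which outweighs the root of that entropy.
    Decoupling by subsets, rather than by an independent copy of the whole vector, keeps [Phi_S z]
    built from the original probes; a sign flip then compares it with [Phi z], which leads back to
    [D] and closes the recursion. Two quantities are absorbed into half of themselves, the sparse
    norm under rounding and [E max D] at the end. Each must be known to be finite beforehand. *)

(** * Independent random vectors *)

(* A type synonym, so that [I -> R] can carry the product sigma-algebra. *)
Definition rvec (R : realType) (I : finType) : Type := I -> R.

HB.instance Definition _ (R : realType) (I : finType) :=
  gen_eqMixin (rvec R I).
HB.instance Definition _ (R : realType) (I : finType) :=
  gen_choiceMixin (rvec R I).
HB.instance Definition _ (R : realType) (I : finType) :=
  isPointed.Build (rvec R I) (fun=> 0).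

(** Boxes rather than single-coordinate cylinders: boxes are stable under intersection, as the
    uniqueness theorem for measures requires, and independence is stated on them. *)
Definition box_sets (R : realType) (I : finType) : set (set (rvec R I)) :=
  [set A | exists B : I -> set R, (forall k, measurable (B k)) /\
     A = [set x | forall k, B k (x k)]].

HB.instance Definition _ (R : realType) (I : finType) :=
  Measurable.copy (rvec R I) (g_sigma_algebraType (@box_sets R I)).

Lemma measurable_coord (R : realType) (I : finType) (k : I) :
  measurable_fun setT (fun x : rvec R I => x k).
Proof.
move=> _ B mB; rewrite setTI; apply: sub_sigma_algebra.
exists (fun j => if j == k then B else setT); split.
  by move=> j; case: ifP.
apply/seteqP; split => x /=.
  by move=> Bx j; case: eqP => // ->.
by move=> /(_ k); rewrite eqxx.
Qed.

Lemma measurable_to_rvec (R : realType) (I : finType) (d : measure_display)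
    (T : measurableType d) (X : T -> rvec R I) :
  (forall k, measurable_fun setT (fun w => X w k)) ->
  measurable_fun setT X.
Proof.
move=> mX; apply: (measurability (@box_sets R I)); first by [].
move=> _ [A [B [mB ->]] <-].
rewrite (_ : _ `&` _ = \bigcap_(k in [set: I]) ((fun w => X w k) @^-1` B k)).
  apply: fin_bigcap_measurable; first exact: finite_finset.
  by move=> k _; rewrite -[X in measurable X]setTI; exact: mX.
rewrite setTI; apply/seteqP; split => w /= H k; [by move=> _; exact: H|].
exact: H.
Qed.

Lemma ge0_integral_comp (R : realType) (d1 d2 : measure_display)
    (T1 : measurableType d1) (T2 : measurableType d2) (P : probability T1 R)
    (X : T1 -> T2) (mX : measurable_fun setT X) (F : T2 -> \bar R) :
  measurable_fun setT F -> (forall x, 0 <= F x)%E ->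
  (\int[pushforward P X]_y F y = \int[P]_w F (X w))%E.
Proof.
by move=> mF F0; rewrite (ge0_integral_pushforward mX).
Qed.

(** The two image measures agree on boxes, a generating pi-system that contains the whole space,
    hence everywhere. The probability spaces may differ; below, one of them is [T * T]. *)
Lemma same_law_integral (R : realType) (I : finType)
    (d1 d2 : measure_display) (T1 : measurableType d1) (T2 : measurableType d2)
    (P1 : probability T1 R) (P2 : probability T2 R)
    (X : T1 -> rvec R I) (Y : T2 -> rvec R I) (F : rvec R I -> \bar R) :
  (forall k, measurable_fun setT (fun w => X w k)) ->
  (forall k, measurable_fun setT (fun w => Y w k)) ->
  (forall B : I -> set R, (forall k, measurable (B k)) ->
    P1 (\bigcap_(k in [set: I]) ((fun w => X w k) @^-1` B k)) =
    P2 (\bigcap_(k in [set: I]) ((fun w => Y w k) @^-1` B k))) ->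
  measurable_fun setT F -> (forall x, 0 <= F x)%E ->
  (\int[P1]_w F (X w) = \int[P2]_w F (Y w))%E.
Proof.
move=> /measurable_to_rvec mX /measurable_to_rvec mY XY mF F0.
rewrite -(ge0_integral_comp P1 mX) // -(ge0_integral_comp P2 mY) //.
pose mX' := isMeasurableFun.Build _ _ _ _ _ mX.
pose mY' := isMeasurableFun.Build _ _ _ _ _ mY.
pose X' : {mfun _ >-> _} := HB.pack X mX'.
pose Y' : {mfun _ >-> _} := HB.pack Y mY'.
apply: (@eq_measure_integral _ _ _ _ (pushforward P2 Y')
  (pushforward P1 X')) => A mA _.
apply: (@measure_unique _ R (rvec R I) (@box_sets R I) (fun=> setT) _ _ _ _
   (pushforward P1 X') (pushforward P2 Y')) => //.
- move=> _ _ [B [mB ->]] [C [mC ->]].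
  exists (fun k => B k `&` C k); split; first by move=> k; exact: measurableI.
  apply/seteqP; split => x /=; first by move=> [Bx Cx] k; split.
  by move=> H; split => k; have [] := H k.
- by move=> _; exists (fun=> setT); split => //; apply/seteqP; split.
- by rewrite bigcup_const //; exists 0%N.
- move=> _ [B [mB ->]]; rewrite /pushforward /=.
  have := XY B mB; rewrite (_ : \bigcap_(k in _) _ = X @^-1` [set x | forall k, B k (x k)]).
    rewrite (_ : \bigcap_(k in _) _ = Y @^-1` [set x | forall k, B k (x k)]) //.
    by apply/seteqP; split => w /= H k; [exact: H|move=> _; exact: H].
  by apply/seteqP; split => w /= H k; [exact: H|move=> _; exact: H].
- by move=> k; rewrite [ltLHS](_ : _ = P1 setT) // probability_setT ltry.
Qed.

Section independent_family.
Context (R : realType) (d : measure_display) (T : measurableType d)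
  (P : probability T R) (I : finType) (X : T -> rvec R I).
Hypothesis mX : forall k, measurable_fun setT (fun w => X w k).
Hypothesis indepX : mutually_independent P (fun k w => X w k).

Definition mix (S : I -> bool) (x y : rvec R I) : rvec R I :=
  fun k => if S k then x k else y k.

(** By independence, taking the coordinates in [S] from one copy and the others from a second copy
    on [T * T] does not change the law; Tonelli then gives the iterated integral. This is the form
    in which conditioning on the coordinates in [S] is used. *)
Lemma mix_integral (S : I -> bool) (F : rvec R I -> \bar R) :
  measurable_fun setT F -> (forall x, 0 <= F x)%E ->
  (\int[P]_w F (X w) = \int[P]_w \int[P]_w' F (mix S (X w) (X w')))%E.
Proof.
move=> mF F0.
pose PP : probability _ _ := (P \x P)%E.
pose Y := fun z : T * T => mix S (X z.1) (X z.2).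
have mY k : measurable_fun setT (fun z => Y z k).
  rewrite /Y /mix; case: (S k).
  - exact: (measurableT_comp (mX k) measurable_fst).
  - exact: (measurableT_comp (mX k) measurable_snd).
transitivity (\int[PP]_z F (Y z))%E; last first.
  rewrite (fubini_tonelli1 (fun z => F (Y z))) //.
  apply: measurableT_comp => //; exact: measurable_to_rvec.
apply: same_law_integral => // B mB.
pose BS1 k := if S k then B k else setT.
pose BS2 k := if S k then setT else B k.
have mA (C : I -> set R) : (forall k, measurable (C k)) ->
    measurable (\bigcap_(k in [set: I]) ((fun w => X w k) @^-1` C k)).
  move=> mC; apply: fin_bigcap_measurable; first exact: finite_finset.
  by move=> k _; rewrite -[X in measurable X]setTI; exact: mX.
have mB1 k : measurable (BS1 k) by rewrite /BS1; case: (S k).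
have mB2 k : measurable (BS2 k) by rewrite /BS2; case: (S k).
have -> : \bigcap_(k in [set: I]) ((fun z => Y z k) @^-1` B k) =
    (\bigcap_(k in [set: I]) ((fun w => X w k) @^-1` BS1 k)) `*`
    (\bigcap_(k in [set: I]) ((fun w => X w k) @^-1` BS2 k)).
  apply/seteqP; split => -[a b] /=.
    move=> H; split => k _ /=; have := H k Logic.I;
    by rewrite /Y /mix /BS1 /BS2 /=; case: (S k).
  move=> [H1 H2] k _; have := H1 k Logic.I; have := H2 k Logic.I.
  by rewrite /= /Y /mix /BS1 /BS2 /=; case: (S k).
rewrite [RHS]product_measure1E; [|exact: mA|exact: mA].
transitivity (\prod_(k : I) (P ((fun w => X w k) @^-1` BS1 k) *
    P ((fun w => X w k) @^-1` BS2 k)))%E; last first.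
  rewrite big_split /=.
  by apply: (f_equal2 (fun a b => a * b)%E); apply/esym; exact: indepX.
rewrite (indepX mB); apply: eq_bigr => k _.
rewrite /BS1 /BS2; case: (S k); rewrite preimage_setT probability_setT.
  by rewrite mule1.
by rewrite mul1e.
Qed.

Lemma flip_integral (S : I -> bool) (F : rvec R I -> \bar R) :
  (forall k (B : set R), measurable B ->
    P ((fun w => X w k) @^-1` B) = P ((fun w => - X w k) @^-1` B)) ->
  measurable_fun setT F -> (forall x, 0 <= F x)%E ->
  (\int[P]_w F (X w) =
   \int[P]_w F ((fun k => if S k then X w k else (- X w k)%R) : rvec R I))%E.
Proof.
move=> symX mF F0; apply: (@same_law_integral _ _ _ _ _ _ P P X _ F) => //.
  move=> k; case: (S k) => //; exact: measurableT_comp.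
move=> B mB.
pose C k : set R := if S k then B k else -%R @^-1` B k.
have mC k : measurable (C k).
  rewrite /C; case: (S k) => //; rewrite -[X in measurable X]setTI.
  have mN : measurable_fun setT (-%R : R -> R) by exact: measurable_funN.
  exact: mN.
have -> : \bigcap_(k in [set: I]) ((fun w => if S k then X w k else - X w k)
     @^-1` B k) = \bigcap_(k in [set: I]) ((fun w => X w k) @^-1` C k).
  by apply: eq_bigcapr => k _; rewrite /C; case: (S k).
rewrite (indepX mB) (indepX mC); apply: eq_bigr => k _.
by rewrite /C; case: (S k) => //; rewrite symX.
Qed.

(** One factor is peeled off at a time by [mix_integral] with [S = {k}]: the factor at [k] then sees
    only the first copy and, [k] not recurring in the list, the others see only the second. *)
Lemma prod_integral (f : I -> R -> R) (r : seq I) :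
  (forall k, measurable_fun setT (f k)) -> (forall k x, 0 <= f k x) ->
  uniq r ->
  (\int[P]_w (\prod_(k <- r) f k (X w k))%:E =
   \prod_(k <- r) \int[P]_w (f k (X w k))%:E)%E.
Proof.
move=> mf f0; elim: r => [|k r IHr] /=.
  move=> _; under eq_integral => w _ do rewrite big_nil.
  rewrite big_nil; transitivity (1 * P setT)%E; first exact: integral_cst.
  by rewrite probability_setT mule1.
move=> /andP[kr ur]; rewrite big_cons -IHr //.
pose F (x : rvec R I) := (\prod_(j <- k :: r) f j (x j))%:E.
have F0 x : (0 <= F x)%E by rewrite lee_fin; apply: prodr_ge0.
have mprod (r' : seq I) : measurable_fun setT
    (fun x : rvec R I => \prod_(j <- r') f j (x j)).
  elim: r' => [|j r' IH].
    by under eq_fun do rewrite big_nil; exact: measurable_cst.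
  under eq_fun do rewrite big_cons; apply: measurable_funM => //.
  exact: (measurableT_comp (mf j) (measurable_coord j)).
have mF : measurable_fun setT F by apply/measurable_EFinP; exact: mprod.
rewrite (mix_integral (fun j => j == k) mF F0).
have E w w' : F (mix (fun j => j == k) (X w) (X w')) =
    ((f k (X w k))%:E * (\prod_(j <- r) f j (X w' j))%:E)%E.
  rewrite /F big_cons -EFinM /mix eqxx; congr (_ * _)%:E.
  apply: eq_big_seq => j jr; case: eqP => // jk; move: kr.
  by rewrite -jk jr.
under eq_integral => w _.
  under eq_integral => w' _ do rewrite E.
  rewrite ge0_integralZl //; last 3 first.
  - apply/measurable_EFinP.
    exact: (measurableT_comp (mprod r) (measurable_to_rvec mX)).
  - by move=> w' _; rewrite lee_fin; apply: prodr_ge0.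
  - by rewrite lee_fin.
  over.
rewrite ge0_integralZr //.
- apply/measurable_EFinP; exact: measurableT_comp.
- by move=> w' _; rewrite lee_fin.
- by apply: integral_ge0 => w' _; rewrite lee_fin; apply: prodr_ge0.
Qed.

End independent_family.

(** * Gaussian variables *)

Section density.
Context (R : realType) (d : measure_display) (T : measurableType d)
  (mu nu : {measure set T -> \bar R}) (g : T -> R).
Hypothesis mg : measurable_fun setT g.
Hypothesis g0 : forall x, 0 <= g x.
Hypothesis nuE : forall A, measurable A -> nu A = (\int[mu]_(x in A) (g x)%:E)%E.

Import HBNNSimple.

Lemma integral_density_nnsfun (f : {nnsfun T >-> R}) :
  (\int[nu]_x (f x)%:E = \int[mu]_x ((f x)%:E * (g x)%:E))%E.
Proof.
under [LHS]eq_integral do rewrite fimfunE -fsumEFin//.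
rewrite [LHS]ge0_integral_fsum//; last 2 first.
  - by move=> r; exact/measurable_EFinP/measurableT_comp.
  - by move=> n x _; rewrite EFinM nnfun_muleindic_ge0.
under [RHS]eq_integral.
  move=> x xD; rewrite fimfunE -fsumEFin// ge0_mule_fsuml; last first.
    by move=> r; rewrite EFinM nnfun_muleindic_ge0.
  over.
rewrite [RHS]ge0_integral_fsum//; last 2 first.
  - move=> r; apply: emeasurable_funM; last exact/measurable_EFinP.
    exact/measurable_EFinP/measurableT_comp.
  - move=> n x _; rewrite mule_ge0//; last by rewrite lee_fin.
    by rewrite EFinM nnfun_muleindic_ge0.
apply: eq_fsbigr => r; rewrite inE => -[z _ fzr].
have r0 : 0 <= r by rewrite -fzr.
have mr : measurable (f @^-1` [set r]).
  by rewrite -[X in measurable X]setTI; exact: (measurable_funP f).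
under [LHS]eq_integral do rewrite EFinM.
rewrite ge0_integralZl//; try (by move=> x _; rewrite lee_fin);
  try (by rewrite lee_fin); last exact/measurable_EFinP/measurable_indic.
rewrite integral_indic // setIT nuE //.
under [RHS]eq_integral do rewrite EFinM -muleA.
rewrite ge0_integralZl//; try (by move=> x _; rewrite mule_ge0 // lee_fin);
  try (by rewrite lee_fin); last first.
  by apply: emeasurable_funM; apply/measurable_EFinP.
congr (_ * _)%E; rewrite integral_mkcond; apply: eq_integral => x _.
rewrite patchE indicE; case: ifPn => _; by rewrite ?mul1e ?mul0e.
Qed.

Lemma ge0_integral_density (f : T -> \bar R) :
  measurable_fun setT f -> (forall x, 0 <= f x)%E ->
  (\int[nu]_x f x = \int[mu]_x (f x * (g x)%:E))%E.
Proof.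
move=> mf f0.
pose f_ := nnsfun_approx measurableT mf.
transitivity (lim (\int[nu]_x (f_ n x)%:E @[n --> \oo])%E).
  rewrite -monotone_convergence//=.
  - apply: eq_integral => ? /[!inE] xD; apply/esym/cvg_lim => //=.
    exact: cvg_nnsfun_approx.
  - by move=> n; exact/measurable_EFinP/measurable_funTS.
  - by move=> n ? _; rewrite lee_fin.
  - by move=> ? _ ? ? mn; rewrite lee_fin; exact/lefP/nd_nnsfun_approx.
rewrite [X in _ = X](_ : _ = lim
    (\int[mu]_x ((f_ n x)%:E * (g x)%:E) @[n --> \oo])%E); last first.
  rewrite -monotone_convergence//=.
  - apply: eq_integral => x /[!inE] xD.
    apply/esym/cvg_lim => //.
    apply: cvgeZr => //; exact: cvg_nnsfun_approx.
  - move=> n; apply: emeasurable_funM; apply/measurable_EFinP => //.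
  - by move=> n ? _; rewrite mule_ge0 // lee_fin.
  - move=> x _ a b ab; rewrite lee_wpmul2r // ?lee_fin //.
    exact/lefP/nd_nnsfun_approx.
apply: congr_lim; apply/funext => n /=; exact: integral_density_nnsfun.
Qed.

End density.

Section gaussian.
Context (R : realType) (d : measure_display) (T : measurableType d)
  (P : probability T R) (sigma : R) (xi : T -> R).
Hypothesis sigma0 : 0 < sigma.
Hypothesis mxi : measurable_fun setT xi.
Hypothesis xiE : forall B : set R, measurable B ->
  P (xi @^-1` B) = normal_prob 0 sigma B.

Lemma gaussian_integral (f : R -> R) : measurable_fun setT f ->
  (forall x, 0 <= f x) ->
  (\int[P]_w (f (xi w))%:E =
   \int[lebesgue_measure]_x (f x * normal_pdf 0 sigma x)%:E)%E.
Proof.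
move=> mf f0.
pose xi' : T -> measurableTypeR R := xi.
have mxi' : measurable_fun setT xi' by exact: mxi.
pose f' : measurableTypeR R -> \bar R := fun x => (f x)%:E.
have mf' : measurable_fun setT f' by exact/measurable_EFinP.
have f'0 x : (0 <= f' x)%E by rewrite lee_fin.
rewrite -[LHS](ge0_integral_comp P mxi' mf' f'0).
transitivity (\int[normal_prob 0 sigma]_x f' x)%E.
  pose mX' := isMeasurableFun.Build _ _ _ _ _ mxi'.
  pose X' : {mfun _ >-> _} := HB.pack xi' mX'.
  apply: (@eq_measure_integral _ _ _ _ (normal_prob 0 sigma)
    (pushforward P X')) => A mA _.
  exact: xiE.
rewrite (@ge0_integral_density _ _ _ lebesgue_measure _ (normal_pdf 0 sigma)) //.
- exact: measurable_normal_pdf.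
- by move=> x; exact: normal_pdf_ge0.
Qed.

Lemma gaussian_sym (B : set R) : measurable B ->
  P (xi @^-1` B) = P ((fun w => - xi w) @^-1` B).
Proof.
move=> mB.
have mN : measurable_fun setT (-%R : R -> R) by exact: measurable_funN.
have mB' : measurable (-%R @^-1` B : set R).
  by rewrite -[X in measurable X]setTI; exact: mN.
rewrite (xiE mB); transitivity (normal_prob 0 sigma (-%R @^-1` B)); last first.
  by rewrite -(xiE mB').
rewrite /normal_prob.
pose N : measurableTypeR R -> measurableTypeR R := -%R.
have mN' : measurable_fun setT N by exact: mN.
pose pdf : measurableTypeR R -> \bar R := fun x => (normal_pdf 0 sigma x)%:E.
have mpdf : measurable_fun B pdf.
  by apply/measurable_funTS/measurable_EFinP; exact: measurable_normal_pdf.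
transitivity (\int[pushforward lebesgue_measure N]_(x in B) pdf x)%E.
  by apply: eq_measure_integral => A mA _; exact/esym/lebesgue_measureN.
rewrite (ge0_integral_pushforward mN' _ mB mpdf) //; last first.
  by move=> x _; rewrite lee_fin normal_pdf_ge0.
apply: eq_integral => x _ /=; rewrite /pdf /N !normal_pdfE ?gt_eqF //.
by rewrite /normal_fun !subr0 sqrrN.
Qed.

(** Completing the square makes the integrand a constant times the normal density centred at
    [a sigma^2], which integrates to 1. *)
Lemma gaussian_mgf (a : R) :
  (\int[P]_w (expR (a * xi w))%:E = (expR (a ^+ 2 * sigma ^+ 2 / 2))%:E)%E.
Proof.
rewrite (@gaussian_integral (fun x => expR (a * x))) //; last first.
  by apply: measurableT_comp; [exact: measurable_expR|exact: measurable_funM].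
have E x : (expR (a * x) * normal_pdf 0 sigma x)%:E =
    ((expR (a ^+ 2 * sigma ^+ 2 / 2))%:E *
     (normal_pdf (a * sigma ^+ 2) sigma x)%:E)%E.
  rewrite !normal_pdfE ?gt_eqF // -EFinM /normal_fun; congr (_%:E).
  rewrite mulrCA [RHS]mulrCA; congr (_ * _); rewrite -!expRD; congr expR.
  rewrite subr0; field; by rewrite gt_eqF.
under eq_integral do rewrite E.
rewrite ge0_integralZl //; first last.
- by move=> x _; rewrite lee_fin normal_pdf_ge0.
- by apply/measurable_EFinP; exact: measurable_normal_pdf.
by rewrite integral_normal_pdf mule1.
Qed.

(** The integrand is a constant times the centred normal density of standard deviation
    [sigma / sqrt(1 - 2 t sigma^2)]; the hypothesis makes this a positive real. *)
Lemma gaussian_sqr_mgf (t : R) : 2 * t * sigma ^+ 2 < 1 ->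
  (\int[P]_w (expR (t * xi w ^+ 2))%:E =
   ((Num.sqrt (1 - 2 * t * sigma ^+ 2))^-1)%:E)%E.
Proof.
move=> tlt; set q := 1 - 2 * t * sigma ^+ 2.
have q0 : 0 < q by rewrite subr_gt0.
have sq0 : 0 < Num.sqrt q by rewrite sqrtr_gt0.
rewrite (@gaussian_integral (fun x => expR (t * x ^+ 2))) //; last first.
  apply: measurableT_comp; first exact: measurable_expR.
  by apply: measurable_funM => //; exact: measurable_funX.
pose s' := sigma / Num.sqrt q.
have s'0 : 0 < s' by rewrite divr_gt0.
have E x : (expR (t * x ^+ 2) * normal_pdf 0 sigma x)%:E =
    (((Num.sqrt q)^-1)%:E * (normal_pdf 0 s' x)%:E)%E.
  rewrite !normal_pdfE ?gt_eqF // -EFinM /normal_fun; congr (_%:E).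
  have -> : normal_peak s' = Num.sqrt q * normal_peak sigma.
    rewrite /normal_peak /s' exprMn exprVn sqr_sqrtr ?ltW //.
    rewrite -mulrnAr -[in RHS]mulrnAr.
    rewrite [_ * q^-1]mulrC -mulrA sqrtrM ?invr_ge0 ?ltW // invfM.
    by rewrite sqrtrV ?ltW // invrK.
  rewrite [RHS]mulrA [X in _ = X * _]mulrA mulVf ?gt_eqF // mul1r mulrCA; congr (_ * _).
  rewrite -expRD; congr expR.
  rewrite subr0 /s' exprMn exprVn sqr_sqrtr ?ltW // /q; field.
  by rewrite !gt_eqF.
under eq_integral do rewrite E.
rewrite ge0_integralZl //; first last.
- by move=> x _; rewrite lee_fin normal_pdf_ge0.
- by apply/measurable_EFinP; exact: measurable_normal_pdf.
by rewrite integral_normal_pdf mule1.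
Qed.

End gaussian.

(** * Maxima of subgaussian families *)

(* Starting from 0, so meant for nonnegative families. *)
Definition fmax (R : realType) (J : finType) (f : J -> R) : R :=
  \big[Num.max/0]_(j : J) f j.

Section fmax.
Context (R : realType) (J : finType).
Implicit Types f : J -> R.

Lemma le_fmax f j : f j <= fmax f.
Proof. exact: le_bigmax. Qed.

Lemma fmax_ge0 f : 0 <= fmax f.
Proof. exact: bigmax_ge_id. Qed.

Lemma fmax_le f c : 0 <= c -> (forall j, f j <= c) -> fmax f <= c.
Proof. by move=> c0 fc; apply: bigmax_le. Qed.

Lemma measurable_fmax (d : measure_display) (T : measurableType d)
    (F : J -> T -> R) : (forall j, measurable_fun setT (F j)) ->
  measurable_fun setT (fun w => fmax (fun j => F j w)).
Proof.
move=> mF; rewrite /fmax; elim: (index_enum J) => [|j r IH].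
  by under eq_fun do rewrite big_nil; exact: measurable_cst.
by under eq_fun do rewrite big_cons; exact: measurable_maxr.
Qed.

End fmax.

Section expectation.
Context (R : realType) (d : measure_display) (T : measurableType d)
  (P : probability T R).

Lemma le_expectation (f g : T -> R) :
  measurable_fun setT f -> measurable_fun setT g ->
  (forall w, 0 <= f w) -> (forall w, f w <= g w) ->
  (\int[P]_w (f w)%:E <= \int[P]_w (g w)%:E)%E.
Proof.
move=> mf mg f0 fg; apply: ge0_le_integral => //.
- by move=> w _; rewrite lee_fin.
- exact/measurable_EFinP.
- exact/measurable_EFinP.
- by move=> w _; rewrite lee_fin.
Qed.

Lemma expectation_cst (c : R) : (\int[P]_w c%:E)%E = c%:E.
Proof.
transitivity (c%:E * P setT)%E; first exact: integral_cst.
by rewrite probability_setT mule1.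
Qed.

Lemma expectationD (f g : T -> R) :
  measurable_fun setT f -> measurable_fun setT g ->
  (forall w, 0 <= f w) -> (forall w, 0 <= g w) ->
  (\int[P]_w (f w + g w)%:E = \int[P]_w (f w)%:E + \int[P]_w (g w)%:E)%E.
Proof.
move=> mf mg f0 g0; under eq_integral do rewrite EFinD.
apply: ge0_integralD => //.
- by move=> w _; rewrite lee_fin.
- exact/measurable_EFinP.
- by move=> w _; rewrite lee_fin.
- exact/measurable_EFinP.
Qed.

Lemma expectationZ (c : R) (f : T -> R) :
  measurable_fun setT f -> (forall w, 0 <= f w) -> 0 <= c ->
  (\int[P]_w (c * f w)%:E = c%:E * \int[P]_w (f w)%:E)%E.
Proof.
move=> mf f0 c0; under eq_integral do rewrite EFinM.
apply: ge0_integralZl => //.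
- exact/measurable_EFinP.
- by move=> w _; rewrite lee_fin.
Qed.

Lemma measurable_rsum (J : Type) (r : seq J) (f : J -> T -> R) :
  (forall j, measurable_fun setT (f j)) ->
  measurable_fun setT (fun w => \sum_(j <- r) f j w).
Proof.
move=> mf; elim: r => [|j r IH].
  by under eq_fun do rewrite big_nil; exact: measurable_cst.
by under eq_fun do rewrite big_cons; exact: measurable_funD.
Qed.

Lemma expectation_sum (J : Type) (r : seq J) (f : J -> T -> R) :
  (forall j, measurable_fun setT (f j)) -> (forall j w, 0 <= f j w) ->
  (\int[P]_w (\sum_(j <- r) f j w)%:E = \sum_(j <- r) \int[P]_w (f j w)%:E)%E.
Proof.
move=> mf f0; elim: r => [|j r IH].
  by under eq_integral do rewrite big_nil; rewrite big_nil expectation_cst.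
under eq_integral do rewrite big_cons.
rewrite big_cons expectationD ?IH //; first exact: measurable_rsum.
by move=> w; apply: sumr_ge0.
Qed.

(* Pointwise, [a * max |Y| <= c + sum_j (e^(a Y_j - c) + e^(- a Y_j - c))];
   the choice of [c] makes the expectation of the sum at most 1. *)
Lemma expectation_fmax (J : finType) (Y : J -> T -> R) (a A : R) :
  (forall j, measurable_fun setT (Y j)) -> 0 < a -> 0 <= A ->
  (forall j, \int[P]_w (expR (a * Y j w))%:E <= (expR A)%:E)%E ->
  (forall j, \int[P]_w (expR (- a * Y j w))%:E <= (expR A)%:E)%E ->
  (\int[P]_w (fmax (fun j => `|Y j w|))%:E
    <= ((ln (2 * #|J|%:R) + A + 1) / a)%:E)%E.
Proof.
move=> mY a0 A0 Yp Yn.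
set c := ln (2 * #|J|%:R) + A.
have c0 : 0 <= c.
  rewrite addr_ge0 //; case: (posnP #|J|) => [->|J0].
    by rewrite mulr0 ln0.
  by rewrite ln_ge0 // -natrM ler1n muln_gt0.
pose S w := \sum_(j : J) (expR (a * Y j w) + expR (- a * Y j w)).
have mexp b j : measurable_fun setT (fun w => expR (b * Y j w)).
  apply: measurableT_comp; first exact: measurable_expR.
  exact: measurable_funM.
have mS : measurable_fun setT S.
  by apply: measurable_rsum => j; exact: measurable_funD.
have S0 w : 0 <= S w by apply: sumr_ge0 => j _; rewrite addr_ge0 ?expR_ge0.
have ES : (\int[P]_w (S w)%:E <= (expR c)%:E)%E.
  rewrite expectation_sum; last 2 first.
  - by move=> j; exact: measurable_funD.
  - by move=> j w; rewrite addr_ge0 ?expR_ge0.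
  apply: (@le_trans _ _ (\sum_(j : J) (2 * expR A)%:E)%E).
    apply: lee_sum => j _; rewrite expectationD //.
    by rewrite mulr_natl mulr2n EFinD; apply: leeD.
  rewrite sumEFin lee_fin sumr_const -[_ *+ _]mulr_natl /c expRD.
  rewrite mulrA [_ * 2]mulrC ler_wpM2r ?expR_ge0 //.
  case: (posnP #|J|) => [->|J0]; first by rewrite mulr0 expR_ge0.
  by rewrite lnK // posrE mulr_gt0 // ltr0n.
apply: (@le_trans _ _ (\int[P]_w (a^-1 * c + (a^-1 * expR (- c)) * S w)%:E)%E).
  apply: le_expectation.
  - by apply: measurable_fmax => j; exact: measurableT_comp.
  - apply: measurable_funD => //; exact: measurable_funM.
  - by move=> w; exact: fmax_ge0.
  move=> w; rewrite -mulrA -mulrDr ler_pdivlMl //.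
  have pos : 0 <= c + expR (- c) * S w.
    by rewrite addr_ge0 // mulr_ge0 ?expR_ge0.
  rewrite -ler_pdivlMl //; apply: fmax_le => [|j].
    by rewrite mulr_ge0 // invr_ge0 ltW.
  rewrite ler_pdivlMl //.
  have key x : x <= c + expR (- c) * expR x.
    rewrite -expRD -lerBlDl addrC [X in expR X]addrC.
    by apply: le_trans (expR_ge1Dx _); rewrite -subr_ge0; lra.
  have eS b : b = a \/ b = - a -> expR (b * Y j w) <= S w.
    move=> ba; rewrite /S (bigD1 j) //= -[leLHS]addr0; apply: lerD.
      case: ba => ->; first by rewrite lerDl expR_ge0.
      by rewrite lerDr expR_ge0.
    by apply: sumr_ge0 => k _; rewrite addr_ge0 ?expR_ge0.
  rewrite -[X in X * _](ger0_norm (ltW a0)) -normrM ler_norml.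
  apply/andP; split.
    rewrite lerNl -mulNr; apply: le_trans (key _) _.
    by rewrite lerD2l ler_wpM2l ?expR_ge0 // eS //; right.
  apply: le_trans (key _) _.
  by rewrite lerD2l ler_wpM2l ?expR_ge0 // eS //; left.
rewrite expectationD //; last 3 first.
- exact: measurable_funM.
- by move=> _; rewrite mulr_ge0 // invr_ge0 ltW.
- by move=> w; rewrite !mulr_ge0 ?expR_ge0 // invr_ge0 ltW.
rewrite expectation_cst expectationZ //; last first.
  by rewrite mulr_ge0 ?expR_ge0 // invr_ge0 ltW.
apply: (@le_trans _ _ ((a^-1 * c)%:E + (a^-1 * expR (- c))%:E * (expR c)%:E)%E).
  by rewrite leeD2l // lee_wpmul2l // lee_fin mulr_ge0 ?expR_ge0 // invr_ge0 ltW.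
rewrite -EFinM -EFinD lee_fin -mulrA expRN mulVf ?gt_eqF ?expR_gt0 //.
by rewrite -mulrDr mulrC.
Qed.

End expectation.

(** Follows from [(1 + v + 2 v^2)(1 - v) = 1 + v^2 (1 - 2 v) >= 1] and [1 + x <= e^x]. *)
Lemma expR_inv1B (R : realType) (v : R) : v <= 2^-1 ->
  (1 - v)^-1 <= expR (v + 2 * v ^+ 2).
Proof.
move=> v2; have v1 : 0 < 1 - v by lra.
rewrite -[leLHS]mul1r ler_pdivrMr //.
apply: (@le_trans _ _ ((1 + (v + 2 * v ^+ 2)) * (1 - v))); last first.
  by rewrite ler_wpM2r ?expR_ge1Dx // ltW.
nra.
Qed.

Section gaussian_family.
Context (R : realType) (d : measure_display) (T : measurableType d)
  (P : probability T R) (I : finType) (X : T -> rvec R I) (sigma : R).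
Hypothesis sigma0 : 0 < sigma.
Hypothesis mX : forall k, measurable_fun setT (fun w => X w k).
Hypothesis indepX : mutually_independent P (fun k w => X w k).
Hypothesis lawX : forall k (B : set R), measurable B ->
  P ((fun w => X w k) @^-1` B) = normal_prob 0 sigma B.

Lemma linear_mgf (b : I -> R) :
  (\int[P]_w (expR (\sum_k b k * X w k))%:E =
   (expR (sigma ^+ 2 * (\sum_k b k ^+ 2) / 2))%:E)%E.
Proof.
under eq_integral do rewrite expR_sum.
rewrite (@prod_integral _ _ _ _ _ _ mX indepX (fun k x => expR (b k * x))).
- rewrite (eq_bigr (fun k => (expR (b k ^+ 2 * sigma ^+ 2 / 2))%:E)).
    rewrite prodEFin -expR_sum -mulr_suml -mulr_suml.
    by rewrite [sigma ^+ 2 * _]mulrC.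
  by move=> k _; apply: gaussian_mgf => //; exact: lawX.
- move=> k; apply: measurableT_comp; first exact: measurable_expR.
  exact: measurable_funM.
- by move=> k x; exact: expR_ge0.
- exact: index_enum_uniq.
Qed.

Lemma gaussian_fmax (J : finType) (b : J -> I -> R) (t : R) : 0 < t ->
  (forall j, \sum_k b j k ^+ 2 <= t ^+ 2) ->
  (\int[P]_w (fmax (fun j => `|\sum_k b j k * X w k|))%:E
    <= (2 * sigma * t * Num.sqrt (ln (2 * #|J|%:R) + 1))%:E)%E.
Proof.
move=> t0 bt; set h := ln (2 * #|J|%:R) + 1.
have h1 : 1 <= h.
  rewrite lerDr; case: (posnP #|J|) => [->|J0]; first by rewrite mulr0 ln0.
  by rewrite ln_ge0 // -natrM ler1n muln_gt0.
have h0 : 0 < h by lra.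
have q0 : 0 < Num.sqrt h by rewrite sqrtr_gt0.
(* This choice makes the exponent [a^2 sigma^2 t^2 / 2] equal to [h / 2], of the same order as the
   logarithm of the cardinality, so the bound comes out as [(3/2) sigma t sqrt h]. *)
pose a := Num.sqrt h / (sigma * t).
have st0 : 0 < sigma * t by rewrite mulr_gt0.
have a0 : 0 < a by rewrite divr_gt0.
have bnd c j : c ^+ 2 = a ^+ 2 ->
    (\int[P]_w (expR (c * (\sum_k b j k * X w k)))%:E <= (expR (h / 2))%:E)%E.
  move=> ca; under eq_integral => w _.
    rewrite mulr_sumr; under eq_bigr do rewrite mulrA; over.
  rewrite (linear_mgf (fun k => c * b j k)) lee_fin ler_expR.
  rewrite ler_wpM2r ?invr_ge0 //.
  under eq_bigr do rewrite exprMn.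
  rewrite -mulr_sumr ca /a expr_div_n sqr_sqrtr ?(ltW h0) // exprMn.
  apply: (@le_trans _ _ (sigma ^+ 2 * (h / (sigma ^+ 2 * t ^+ 2) * t ^+ 2))).
    apply: ler_wpM2l; first exact: sqr_ge0.
    apply: ler_wpM2l => //; apply: divr_ge0; first exact: ltW.
    by rewrite mulr_ge0 // sqr_ge0.
  by rewrite le_eqVlt; apply/orP; left; apply/eqP; field; rewrite !gt_eqF.
have := @expectation_fmax R d T P J (fun j w => \sum_k b j k * X w k) a (h / 2).
move=> /(_ _ a0 _ _ _) H; apply: le_trans (H _ _ _ _) _.
- by move=> j; apply: measurable_rsum => k; exact: measurable_funM.
- by rewrite divr_ge0 ?ltW.
- by move=> j; apply: bnd.
- by move=> j; apply: bnd; rewrite sqrrN.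
rewrite lee_fin addrAC -/h /a invf_div.
have -> : (h + h / 2) * (sigma * t / Num.sqrt h) =
    3 / 2 * (sigma * t) * (h / Num.sqrt h) by field; rewrite gt_eqF.
have -> : h / Num.sqrt h = Num.sqrt h.
  by rewrite -[X in X / _](sqr_sqrtr (ltW h0)) expr2 mulfK // gt_eqF.
apply: ler_wpM2r; first exact: sqrtr_ge0.
by rewrite -[leRHS]mulrA; apply: ler_wpM2r; [exact: ltW|lra].
Qed.

(** Only finiteness matters here, for [dev_finite]; it is read off from [t x^2 <= e^(t x^2)] with
    [t] chosen so that [2 t sigma^2 = 1/2]. *)
Lemma gaussian_sqr_bound k : (\int[P]_w (X w k ^+ 2)%:E < +oo)%E.
Proof.
pose t := (4 * sigma ^+ 2)^-1.
have s2 : 0 < sigma ^+ 2 by rewrite exprn_gt0.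
have t0 : 0 < t by rewrite invr_gt0 mulr_gt0.
have tl : 2 * t * sigma ^+ 2 = 2^-1 by rewrite /t; field; rewrite gt_eqF.
apply: (@le_lt_trans _ _ (\int[P]_w (t^-1 * expR (t * X w k ^+ 2))%:E)%E).
  apply: le_expectation.
  - exact: measurable_funX.
  - apply: measurable_funM => //.
    apply: measurableT_comp; first exact: measurable_expR.
    by apply: measurable_funM => //; exact: measurable_funX.
  - by move=> w; exact: sqr_ge0.
  - move=> w; rewrite ler_pdivlMl //; apply: le_trans (expR_ge1Dx _).
    by rewrite lerDr.
rewrite expectationZ //; last 2 first.
- apply: measurableT_comp; first exact: measurable_expR.
  by apply: measurable_funM => //; exact: measurable_funX.
- by rewrite invr_ge0 ltW.
rewrite (gaussian_sqr_mgf (sigma := sigma)) //; first exact: ltry.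
- exact: lawX.
- by rewrite tl; lra.
Qed.

End gaussian_family.

Section chi_square.
Context (R : realType) (d : measure_display) (T : measurableType d)
  (P : probability T R) (J K : finType) (X : T -> rvec R (J * K)%type).
Hypothesis K0 : (0 < #|K|)%N.
Let sigma : R := Num.sqrt (#|K|%:R^-1).
Hypothesis mX : forall k, measurable_fun setT (fun w => X w k).
Hypothesis indepX : mutually_independent P (fun k w => X w k).
Hypothesis lawX : forall k (B : set R), measurable B ->
  P ((fun w => X w k) @^-1` B) = normal_prob 0 sigma B.

Let K0R : 0 < #|K|%:R :> R. Proof. by rewrite ltr0n. Qed.
Let sigma0 : 0 < sigma. Proof. by rewrite sqrtr_gt0 invr_gt0. Qed.
Let sigma2 : sigma ^+ 2 = #|K|%:R^-1.
Proof. by rewrite sqr_sqrtr // invr_ge0 ltW. Qed.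

Let msqr k : measurable_fun setT (fun w => X w k ^+ 2).
Proof. exact: measurable_funX. Qed.

(** With [u = a / #|K|] the integral is [e^(-u) / sqrt(1 - 2 u)], and its square is at most
    [e^(8 u^2)] by [expR_inv1B] at [v = 2 u]. That application is what restricts [a] to
    [#|K| / 4]. *)
Lemma centered_sqr_mgf (k : J * K) (a : R) : `|a| <= #|K|%:R / 4 ->
  (\int[P]_w (expR (a * (X w k ^+ 2 - #|K|%:R^-1)))%:E
    <= (expR (4 * (a / #|K|%:R) ^+ 2))%:E)%E.
Proof.
move=> aK; set u := a / #|K|%:R.
have u4 : `|u| <= 4^-1.
  by rewrite normrM normfV (gtr0_norm K0R) ler_pdivrMr // mulrC.
have [u4n u4p] : - 4^-1 <= u /\ u <= 4^-1 by move: u4; rewrite ler_norml => /andP.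
have E w : (expR (a * (X w k ^+ 2 - #|K|%:R^-1)))%:E =
    (expR (- u) * expR (a * X w k ^+ 2))%:E.
  by rewrite -expRD mulrBr addrC.
under eq_integral do rewrite E.
rewrite expectationZ ?expR_ge0 //; last first.
  apply: measurableT_comp; first exact: measurable_expR.
  exact: measurable_funM.
have ulin : 2 * a * sigma ^+ 2 = 2 * u by rewrite sigma2 /u mulrA.
rewrite (gaussian_sqr_mgf (sigma := sigma)) //; last 2 first.
- exact: lawX.
- by rewrite ulin; lra.
rewrite ulin -EFinM lee_fin.
have q0 : 0 < 1 - 2 * u by lra.
rewrite -(@ler_pXn2r _ 2) ?nnegrE ?mulr_ge0 ?expR_ge0 ?invr_ge0 ?sqrtr_ge0 //.
rewrite exprMn exprVn sqr_sqrtr ?(ltW q0) // -!expRM_natl.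
rewrite mulrC -ler_pdivlMr ?expR_gt0 // -expRN -expRD.
apply: le_trans (expR_inv1B _) _; first lra.
rewrite ler_expR; nra.
Qed.

Lemma chi_square_fmax : ln (2 * #|J|%:R) + 1 <= #|K|%:R :> R ->
  (\int[P]_w (fmax (fun j => `|\sum_(t : K) X w (j, t) ^+ 2 - 1|))%:E
    <= (5 * Num.sqrt ((ln (2 * #|J|%:R) + 1) / #|K|%:R))%:E)%E.
Proof.
set h := ln (2 * #|J|%:R) + 1 => hK.
have h1 : 1 <= h.
  rewrite lerDr; case: (posnP #|J|) => [->|J0]; first by rewrite mulr0 ln0.
  by rewrite ln_ge0 // -natrM ler1n muln_gt0.
have h0 : 0 < h by lra.
pose q := Num.sqrt (h / #|K|%:R).
have q2 : q ^+ 2 = h / #|K|%:R by rewrite sqr_sqrtr // divr_ge0 ?ltW.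
have q0 : 0 < q by rewrite sqrtr_gt0 divr_gt0.
have q1 : q <= 1.
  rewrite -(@ler_pXn2r _ 2) ?nnegrE ?(ltW q0) // q2 expr1n.
  by rewrite ler_pdivrMr // mul1r.
(* Since [q <= 1], this stays in the range of [centered_sqr_mgf]; the [#|K|] independent factors
   together give the exponent [4 #|K| (a / #|K|)^2 = h / 4], and [(h + h / 4) / a = 5 q]. *)
pose a := #|K|%:R * q / 4.
have a0 : 0 < a by rewrite divr_gt0 // mulr_gt0.
have bnd c j : `|c| = a ->
    (\int[P]_w (expR (c * (\sum_(t : K) X w (j, t) ^+ 2 - 1)))%:E
      <= (expR (h / 4))%:E)%E.
  move=> ca.
  have E w : \sum_(t : K) X w (j, t) ^+ 2 - 1 =
      \sum_(k <- [seq (j, t) | t <- enum K]) (X w k ^+ 2 - #|K|%:R^-1).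
    rewrite big_map big_enum /= sumrB; congr (_ - _).
    by rewrite sumr_const -[RHS]mulr_natl divff // gt_eqF.
  under eq_integral => w _.
    rewrite E mulr_sumr expR_sum; over.
  rewrite (@prod_integral _ _ _ _ _ _ mX indepX
    (fun k x => expR (c * (x ^+ 2 - #|K|%:R^-1)))); last 3 first.
  - move=> k; apply: measurableT_comp; first exact: measurable_expR.
    by apply: measurable_funM => //; exact: measurable_funB.
  - by move=> k x; exact: expR_ge0.
  - by rewrite map_inj_uniq ?enum_uniq // => x y [].
  apply: (@le_trans _ _ (\prod_(k <- [seq (j, t) | t <- enum K])
      (expR (4 * (c / #|K|%:R) ^+ 2))%:E)%E).
    elim: [seq _ | _ <- _] => [|k r IH]; first by rewrite !big_nil.
    rewrite !big_cons; apply: lee_pmul => //.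
    - by apply: integral_ge0 => w _; rewrite lee_fin expR_ge0.
    - elim: r {IH} => [|k' r IH]; first by rewrite big_nil.
      rewrite big_cons mule_ge0 //.
      by apply: integral_ge0 => w _; rewrite lee_fin expR_ge0.
    apply: centered_sqr_mgf; rewrite ca /a ler_pM2r ?invr_gt0 //.
    by rewrite ler_piMr // ltW.
  rewrite prodEFin lee_fin -expR_sum ler_expR big_map big_enum /= sumr_const.
  rewrite -[_ *+ _]mulr_natl expr_div_n -real_normK ?num_real // ca /a.
  rewrite le_eqVlt; apply/orP; left; apply/eqP.
  rewrite !exprMn q2; field; by rewrite !gt_eqF.
have := @expectation_fmax R d T P J
  (fun j w => \sum_(t : K) X w (j, t) ^+ 2 - 1) a (h / 4).
move=> /(_ _ a0 _ _ _) H; apply: le_trans (H _ _ _ _) _.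
- by move=> j; apply: measurable_funB => //; apply: measurable_rsum => t.
- by rewrite divr_ge0 ?ltW.
- by move=> j; apply: bnd; rewrite gtr0_norm.
- by move=> j; apply: bnd; rewrite normrN gtr0_norm.
rewrite lee_fin addrAC -/h -/q ler_pdivrMr //.
have -> : h = q ^+ 2 * #|K|%:R by rewrite q2 divfK // gt_eqF.
rewrite /a; nra.
Qed.

End chi_square.

(** * Maurey's empirical method and chaining *)

(** Averaged over a centred variable the linear term disappears, which leaves a subgaussian
    estimate. For [|x| <= 1/2] it reduces to [x^2 (1 - 2 x) >= 0] through [e^x <= 1 / (1 - x)];
    beyond that range cruder bounds suffice. *)
Lemma expR_le_id_sqr (R : realType) (x : R) : expR x <= x + expR (2 * x ^+ 2).
Proof.
have [x2|x2] := lerP x (- 2^-1).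
  have e1 : expR x <= 1 by rewrite expR_le1; lra.
  apply: (le_trans e1); apply: (@le_trans _ _ (x + (1 + 2 * x ^+ 2))); first nra.
  by rewrite lerD2l expR_ge1Dx.
have [y2|y2] := lerP x 2^-1; last first.
  apply: (@le_trans _ _ (expR (2 * x ^+ 2))); last by rewrite lerDr; lra.
  rewrite ler_expR; nra.
apply: (@le_trans _ _ (x + (1 + 2 * x ^+ 2))); last by rewrite lerD2l expR_ge1Dx.
have := @expR_ge1Dx R (- x) => h.
have e0 := expR_gt0 x.
have ee : expR x * expR (- x) = 1 by rewrite -expRD subrr expR0.
have x1 : 0 < 1 - x by lra.
have h1 : expR x * (1 - x) <= 1 by rewrite -[leRHS]ee ler_wpM2l ?(ltW e0).
rewrite -(ler_pM2r x1); apply: (le_trans h1).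
have : 0 <= x ^+ 2 * (1 - 2 * x) by rewrite mulr_ge0 ?sqr_ge0 //; lra.
by lra.
Qed.

Lemma le_average (R : realDomainType) (J : finType) (w f : J -> R) (M : R) :
  (forall j, 0 <= w j) -> \sum_j w j = 1 -> \sum_j w j * f j <= M ->
  exists j, f j <= M.
Proof.
move=> w0 w1 wf; apply/not_existsP => H.
have fM j : M < f j by rewrite ltNge; apply/negP; exact: H.
have Mw : M = \sum_j w j * M by rewrite -mulr_suml w1 mul1r.
have z : \sum_j w j * (f j - M) <= 0.
  under eq_bigr do rewrite mulrBr; by rewrite sumrB -Mw subr_le0.
have nn j : 0 <= w j * (f j - M) by rewrite mulr_ge0 // subr_ge0 ltW.
have zz : \sum_j w j * (f j - M) = 0.
  by apply/le_anti; rewrite z sumr_ge0.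
have wz j : w j = 0.
  have /(_ j erefl) wj0 := psumr_eq0P (fun j _ => nn j) zz.
  move/eqP: wj0; by rewrite mulf_eq0 [f j - M == 0]gt_eqF ?subr_gt0 // orbF => /eqP.
by move: w1 => /eqP; rewrite big1 // eq_sym oner_eq0.
Qed.

(** * Symmetric positive semidefinite bilinear forms *)

Section psd_form.
Context (R : realType) (V : lmodType R) (b : V -> V -> R).
Hypothesis bD : forall x y z, b (x + y) z = b x z + b y z.
Hypothesis bZ : forall k x z, b (k *: x) z = k * b x z.
Hypothesis bC : forall x y, b x y = b y x.
Hypothesis b0 : forall x, 0 <= b x x.

Lemma formDr x y z : b x (y + z) = b x y + b x z.
Proof. by rewrite bC bD !(bC _ x). Qed.

Lemma formZr k x y : b x (k *: y) = k * b x y.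
Proof. by rewrite bC bZ bC. Qed.

Lemma formNl x y : b (- x) y = - b x y.
Proof. by rewrite -scaleN1r bZ mulN1r. Qed.

Lemma formNr x y : b x (- y) = - b x y.
Proof. by rewrite bC formNl bC. Qed.

Lemma form0l y : b 0 y = 0.
Proof. by rewrite -(scale0r (0 : V)) bZ mul0r. Qed.

Lemma form_suml (J : Type) (r : seq J) (F : J -> V) y :
  b (\sum_(j <- r) F j) y = \sum_(j <- r) b (F j) y.
Proof.
elim: r => [|j r IH]; first by rewrite !big_nil form0l.
by rewrite !big_cons bD IH.
Qed.

Lemma form_sqrD x y : b (x + y) (x + y) = b x x + 2 * b x y + b y y.
Proof. by rewrite bD !formDr (bC y x); ring. Qed.

Lemma form_sqrD_le x y : b (x + y) (x + y) <= 2 * b x x + 2 * b y y.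
Proof.
have := b0 (x - y); rewrite form_sqrD form_sqrD formNr formNl formNr opprK; lra.
Qed.

Lemma form_normM_le x y : 2 * `|b x y| <= b x x + b y y.
Proof.
have h1 := b0 (x - y); have h2 := b0 (x + y).
rewrite form_sqrD formNr formNl formNr opprK in h1.
rewrite form_sqrD in h2.
by case: (ger0P (b x y)) => _; lra.
Qed.

Lemma form_CauchySchwarz x y : b x y ^+ 2 <= b x x * b y y.
Proof.
have h t : 0 <= b x x + 2 * t * b x y + t ^+ 2 * b y y.
  have := b0 (x + t *: y); rewrite form_sqrD !(bZ, formZr); lra.
have [yy|yy] := eqVneq (b y y) 0.
  rewrite yy mulr0; have [->|xy] := eqVneq (b x y) 0; first by rewrite expr0n.
  (* When [b y y = 0] the polynomial is affine in [t]; this [t] gives it the value [-1]. *)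
  have := h (- (b x x + 1) / (2 * b x y)); rewrite yy mulr0 addr0.
  have -> : 2 * (- (b x x + 1) / (2 * b x y)) * b x y = - (b x x + 1) by field.
  lra.
have y0 : 0 < b y y by rewrite lt_def yy b0.
have := h (- b x y / b y y).
have -> : b x x + 2 * (- b x y / b y y) * b x y + (- b x y / b y y) ^+ 2 * b y y
   = (b x x * b y y - b x y ^+ 2) / b y y by field.
by rewrite pmulr_lge0 ?invr_gt0 // subr_ge0.
Qed.

End psd_form.

(** The signed vertices of the l1 ball of radius [rho], together with its centre [None], which
    receives the weight left over when the l1 norm of the target is below [rho]. *)
Definition atom (R : realType) (N : nat) (rho : R)
    (o : option ('I_N * bool)) : 'cV[R]_N :=
  if o is Some (c, s) then ((-1) ^+ s * rho) *: delta_mx c 0 else 0.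

Section maurey.
Context (R : realType) (N : nat) (A : finType)
  (b : A -> 'cV[R]_N -> 'cV[R]_N -> R).
Hypothesis bD : forall a x y z, b a (x + y) z = b a x z + b a y z.
Hypothesis bZ : forall a k x z, b a (k *: x) z = k * b a x z.
Hypothesis bC : forall a x y, b a x y = b a y x.
Hypothesis b0 : forall a x, 0 <= b a x x.
Hypothesis b1 : forall a c, b a (delta_mx c 0) (delta_mx c 0) <= 1.

(** Expanding both arguments in coordinates leaves the values of the form at pairs of unit vectors,
    which [form_normM_le] and [b1] bound by 1 in absolute value. *)
Lemma form_l1_bound a (x : 'cV[R]_N) :
  b a x x <= (\sum_c `|x c 0|) ^+ 2.
Proof.
have dx : x = \sum_c x c 0 *: delta_mx c 0.
  by rewrite [LHS]matrix_sum_delta; apply: eq_bigr => c _; rewrite big_ord1.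
rewrite [in X in X <= _]dx (form_suml (bD a) (bZ a)).
rewrite expr2 mulr_suml; apply: ler_sum => c _.
rewrite (bC a) (form_suml (bD a) (bZ a)).
rewrite mulr_sumr; apply: ler_sum => e _.
rewrite bZ (bC a) bZ mulrCA.
apply: (le_trans (ler_norm _)); rewrite !normrM mulrA [`|_| * `|_|]mulrC.
rewrite ler_piMr ?mulr_ge0 //.
have := form_normM_le (bD a) (bZ a) (bC a) (b0 a) (delta_mx c 0) (delta_mx e 0).
by have := b1 a c; have := b1 a e; lra.
Qed.

Lemma atom_form a rho o : b a (atom rho o) (atom rho o) <= rho ^+ 2.
Proof.
case: o => [[c s]|] /=; last by rewrite (form0l (bZ a)) sqr_ge0.
rewrite bZ (bC a) bZ mulrA -expr2 exprMn sqrr_sign mul1r.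
by rewrite -[leRHS]mulr1 ler_wpM2l ?sqr_ge0.
Qed.

(** Positive and negative parts of the coordinates divided by [rho]: the probabilities for which [x]
    is the mean of a random atom. *)
Definition atom_weight (rho : R) (x : 'cV[R]_N) (o : option ('I_N * bool)) : R :=
  if o is Some (c, s) then (`|x c 0| + (-1) ^+ s * x c 0) / (2 * rho)
  else 1 - (\sum_c `|x c 0|) / rho.

Lemma sum_atoms (W : zmodType) (F : option ('I_N * bool) -> W) :
  \sum_o F o = F None + \sum_(c < N) (F (Some (c, false)) + F (Some (c, true))).
Proof.
rewrite (bigD1 None) //=; congr (_ + _).
transitivity (\sum_(z : 'I_N * bool) F (Some z)).
  rewrite (reindex_omap Some id) /=; first by apply: eq_bigl => z; rewrite eqxx.
  by case.
rewrite (eq_bigr (fun z => F (Some (z.1, z.2)))); last by case.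
rewrite -(pair_bigA _ (fun c s => F (Some (c, s)))) /=.
by apply: eq_bigr => c _; rewrite big_bool addrC.
Qed.

Lemma atom_weight_ge0 rho (x : 'cV[R]_N) o : 0 < rho -> \sum_c `|x c 0| <= rho ->
  0 <= atom_weight rho x o.
Proof.
move=> r0 xr; case: o => [[c s]|] /=; last first.
  by rewrite subr_ge0 ler_pdivrMr // mul1r.
apply: divr_ge0; last by rewrite mulr_ge0 ?ltW.
have := ler_norm (x c 0); have := ler_norm (- x c 0); rewrite normrN.
by case: s; rewrite /= ?expr0 ?expr1; lra.
Qed.

Lemma atom_weight_sum rho (x : 'cV[R]_N) : 0 < rho -> \sum_o atom_weight rho x o = 1.
Proof.
move=> r0; rewrite sum_atoms /= [X in _ + X](_ : _ = (\sum_c `|x c 0|) / rho).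
  by rewrite subrK.
rewrite mulr_suml; apply: eq_bigr => c _.
by rewrite expr0 expr1; field; rewrite gt_eqF.
Qed.

Lemma atom_weight_mean rho (x : 'cV[R]_N) : 0 < rho ->
  \sum_o atom_weight rho x o *: atom rho o = x.
Proof.
move=> r0; rewrite sum_atoms /= scaler0 add0r.
rewrite [RHS]matrix_sum_delta; apply: eq_bigr => c _; rewrite big_ord1.
rewrite !scalerA -scalerDl; congr (_ *: _).
by rewrite expr0 expr1; field; rewrite gt_eqF.
Qed.

(* Averaging [exp (c Q (S + D))] over a centred random atom [D] costs a factor
   [exp (c B)] and inflates the exponent [c] to [c + 8 B c ^ 2]. *)
Lemma potential_step rho (x : 'cV[R]_N) (S : 'cV[R]_N) (c : R) :
  0 < rho -> \sum_c `|x c 0| <= rho -> 0 <= c ->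
  exists o, \sum_a expR (c * b a (S + (atom rho o - x)) (S + (atom rho o - x)))
   <= expR (c * (4 * rho ^+ 2)) *
      \sum_a expR (c * (1 + 8 * c * (4 * rho ^+ 2)) * b a S S).
Proof.
move=> r0 xr c0; set B := 4 * rho ^+ 2.
have B0 : 0 <= B by rewrite mulr_ge0 // sqr_ge0.
pose w := atom_weight rho x.
apply: (@le_average _ _ w).
- by move=> o; exact: atom_weight_ge0.
- exact: atom_weight_sum.
under eq_bigr do rewrite mulr_sumr.
rewrite exchange_big mulr_sumr; apply: ler_sum => a _ /=.
have DB o : b a (atom rho o - x) (atom rho o - x) <= B.
  apply: le_trans (form_sqrD_le (bD a) (bZ a) (bC a) (b0 a) _ _) _.
  rewrite (formNl (bZ a)) (formNr (bZ a) (bC a)) opprK.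
  have h1 := atom_form a rho o; have h2 := form_l1_bound a x.
  have h3 : (\sum_c `|x c 0|) ^+ 2 <= rho ^+ 2.
    by rewrite ler_pXn2r ?nnegrE ?(ltW r0) // sumr_ge0.
  by rewrite /B; lra.
(* The cross term in the expansion of the square. It averages to 0 over the atoms, so
   [expR_le_id_sqr] and Cauchy-Schwarz bound the mean of [e^t] by [e^(8 c^2 B b(S, S))]. *)
pose t o := 2 * c * b a S (atom rho o - x).
have tmean : \sum_o w o * t o = 0.
  under eq_bigr do rewrite /t mulrCA; rewrite -mulr_sumr.
  rewrite (_ : \sum_o _ = b a S (\sum_o w o *: (atom rho o - x))).
    under eq_bigr do rewrite scalerBr; rewrite sumrB atom_weight_mean //.
    rewrite -scaler_suml atom_weight_sum // scale1r subrr.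
    by rewrite (bC a) (form0l (bZ a)) mulr0.
  rewrite (bC a) (form_suml (bD a) (bZ a)).
  by apply: eq_bigr => o _; rewrite bZ (bC a).
have w0 o : 0 <= w o by exact: atom_weight_ge0.
apply: (@le_trans _ _ (expR (c * b a S S + c * B) * \sum_o w o * expR (t o))).
  rewrite mulr_sumr; apply: ler_sum => o _; rewrite mulrCA.
  rewrite ler_wpM2l // -expRD ler_expR.
  rewrite (form_sqrD (bD a) (bC a)) /t.
  have := ler_wpM2l c0 (DB o); lra.
have st : \sum_o w o * expR (t o) <= expR (8 * c ^+ 2 * b a S S * B).
  apply: (@le_trans _ _ (\sum_o (w o * t o + w o * expR (8 * c ^+ 2 * b a S S * B)))).
    apply: ler_sum => o _; rewrite -mulrDr ler_wpM2l //.
    apply: le_trans (expR_le_id_sqr _) _; rewrite lerD2l ler_expR.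
    have := form_CauchySchwarz (bD a) (bZ a) (bC a) (b0 a) S (atom rho o - x).
    have := ler_wpM2l (b0 a S) (DB o).
    rewrite /t; set u := b a S (atom rho o - x) => h1 h2.
    have h3 : u ^+ 2 <= b a S S * B by lra.
    have := ler_wpM2l (sqr_ge0 c) h3; rewrite !exprMn; lra.
  by rewrite big_split /= tmean add0r -mulr_suml atom_weight_sum // mul1r.
apply: (le_trans (ler_wpM2l (expR_ge0 _) st)).
rewrite -!expRD ler_expR le_eqVlt; apply/orP; left; apply/eqP; ring.
Qed.

Definition net_point (rho : R) (k : nat) (t : seq (option ('I_N * bool))) :
  'cV[R]_N := k%:R^-1 *: \sum_(o <- t) atom rho o.

(** The atoms are chosen one after another, each keeping the exponential potential summed over all
    forms small. A single average thus serves all forms at once, and their number enters only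
    through its logarithm. *)
Lemma maurey rho (x : 'cV[R]_N) (k : nat) :
  0 < rho -> \sum_c `|x c 0| <= rho -> (0 < k)%N -> (0 < #|A|)%N ->
  exists t : k.-tuple (option ('I_N * bool)), forall a,
    b a (x - net_point rho k t) (x - net_point rho k t)
      <= 64 * rho ^+ 2 * (ln #|A|%:R + 1) / k%:R.
Proof.
move=> r0 xr k0 A0; set B := 4 * rho ^+ 2.
have B0 : 0 < B by rewrite mulr_gt0 // exprn_gt0.
have kR : 0 < k%:R :> R by rewrite ltr0n.
(* Because [n (n + 2) <= (n + 1)^2] for [n = k + l], the exponent [c l.+1] is still at most [c l]
   after the inflation in [potential_step]. Each step costs a factor of at most [e^(1 / (8 k))],
   hence [e^(1/8)] over all [k] steps. *)
pose c l : R := (8 * B * (k + l)%:R)^-1.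
have kl l : 0 < (k + l)%:R :> R by rewrite ltr0n addn_gt0 k0.
have c_gt0 l : 0 < c l by rewrite invr_gt0 !mulr_gt0.
have step l : (l <= k)%N -> exists2 t : seq (option ('I_N * bool)), size t = l &
   \sum_a expR (c l * b a (\sum_(o <- t) (atom rho o - x))
                          (\sum_(o <- t) (atom rho o - x)))
   <= #|A|%:R * expR (l%:R / (8 * k%:R)).
  elim: l => [_|l IH lk].
    exists [::] => //; rewrite mul0r expR0 mulr1.
    under eq_bigr => a _ do rewrite big_nil (form0l (bZ a)) mulr0 expR0.
    by rewrite sumr_const.
  have [t st Pt] := IH (ltnW lk).
  have [y Py] := potential_step (\sum_(o <- t) (atom rho o - x)) r0 xr
     (ltW (c_gt0 l.+1)).
  exists (rcons t y); first by rewrite size_rcons st.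
  under eq_bigr do rewrite -cats1 big_cat /= big_seq1.
  apply: (le_trans Py); rewrite -/B.
  have -> : l.+1%:R / (8 * k%:R) = l%:R / (8 * k%:R) + (8 * k%:R)^-1 :> R.
    by rewrite -natr1 mulrDl mul1r.
  rewrite expRD mulrA [leRHS]mulrC.
  have n0 := kl l.
  have nS : (k + l.+1)%:R = (k + l)%:R + 1 :> R by rewrite addnS natr1.
  have kn : k%:R <= (k + l)%:R :> R by rewrite ler_nat leq_addr.
  apply: ler_pM; rewrite ?expR_ge0 ?sumr_ge0 //.
  - rewrite ler_expR /c nS.
    have -> : (8 * B * ((k + l)%:R + 1))^-1 * B = (8 * ((k + l)%:R + 1))^-1.
      by field; rewrite !gt_eqF //; lra.
    by rewrite lef_pV2 ?posrE ?mulr_gt0 //; lra.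
  - apply: le_trans Pt; apply: ler_sum => a _; rewrite ler_expR.
    apply: ler_wpM2r => //.
    rewrite /c nS; set n := (k + l)%:R.
    have -> : (8 * B * (n + 1))^-1 * (1 + 8 * (8 * B * (n + 1))^-1 * B) =
       (8 * B)^-1 * ((n + 2) / (n + 1) ^+ 2).
      by field; rewrite !gt_eqF //; rewrite /n; lra.
    rewrite [(8 * B * n)^-1]invfM; apply: ler_wpM2l; first by rewrite invr_ge0 mulr_ge0 // ltW.
    rewrite ler_pdivrMr ?exprn_gt0 //; last by rewrite /n; lra.
    rewrite mulrC ler_pdivlMr //; rewrite -/n; nra.
have [t st Pt] := step k (leqnn k).
exists (Tuple (introT eqP st)) => a; rewrite /net_point /=.
set S := \sum_(o <- t) (atom rho o - x) in Pt.
have -> : x - k%:R^-1 *: (\sum_(o <- t) atom rho o) = - (k%:R^-1 *: S).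
  rewrite /S sumrB big_const_seq count_predT st iter_addr_0.
  rewrite scalerBr -[x *+ k]scaler_nat scalerA mulVf ?gt_eqF // scale1r opprB //.
rewrite (formNl (bZ a)) (formNr (bZ a) (bC a)) opprK bZ (bC a) bZ.
have Sa : c k * b a S S <= ln #|A|%:R + 1.
  have AR : 0 < #|A|%:R :> R by rewrite ltr0n.
  rewrite -ler_expR expRD lnK ?posrE //.
  apply: (@le_trans _ _ (#|A|%:R * expR (k%:R / (8 * k%:R)))).
    apply: le_trans Pt; rewrite (bigD1 a) //= lerDl.
    by apply: sumr_ge0 => e _; exact: expR_ge0.
  rewrite ler_wpM2l ?(ltW AR) // ler_expR.
  have -> : k%:R / (8 * k%:R) = 8^-1 :> R by field; rewrite gt_eqF.
  lra.
have ck : c k = (64 * rho ^+ 2 * k%:R)^-1.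
  by rewrite /c /B natrD; congr (_^-1); ring.
rewrite ck mulrC ler_pdivrMr ?mulr_gt0 ?exprn_gt0 // in Sa.
rewrite mulrA -expr2 mulrC ler_pdivlMr // exprVn.
apply: le_trans (_ : b a S S / k%:R <= _).
  by rewrite le_eqVlt; apply/orP; left; apply/eqP; field; rewrite gt_eqF.
by rewrite ler_pdivrMr //; lra.
Qed.

End maurey.

(** * Chaining a Gaussian process along the Maurey nets *)

Section chaining.
Context (R : realType) (d : measure_display) (T : measurableType d)
  (P : probability T R) (I : finType) (X : T -> rvec R I) (sigma : R).
Hypothesis sigma0 : 0 < sigma.
Hypothesis mX : forall k, measurable_fun setT (fun w => X w k).
Hypothesis indepX : mutually_independent P (fun k w => X w k).
Hypothesis lawX : forall k (B : set R), measurable B ->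
  P ((fun w => X w k) @^-1` B) = normal_prob 0 sigma B.

Context (N : nat) (A : finType) (b : A -> 'cV[R]_N -> 'cV[R]_N -> R).
Hypothesis bD : forall a x y z, b a (x + y) z = b a x z + b a y z.
Hypothesis bZ : forall a k x z, b a (k *: x) z = k * b a x z.
Hypothesis bC : forall a x y, b a x y = b a y x.
Hypothesis b0 : forall a x, 0 <= b a x x.
Hypothesis b1 : forall a c, b a (delta_mx c 0) (delta_mx c 0) <= 1.
Hypothesis A0 : (0 < #|A|)%N.
Hypothesis N0 : (0 < N)%N.

Context (U : finType) (good : pred U) (vec : U -> 'cV[R]_N) (u0 : U)
  (rho D : R) (f : U -> I -> R).
Hypothesis good0 : good u0.
Hypothesis vec0 : vec u0 = 0.
Hypothesis f0 : forall k, f u0 k = 0.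
Hypothesis rho0 : 0 < rho.
Hypothesis D0 : 0 < D.
Hypothesis vec_l1 : forall u, good u -> \sum_c `|vec u c 0| <= rho.
Hypothesis f_lip : forall u v t, good u -> good v -> 0 <= t ->
  (forall a, b a (vec u - vec v) (vec u - vec v) <= t ^+ 2) ->
  \sum_k (f u k - f v k) ^+ 2 <= (D * t) ^+ 2.

Let La : R := ln #|A|%:R + 1.
Let LN : R := ln (2 * N + 1)%:R.
(** The precision that [maurey] guarantees with [4 ^ j] atoms. *)
Let eps (j : nat) : R := 8 * rho * Num.sqrt La / 2 ^+ j.

Let La1 : 1 <= La. Proof. by rewrite lerDr ln_ge0 // ler1n. Qed.

Let sLa1 : 1 <= Num.sqrt La.
Proof. by rewrite -[leLHS]sqrtr1 ler_sqrt // (le_trans ler01 La1). Qed.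

Let eps_gt0 j : 0 < eps j.
Proof.
by rewrite divr_gt0 ?exprn_gt0 // !mulr_gt0 // (lt_le_trans ltr01 sLa1).
Qed.

Let eps_sqr j : eps j ^+ 2 = 64 * rho ^+ 2 * La / (4 ^ j)%:R.
Proof.
have La0 : 0 <= La := le_trans ler01 La1.
rewrite /eps expr_div_n !exprMn sqr_sqrtr // natrX -exprM mulnC exprM.
have -> : 2 ^+ 2 = 4 :> R by ring.
by have -> : 8 ^+ 2 = 64 :> R by ring.
Qed.

Let epsS j : eps j.+1 = eps j / 2.
Proof. by rewrite /eps exprS; field; rewrite expf_neq0. Qed.

Let LN_ge : 2^-1 <= LN.
Proof.
rewrite -ler_expR lnK ?posrE ?ltr0n ?addn1 //.
apply: (@le_trans _ _ 2); last first.
  by rewrite ler_nat; move: N0; lia.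
have h := @expR_ge1Dx R (- 2^-1).
have e : expR (- 2^-1) * expR 2^-1 = 1 :> R by rewrite -expRD addNr expR0.
have := @expR_gt0 R 2^-1; nra.
Qed.

(** The process exists only on [U], so each Maurey point is replaced by some good index close to it,
    when there is one; this doubles the radius. Level 0 needs only [u0], as the whole l1 ball lies
    within [2 * eps 0] of the origin. *)
Lemma chaining_net j : exists r : (4 ^ j).-tuple (option ('I_N * bool)) -> U,
  [/\ forall t, good (r t),
      forall u, good u -> exists t, forall a,
        b a (vec u - vec (r t)) (vec u - vec (r t)) <= (2 * eps j) ^+ 2 &
      j = 0%N -> forall t, r t = u0].
Proof.
case: j => [|j].
  exists (fun=> u0); split => // u gu.
  exists [tuple of nseq (4 ^ 0) None] => a; rewrite vec0 subr0.
  apply: (le_trans (form_l1_bound bD bZ bC b0 b1 a (vec u))).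
  rewrite ler_pXn2r ?nnegrE ?sumr_ge0 //; last by rewrite mulr_ge0 // ltW.
  apply: (le_trans (vec_l1 gu)); rewrite /eps expr0 divr1.
  have : rho <= rho * Num.sqrt La by rewrite ler_peMr // ltW.
  by have := rho0; nra.
pose k := (4 ^ j.+1)%N.
have k0 : (0 < k)%N by rewrite expn_gt0.
pose close (t : k.-tuple (option ('I_N * bool))) u := `[< forall a,
  b a (vec u - net_point rho k t) (vec u - net_point rho k t) <= eps j.+1 ^+ 2 >].
pose r t := if [pick u | good u && close t u] is Some u then u else u0.
exists r; split => //.
  by move=> t; rewrite /r; case: pickP => [u /andP[]|].
move=> u gu.
have [t Ht] := maurey bD bZ bC b0 b1 rho0 (vec_l1 gu) k0 A0.
have ct : close t u.
  by apply/asboolP => a; rewrite eps_sqr; exact: Ht.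
exists t => a; rewrite /r; case: pickP => [v /andP[gv /asboolP cv]|]; last first.
  by move=> /(_ u); rewrite gu ct.
have -> : vec u - vec v =
    (vec u - net_point rho k t) + - (vec v - net_point rho k t).
  by rewrite opprB addrA subrK.
apply: le_trans (form_sqrD_le (bD a) (bZ a) (bC a) (b0 a) _ _) _.
rewrite [X in _ + 2 * X](formNl (bZ a)) (formNr (bZ a) (bC a)) opprK.
have h1 := cv a; have h2 := asboolP _ ct a.
rewrite exprMn; lra.
Qed.

Let r j := sval (cid (chaining_net j)).
Arguments r : clear implicits.
Let r_good j t : good (r j t).
Proof. by rewrite /r; case: cid => q [] /=. Qed.
Let r_near j u : good u -> exists t, forall a,
  b a (vec u - vec (r j t)) (vec u - vec (r j t)) <= (2 * eps j) ^+ 2.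
Proof. by rewrite /r; case: cid => q [? h ?] /=; exact: h. Qed.
Let r_zero t : r 0 t = u0.
Proof. by rewrite /r; case: cid => q [? ? h] /=; exact: h. Qed.

Let near j u : (4 ^ j).-tuple (option ('I_N * bool)) :=
  if pselect (good u) is left gu then sval (cid (r_near j gu))
  else [tuple of nseq (4 ^ j) None].
Let nearP j u : good u -> forall a,
  b a (vec u - vec (r j (near j u))) (vec u - vec (r j (near j u)))
    <= (2 * eps j) ^+ 2.
Proof. by rewrite /near; case: pselect => // gu _; case: cid. Qed.

Let g u w := \sum_k f u k * X w k.

Let mg u : measurable_fun setT (g u).
Proof. by apply: measurable_rsum => k; exact: measurable_funM. Qed.

(** Pairs too distant to be consecutive points of a chain get the zero process. The maximum can then
    run over all pairs of tuples, whose number is explicit, with a uniform variance bound. Actual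
    hops satisfy [2 eps_j^2 + 8 eps_j^2 <= (4 eps_j)^2]. *)
Let link j (t : (4 ^ j.+1).-tuple (option ('I_N * bool)) *
                (4 ^ j).-tuple (option ('I_N * bool))) (k : I) : R :=
  if `[< forall a, b a (vec (r j.+1 t.1) - vec (r j t.2))
                       (vec (r j.+1 t.1) - vec (r j t.2)) <= (4 * eps j) ^+ 2 >]
  then f (r j.+1 t.1) k - f (r j t.2) k else 0.

Let level j w := fmax (fun t => `|\sum_k @link j t k * X w k|).
Let last_hop J w := fmax (fun u => `|\sum_k
  (if good u then f u k - f (r J (near J u)) k else 0) * X w k|).

Let mlevel j : measurable_fun setT (level j).
Proof.
apply: measurable_fmax => t; apply: measurableT_comp => //.
by apply: measurable_rsum => k; exact: measurable_funM.
Qed.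

Let mlast J : measurable_fun setT (last_hop J).
Proof.
apply: measurable_fmax => t; apply: measurableT_comp => //.
by apply: measurable_rsum => k; exact: measurable_funM.
Qed.

(** There are [(2 N + 1)^(5 4^j)] pairs, so the root of the entropy grows like [2^j] and cancels the
    decay of [eps j]: all scales have the same bound. The constant is [192 = 2 . 4 . 8 . 3]. *)
Let level_bound j : (\int[P]_w (level j w)%:E <=
  (192 * (sigma * D * rho * Num.sqrt La * Num.sqrt LN))%:E)%E.
Proof.
have t0 := mulr_gt0 D0 (mulr_gt0 (ltr0Sn R 3) (eps_gt0 j)).
apply: le_trans (gaussian_fmax sigma0 mX indepX lawX t0 _) _.
  move=> t; rewrite /link; case: asboolP => [H|_]; last first.
    by rewrite big1 ?sqr_ge0 // => k _; rewrite expr0n.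
  by apply: f_lip => //; rewrite mulr_ge0 // ltW.
rewrite lee_fin card_prod !card_tuple card_option card_prod card_ord card_bool.
have M0 : 0 < (2 * N + 1)%:R :> R by rewrite ltr0n addn1.
have -> : (N * 2).+1 = (2 * N + 1)%N by rewrite addn1 mulnC.
rewrite -expnD natrX lnM ?posrE ?exprn_gt0 // lnXn // -/LN -[LN *+ _]mulr_natr.
have p0 : 0 < 2 ^+ j :> R by rewrite exprn_gt0.
have p4 : (4 ^ j.+1 + 4 ^ j)%:R = 5 * (2 ^+ j) ^+ 2 :> R.
  rewrite natrD !natrX exprS -exprM mulnC exprM.
  by rewrite (_ : 2 ^+ 2 = 4 :> R); ring.
rewrite p4.
have p1 : 1 <= (2 ^+ j) ^+ 2 :> R by rewrite -exprM exprn_ege1 // ler1n.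
have l2 : ln 2 <= 1 :> R.
  by have := @le_ln1Dx R 1; rewrite (_ : 1 + 1 = 2) //; apply; lra.
have sq : Num.sqrt (ln 2 + LN * (5 * (2 ^+ j) ^+ 2) + 1)
    <= 3 * 2 ^+ j * Num.sqrt LN.
  have LNh := LN_ge; have LN0 : 0 <= LN by apply: le_trans LNh; rewrite invr_ge0.
  have l20 : 0 <= ln 2 :> R by rewrite ln_ge0 // ler1n.
  set e := (2 ^+ j) ^+ 2 in p1 *; set l := LN in LNh LN0 *.
  have h : 2^-1 <= e * l by nra.
  rewrite -(@ler_pXn2r _ 2) ?nnegrE ?sqrtr_ge0 //.
  rewrite sqr_sqrtr; last by lra.
  rewrite !exprMn sqr_sqrtr // -/e; lra.
apply: (le_trans (ler_wpM2l _ sq)).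
  by apply: mulr_ge0; [rewrite mulr_ge0 // ltW|exact: ltW].
rewrite le_eqVlt; apply/orP; left; apply/eqP.
rewrite /eps; field; by rewrite expf_neq0.
Qed.

Let last_bound J : (\int[P]_w (last_hop J w)%:E <=
  (32 * (sigma * D * rho * Num.sqrt La
     * (Num.sqrt (ln (2 * #|U|%:R) + 1) / 2 ^+ J)))%:E)%E.
Proof.
have t0 := mulr_gt0 D0 (mulr_gt0 (ltr0Sn R 1) (eps_gt0 J)).
apply: le_trans (gaussian_fmax sigma0 mX indepX lawX t0 _) _.
  move=> u; case: (boolP (good u)) => [gu|_]; last first.
    by rewrite big1 ?sqr_ge0 // => k _; rewrite expr0n.
  by apply: f_lip => //; [rewrite mulr_ge0 // ltW | exact: nearP].
rewrite lee_fin le_eqVlt; apply/orP; left; apply/eqP.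
rewrite /eps; field; by rewrite expf_neq0.
Qed.

(** The increments telescope from [u0], where the process vanishes, through the points chosen near
    [u] at levels up to [J], and then jump to [u] itself. The last jump pays for the cardinality of
    [U], but at a radius reduced by [2^J]. *)
Lemma chaining (J : nat) :
  (\int[P]_w (fmax (fun u => if good u then `|\sum_k f u k * X w k| else 0))%:E
   <= (sigma * D * rho * Num.sqrt La *
        (192 * J%:R * Num.sqrt LN
          + 32 * (Num.sqrt (ln (2 * #|U|%:R) + 1) / 2 ^+ J)))%:E)%E.
Proof.
have ptw w : fmax (fun u => if good u then `|g u w| else 0) <=
    \sum_(j < J) level j w + last_hop J w.
  apply: fmax_le => [|u].
    rewrite addr_ge0 ?fmax_ge0 // sumr_ge0 // => j _; exact: fmax_ge0.
  case: ifPn => [gu|_]; last first.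
    rewrite addr_ge0 ?fmax_ge0 // sumr_ge0 // => j _; exact: fmax_ge0.
  have tel K : `|g (r K (near K u)) w| <= \sum_(j < K) level j w.
    elim: K => [|K IH].
      rewrite big_ord0 r_zero /g big1 ?normr0 // => k _.
      by rewrite f0 mul0r.
    rewrite big_ord_recr /=.
    have -> : g (r K.+1 (near K.+1 u)) w = g (r K (near K u)) w +
        (g (r K.+1 (near K.+1 u)) w - g (r K (near K u)) w) by ring.
    apply: (le_trans (ler_normD _ _)); apply: lerD => //.
    have := le_fmax (fun t => `|\sum_k @link K t k * X w k|)
      (near K.+1 u, near K u).
    apply: le_trans; rewrite le_eqVlt; apply/orP; left; apply/eqP; congr (`|_|).
    rewrite /g -sumrB; apply: eq_bigr => k _; rewrite /link /=.
    case: asboolP => [_|]; first by rewrite mulrBl.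
    case=> a.
    have -> : vec (r K.+1 (near K.+1 u)) - vec (r K (near K u)) =
       - (vec u - vec (r K.+1 (near K.+1 u))) + (vec u - vec (r K (near K u))).
      by rewrite opprB addrA subrK.
    apply: le_trans (form_sqrD_le (bD a) (bZ a) (bC a) (b0 a) _ _) _.
    rewrite [X in 2 * X + _](formNl (bZ a)) (formNr (bZ a) (bC a)) opprK.
    move: (epsS K) (nearP K.+1 gu a) (nearP K gu a).
    move: (eps K) (eps K.+1) => e _ -> h1 h2.
    by have := sqr_ge0 e; lra.
  have -> : g u w = g (r J (near J u)) w + (g u w - g (r J (near J u)) w) by ring.
  apply: (le_trans (ler_normD _ _)); apply: lerD => //.
  have := le_fmax (fun u => `|\sum_k
    (if good u then f u k - f (r J (near J u)) k else 0) * X w k|) u.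
  apply: le_trans; rewrite le_eqVlt; apply/orP; left; apply/eqP; congr (`|_|).
  by rewrite /g -sumrB; apply: eq_bigr => k _; rewrite gu mulrBl.
have msum : measurable_fun setT (fun w => \sum_(j < J) level j w).
  by apply: measurable_rsum => j; exact: mlevel.
apply: le_trans (le_expectation P _ _ _ ptw) _.
- apply: measurable_fmax => u; case: (good u) => //.
  exact: measurableT_comp.
- exact: measurable_funD.
- by move=> w; exact: fmax_ge0.
rewrite expectationD //; last 2 first.
- by move=> w; apply: sumr_ge0 => j _; exact: fmax_ge0.
- by move=> w; exact: fmax_ge0.
rewrite expectation_sum //; last by move=> j w; exact: fmax_ge0.
apply: (@le_trans _ _ (\sum_(j < J)
    (192 * (sigma * D * rho * Num.sqrt La * Num.sqrt LN))%:E +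
  (32 * (sigma * D * rho * Num.sqrt La
     * (Num.sqrt (ln (2 * #|U|%:R) + 1) / 2 ^+ J)))%:E)%E).
  by apply: leeD; [apply: lee_sum => j _; exact: level_bound|exact: last_bound].
rewrite sumEFin -EFinD lee_fin sumr_const card_ord -[_ *+ J]mulr_natr.
rewrite le_eqVlt; apply/orP; left; apply/eqP; ring.
Qed.

End chaining.

(** * Discrete Fourier transform and circulant matrices *)

Definition nsq (R : rcfType) (z : R[i]) : R := complex.Re z ^+ 2 + complex.Im z ^+ 2.
Definition rdot (R : rcfType) (x y : R[i]) : R := complex.Re x * complex.Re y + complex.Im x * complex.Im y.

Section complex_square_norm.
Context (R : rcfType).
Implicit Types x y z : R[i].

Lemma nsq_ge0 x : 0 <= nsq x.
Proof. by rewrite addr_ge0 ?sqr_ge0. Qed.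

Lemma nsqM x y : nsq (x * y) = nsq x * nsq y.
Proof. by case: x => a b; case: y => c e; rewrite /nsq /=; ring. Qed.

Lemma nsq_real (a : R) : nsq (a%:C)%C = a ^+ 2.
Proof. by rewrite /nsq /= expr0n addr0. Qed.

Lemma nsqE x : ((nsq x)%:C)%C = x * (x^*)%C.
Proof.
by case: x => a b; apply/eqP; rewrite eq_complex /nsq /=; apply/andP; split;
  apply/eqP; ring.
Qed.

Lemma nsq_conj x : nsq (x^*)%C = nsq x.
Proof. by case: x => a b; rewrite /nsq /= sqrrN. Qed.

Lemma nsq1 : nsq (1 : R[i]) = 1.
Proof. by rewrite /nsq /= expr1n expr0n addr0. Qed.

Lemma nsqX x k : nsq (x ^+ k) = nsq x ^+ k.
Proof. by elim: k => [|k IH]; rewrite ?expr0 ?nsq1 // !exprS nsqM IH. Qed.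

Lemma rdot_nsq x : rdot x x = nsq x. Proof. by []. Qed.

Lemma rdotC x y : rdot x y = rdot y x.
Proof. by rewrite /rdot mulrC [X in _ + X]mulrC. Qed.

Lemma rdotDl x y z : rdot (x + y) z = rdot x z + rdot y z.
Proof. by case: x => a b; case: y => c e; rewrite /rdot /=; ring. Qed.

Lemma rdotZl (k : R) x y : rdot ((k%:C)%C * x) y = k * rdot x y.
Proof. by case: x => a b; rewrite /rdot /=; ring. Qed.

(** Over the algebraically closed [R[i]] the polynomial ['X^n - 1] splits into distinct linear
    factors, and the resulting [n] roots of unity form a cyclic group. *)
Lemma exists_prim_root n : (0 < n)%N -> exists z : R[i], n.-primitive_root z.
Proof.
pose p : {poly R[i]} := 'X^n - 1; have [r Dp] := closed_field_poly_normal p.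
move=> n_gt0; rewrite (monicP _) ?monicXnsubC // scale1r in Dp.
have rn1: all n.-unity_root r by apply/allP=> z; rewrite -root_prod_XsubC -Dp.
have sz_r: (n < (size r).+1)%N.
  by rewrite -(size_prod_XsubC r id) -Dp size_XnsubC.
have [|z] := hasP (cyclic.has_prim_root n_gt0 rn1 _ sz_r); last by exists z.
by rewrite -separable.separable_prod_XsubC -Dp cyclotomic.separable_Xn_sub_1 // pnatr_eq0 -lt0n.
Qed.

End complex_square_norm.

Section discrete_fourier.
Context (R : rcfType) (m : nat) (zeta : R[i]).
Hypothesis zetaP : m.-primitive_root zeta.

Let m0 : (0 < m)%N. Proof. exact: prim_order_gt0 zetaP. Qed.

Lemma nsq_zeta : nsq zeta = 1.
Proof.
apply/eqP; rewrite -(@pexpr_eq1 _ _ m) ?nsq_ge0 //.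
by rewrite -nsqX (prim_expr_order zetaP) nsq1.
Qed.

Lemma nsq_zetaX k : nsq (zeta ^+ k) = 1.
Proof. by rewrite nsqX nsq_zeta expr1n. Qed.

Lemma zeta_conj k : zeta ^+ k * ((zeta ^+ k)^*)%C = 1.
Proof. by rewrite -nsqE nsq_zetaX. Qed.

Definition dft (f : 'I_m -> R[i]) (w : 'I_m) : R[i] :=
  \sum_(t < m) zeta ^+ (w * t) * f t.

Lemma zeta_orthogonal (s t : 'I_m) :
  \sum_(w < m) zeta ^+ (w * s) * ((zeta ^+ (w * t))^*)%C =
  if s == t then m%:R else 0.
Proof.
case: eqP => [->|st].
  under eq_bigr do rewrite zeta_conj.
  by rewrite sumr_const card_ord.
pose q := zeta ^+ s * ((zeta ^+ t)^*)%C.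
have qE (w : 'I_m) : zeta ^+ (w * s) * ((zeta ^+ (w * t))^*)%C = q ^+ w.
  by rewrite /q exprMn -rmorphXn -!exprM ![(w * _)%N]mulnC.
under eq_bigr do rewrite qE.
have q1 : q != 1.
  apply/eqP => q1; apply: st; apply/val_inj => /=.
  have : zeta ^+ s = zeta ^+ t.
    rewrite -[LHS]mulr1 -(zeta_conj t) mulrCA -/q q1 mulr1 //.
  by move/eqP; rewrite (eq_prim_root_expr zetaP) !modn_small // => /eqP.
have qm : q ^+ m = 1.
  rewrite /q exprMn -rmorphXn -!exprM ![(_ * m)%N]mulnC !exprM.
  by rewrite (prim_expr_order zetaP) !expr1n rmorph1 mulr1.
apply/eqP; rewrite -[_ == 0]orbF -(negbTE q1) -(subr_eq0 q) orbC -mulf_eq0.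
by rewrite -subrX1 qm subrr.
Qed.

Lemma parseval (f : 'I_m -> R[i]) :
  \sum_(w < m) nsq (dft f w) = m%:R * \sum_(t < m) nsq (f t).
Proof.
apply: complexI; rewrite rmorph_sum rmorphM rmorph_sum /=.
under eq_bigr do rewrite nsqE /dft rmorph_sum mulr_suml.
rewrite exchange_big mulr_sumr; apply: eq_bigr => s _ /=.
under eq_bigr do rewrite mulr_sumr.
rewrite exchange_big /=.
under eq_bigr => t _.
  under eq_bigr do rewrite rmorphM /= mulrACA.
  rewrite -mulr_suml zeta_orthogonal; over.
rewrite (bigD1 s) //= eqxx big1 ?addr0; last first.
  by move=> t; rewrite eq_sym => /negbTE ->; rewrite mul0r.
by rewrite nsqE rmorph_nat.
Qed.

End discrete_fourier.

(** * The multichannel circulant matrix in Fourier coordinates *)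

Section circulant.
Context (R : realType) (n p m : nat).
Hypothesis n0 : (0 < n)%N.
Hypothesis nm : (n <= m)%N.
Let m0 : (0 < m)%N. Proof. exact: leq_trans n0 nm. Qed.

Lemma block_subproof (c : 'I_(n * p)) : (c %/ n < p)%N.
Proof. by rewrite ltn_divLR // [(p * n)%N]mulnC. Qed.

Definition block (c : 'I_(n * p)) : 'I_p := Ordinal (block_subproof c).

Definition shift (c : 'I_(n * p)) : nat := (n - (c %% n).+1)%N.

Lemma shift_ltm c : (shift c < m)%N.
Proof. by rewrite /shift; apply: leq_trans nm; rewrite ltn_subrL n0. Qed.

Lemma sample_subproof (r : 'I_m) c : ((r + shift c) %% m < m)%N.
Proof. by rewrite ltn_mod. Qed.

Definition sample (r : 'I_m) c : 'I_m := Ordinal (sample_subproof r c).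

Lemma sample_inj c : injective (fun r => sample r c).
Proof.
move=> r s /(congr1 val) /= /eqP; rewrite eqn_modDr !modn_small //.
by move=> /eqP/val_inj.
Qed.

Lemma block_shift_inj c e : block c = block e -> shift c = shift e -> c = e.
Proof.
move=> /(congr1 val) /= bce; rewrite /shift => sce; apply/val_inj => /=.
rewrite (divn_eq c n) (divn_eq e n) bce; congr (_ + _)%N.
by have := ltn_pmod c n0; have := ltn_pmod e n0; lia.
Qed.

Definition unit_probe (k : 'I_p * 'I_m) : rvec R ('I_p * 'I_m)%type :=
  fun j => (j == k)%:R.

(** The product [Phi z] as a bilinear function of the probes and of [z], so that it can also be
    formed with restricted or sign-flipped probes. *)
Definition act (u : rvec R ('I_p * 'I_m)%type) (z : 'cV[R]_(n * p))
  (r : 'I_m) : R := \sum_c z c 0 * u (block c, sample r c).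

Lemma mc_circulant_act (u : rvec R ('I_p * 'I_m)%type) z r :
  (mc_circulant n (fun i t => u (i, t)) *m z) r 0 = act u z r.
Proof.
rewrite mxE; apply: eq_bigr => c _; rewrite mulrC; congr (_ * _).
rewrite mxE /probe_at.
(* The truncated subtraction is exact because [c %% n < n]: each column is a probe rotated by
   [shift c]. *)
have -> : (n + r - (c %% n).+1)%N = (r + shift c)%N.
  by rewrite /shift addnC addnBA // ltn_pmod.
rewrite (insubT (fun k => k < p)%N (block_subproof c)).
rewrite (insubT (fun k => k < m)%N (sample_subproof r c)) /=.
by congr (u (_, _)); apply/val_inj.
Qed.

Lemma actD u x y r : act u (x + y) r = act u x r + act u y r.
Proof.
by rewrite /act -big_split; apply: eq_bigr => c _; rewrite mxE mulrDl.
Qed.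

Lemma actZ u k x r : act u (k *: x) r = k * act u x r.
Proof. by rewrite /act mulr_sumr; apply: eq_bigr => c _; rewrite mxE mulrA. Qed.

Lemma actB u x y r : act u (x - y) r = act u x r - act u y r.
Proof. by rewrite actD -scaleN1r actZ mulN1r. Qed.

Lemma act_probe u z r : act u z r = \sum_k u k * act (unit_probe k) z r.
Proof.
rewrite /act; under [RHS]eq_bigr do rewrite mulr_sumr.
rewrite exchange_big; apply: eq_bigr => c _ /=.
rewrite (bigD1 (block c, sample r c)) //= big1 ?addr0.
  by rewrite /unit_probe eqxx mulr1 mulrC.
by move=> k; rewrite eq_sym => /negbTE kc; rewrite /unit_probe kc !mulr0.
Qed.

Context (zeta : R[i]).
Hypothesis zetaP : m.-primitive_root zeta.

Local Notation dft := (dft zeta).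
Local Notation dftr f := (dft (fun t => ((f t)%:C)%C)).

(** Conjugated because [act] reads the probe ahead, at [r + shift c]: a correlation rather than a
    convolution. *)
Definition phase (c : 'I_(n * p)) (w : 'I_m) : R[i] :=
  ((zeta ^+ (w * shift c))^*)%C.

Definition block_dft (z : 'cV[R]_(n * p)) (i : 'I_p) (w : 'I_m) : R[i] :=
  \sum_(c | block c == i) ((z c 0)%:C)%C * phase c w.

Lemma zeta_sample (w r : 'I_m) c :
  zeta ^+ (w * sample r c) = zeta ^+ (w * r) * zeta ^+ (w * shift c).
Proof.
rewrite -exprD -mulnDr /= !(mulnC w) !exprM; congr (_ ^+ w).
by rewrite (expr_mod _ (prim_expr_order zetaP)).
Qed.

Lemma dft_act u z w : dftr (act u z) w =
  \sum_c ((z c 0)%:C)%C * (phase c w * dftr (fun t => u (block c, t)) w).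
Proof.
rewrite /dft /act; under eq_bigr do rewrite rmorph_sum mulr_sumr.
rewrite exchange_big; apply: eq_bigr => c _ /=.
rewrite [in RHS](reindex_inj (@sample_inj c)) /= !mulr_sumr.
apply: eq_bigr => r _; rewrite zeta_sample rmorphM /=.
transitivity (((z c 0)%:C)%C * ((zeta ^+ (w * shift c)) * phase c w) *
  (zeta ^+ (w * r) * ((u (block c, sample r c))%:C)%C)); last by ring.
by rewrite /phase (zeta_conj zetaP) mulr1 mulrCA.
Qed.

(** The adjoint of the linear map [u |-> act u z], applied to [h]. For [h = act y z] these are the
    coefficients of the process obtained by freezing the probes [y]. *)
Definition corr (h : 'I_m -> R) (z : 'cV[R]_(n * p)) (k : 'I_p * 'I_m) : R :=
  \sum_r h r * act (unit_probe k) z r.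

Lemma dft_corr h z i w :
  dftr (fun t => corr h z (i, t)) w = dftr h w * ((block_dft z i w)^*)%C.
Proof.
rewrite rmorph_sum mulr_suml /dft /corr.
under eq_bigr => t _.
  rewrite rmorph_sum mulr_sumr.
  under eq_bigr => r _ do rewrite rmorphM rmorph_sum /= mulr_sumr mulr_sumr.
  over.
rewrite exchange_big; apply: eq_bigr => r _ /=; rewrite exchange_big /=.
rewrite mulr_sumr [RHS]big_mkcond; apply: eq_bigr => c _.
rewrite (bigD1 (sample r c)) //= big1 ?addr0; last first.
  move=> t tc; rewrite /unit_probe xpair_eqE [_ == t]eq_sym (negbTE tc) andbF.
  by rewrite mulr0 rmorph0 !mulr0.
rewrite /unit_probe xpair_eqE eqxx andbT zeta_sample; case: eqP => _.
  have -> : (((z c 0)%:C * phase c w)^*)%C =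
      ((z c 0)%:C)%C * zeta ^+ (w * shift c).
    by rewrite rmorphM /= /phase conjcK oppr0.
  rewrite mulr1; ring.
by rewrite mulr0 rmorph0 !mulr0.
Qed.

(** Parseval in each block after [dft_corr] has turned the correlation into a product. Bounding one
    or the other factor by its maximum over frequencies gives the two estimates that close this
    section. *)
Lemma corr_sqr_sum h z : \sum_k corr h z k ^+ 2 =
  m%:R^-1 * \sum_w nsq (dftr h w) * \sum_i nsq (block_dft z i w).
Proof.
have mR : m%:R != 0 :> R by rewrite pnatr_eq0 -lt0n.
apply: (mulfI mR); rewrite mulVKf //.
under [RHS]eq_bigr do rewrite mulr_sumr.
rewrite exchange_big /=.
transitivity (m%:R * \sum_i \sum_t corr h z (i, t) ^+ 2).
  by rewrite pair_bigA; congr (_ * _); apply: eq_bigr => -[].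
rewrite mulr_sumr; apply: eq_bigr => i _.
rewrite (eq_bigr (fun t => nsq (((corr h z (i, t))%:C)%C))); last first.
  by move=> t _; rewrite nsq_real.
rewrite -(parseval zetaP); apply: eq_bigr => w _.
by rewrite dft_corr nsqM nsq_conj.
Qed.

(** This is [corr_sqr_sum] for a point mass [h], whose spectrum has modulus 1. Its correlations list
    the coordinates of [z] at distinct probe entries, as shifts are below [n <= m] and, with the
    block, determine the column. *)
Lemma block_dft_energy z :
  \sum_w \sum_i nsq (block_dft z i w) = m%:R * \sum_c z c 0 ^+ 2.
Proof.
have mR : m%:R != 0 :> R by rewrite pnatr_eq0 -lt0n.
pose r0 : 'I_m := Ordinal m0.
pose h (r : 'I_m) : R := (r == r0)%:R.
have corrE k : corr h z k = act (unit_probe k) z r0.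
  rewrite /corr (bigD1 r0) //= big1 ?addr0; first by rewrite /h eqxx mul1r.
  by move=> r /negbTE rr; rewrite /h rr mul0r.
have dh w : nsq (dftr h w) = 1.
  rewrite /dft (bigD1 r0) //= big1 ?addr0.
    by rewrite muln0 expr0 /h eqxx mul1r nsq1.
  by move=> r /negbTE rr; rewrite /h rr rmorph0 mulr0.
have := corr_sqr_sum h z; under [in RHS]eq_bigr do rewrite dh mul1r.
move/(congr1 ( *%R m%:R)); rewrite mulVKf // => <-; congr (_ * _).
under eq_bigr do rewrite corrE expr2 {1}/act mulr_suml.
rewrite exchange_big; apply: eq_bigr => c _ /=.
rewrite (bigD1 (block c, sample r0 c)) //= big1 ?addr0; last first.
  by move=> k; rewrite eq_sym /unit_probe => /negbTE ->; rewrite mulr0 mul0r.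
rewrite {1}/unit_probe eqxx mulr1 expr2; congr (_ * _).
rewrite /act (bigD1 c) //= big1 ?addr0.
  by rewrite /unit_probe eqxx mulr1.
move=> e ec; rewrite /unit_probe; case: eqP => [[] | _]; last by rewrite mulr0.
move=> be; rewrite !add0n !modn_small ?shift_ltm // => se.
by move: ec; rewrite (@block_shift_inj e c) ?eqxx //; apply: val_inj.
Qed.

(** A unit probe has spectrum of modulus 1 in its own block and 0 in the others. The value does not
    involve [t], so the diagonal of the quadratic form is constant on each block and meets the
    probes only through [sum_t x(i, t)^2]. *)
Lemma unit_probe_energy z i t : \sum_r act (unit_probe (i, t)) z r ^+ 2 =
  m%:R^-1 * \sum_w nsq (block_dft z i w).
Proof.
have mR : m%:R != 0 :> R by rewrite pnatr_eq0 -lt0n.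
apply: (mulfI mR); rewrite mulVKf //.
rewrite (eq_bigr (fun r => nsq (((act (unit_probe (i, t)) z r)%:C)%C))); last first.
  by move=> r _; rewrite nsq_real.
rewrite -(parseval zetaP); apply: eq_bigr => w _.
rewrite dft_act.
have hd c : dftr (fun s => unit_probe (i, t) (block c, s)) w =
    if block c == i then zeta ^+ (w * t) else 0.
  rewrite /dft (bigD1 t) //= big1 ?addr0 /unit_probe; last first.
    by move=> s /negbTE st; rewrite xpair_eqE st andbF mulr0.
  by rewrite xpair_eqE eqxx andbT; case: eqP; rewrite ?mulr1 ?mulr0.
under eq_bigr do rewrite hd.
rewrite -[RHS]mul1r -(nsq_zetaX zetaP (w * t)) -nsqM /block_dft mulr_sumr.
rewrite [in RHS]big_mkcond; congr nsq; apply: eq_bigr => c _.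
by case: eqP => _; [ring|rewrite !mulr0].
Qed.

Lemma corr_sqr_le_block_dft (h : 'I_m -> R) z (M : R) :
  (forall w, \sum_i nsq (block_dft z i w) <= M) ->
  \sum_k corr h z k ^+ 2 <= M * \sum_r h r ^+ 2.
Proof.
move=> zM; rewrite corr_sqr_sum.
have mR : 0 < m%:R :> R by rewrite ltr0n.
rewrite ler_pdivrMl // mulrCA.
rewrite [X in _ <= _ * (_ * X)](eq_bigr (fun r => nsq (((h r)%:C)%C))); last first.
  by move=> r _; rewrite nsq_real.
rewrite -(parseval zetaP) mulr_sumr; apply: ler_sum => w _.
by rewrite mulrC ler_wpM2r ?nsq_ge0.
Qed.

Lemma corr_sqr_le_dft (h : 'I_m -> R) z (M : R) :
  (forall w, nsq (dftr h w) <= M) ->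
  \sum_k corr h z k ^+ 2 <= M * \sum_c z c 0 ^+ 2.
Proof.
move=> hM; rewrite corr_sqr_sum.
have mR : 0 < m%:R :> R by rewrite ltr0n.
rewrite ler_pdivrMl // mulrCA -block_dft_energy mulr_sumr.
apply: ler_sum => w _; rewrite ler_wpM2r //.
by apply: sumr_ge0 => i _; exact: nsq_ge0.
Qed.

End circulant.

(** * Reduction of the sparse norm to a finite net *)

Lemma l2norm_sqr (R : realType) (N : nat) (x : 'cV[R]_N) :
  l2norm x ^+ 2 = \sum_c x c 0 ^+ 2.
Proof. by rewrite sqr_sqrtr // sumr_ge0 // => c _; exact: sqr_ge0. Qed.

Lemma net_center_subproof (s : nat) : (8 * s < 16 * s + 1)%N.
Proof. lia. Qed.

Section sparse_net.
Context (R : realType) (N s : nat).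
Hypothesis s0 : (0 < s)%N.
Hypothesis N0 : (0 < N)%N.

Let h : R := (4 * s%:R)^-1.
Let sR : 1 <= s%:R :> R. Proof. by rewrite ler1n. Qed.
Let h0 : 0 < h. Proof. by rewrite invr_gt0 mulr_gt0 // ltr0n. Qed.
Let hs : h * (4 * s%:R) = 1.
Proof. by rewrite /h mulVf // gt_eqF // mulr_gt0 // ltr0n. Qed.

(* An index lists [s] coordinates with a grid value in [-2, 2] for each; repeated
   coordinates add up, and the value 0 (index [8 s]) is used for padding. *)
Definition net_index := {ffun 'I_s -> 'I_N * 'I_(16 * s + 1)}.

Definition grid (g : 'I_(16 * s + 1)) : R := (g%:R - (8 * s)%:R) / (4 * s%:R).

Definition net_vec (u : net_index) : 'cV[R]_N :=
  \sum_(l < s) grid (u l).2 *: delta_mx (u l).1 0.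

(** The bounds are those satisfied by [x' + y'] and [x' - y'] for roundings of unit vectors on a
    common support of size at most [s]; arbitrary index lists may violate them. *)
Definition net_good (u : net_index) : bool :=
  (\sum_c net_vec u c 0 ^+ 2 <= 4) &&
  (\sum_c `|net_vec u c 0| <= 2 * Num.sqrt s%:R).

Definition net_center : net_index :=
  [ffun _ => (Ordinal N0, Ordinal (net_center_subproof s))].

Lemma net_vec_center : net_vec net_center = 0.
Proof.
rewrite /net_vec big1 // => l _.
by rewrite ffunE /grid /= subrr mul0r scale0r.
Qed.

Lemma net_good_center : net_good net_center.
Proof.
rewrite /net_good net_vec_center !big1.
- by rewrite ler0n mulr_ge0 ?sqrtr_ge0.
- by move=> c _; rewrite mxE normr0.
- by move=> c _; rewrite mxE expr0n.
Qed.

Lemma net_vec_onto (G : {set 'I_N}) (a : 'I_N -> int) : (#|G| <= s)%N ->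
  (forall c, `|a c| <= 8 * s%:Z) -> (forall c, c \notin G -> a c = 0) ->
  exists u, net_vec u = \col_c ((a c)%:~R * h).
Proof.
move=> Gs a8 aG.
have g_subproof c : (absz (a c + 8 * s%:Z)%R < 16 * s + 1)%N.
  by have := a8 c; lia.
pose g c : 'I_(16 * s + 1) := Ordinal (g_subproof c).
have gridE c : grid (g c) = (a c)%:~R * h.
  rewrite /grid /h /=; congr (_ / _).
  rewrite -[(absz _)%:R]/((absz _)%:Z%:~R) gez0_abs; last by have := a8 c; lia.
  rewrite intrD intrM natrM /=; ring.
pose u : net_index := [ffun l : 'I_s => if insub (val l) is Some k
   then (enum_val (k : 'I_#|G|), g (enum_val k))
   else (Ordinal N0, Ordinal (net_center_subproof s))].
exists u; rewrite /net_vec.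
pose F (i : nat) : 'cV[R]_N := if insub i is Some k
   then ((a (enum_val (k : 'I_#|G|)))%:~R * h) *: delta_mx (enum_val k) 0 else 0.
rewrite (eq_bigr (fun l : 'I_s => F l)); last first.
  move=> l _; rewrite /u /F ffunE; case: insub => [k|] /=; first by rewrite gridE.
  by rewrite /grid /= subrr mul0r scale0r.
rewrite -(big_mkord xpredT F) (big_cat_nat _ Gs) //=.
rewrite [X in _ + X]big_nat_cond [X in _ + X]big1 ?addr0; last first.
  by move=> i /andP[/andP[Gi _] _]; rewrite /F insubF // ltnNge Gi.
rewrite big_mkord (eq_bigr (fun k : 'I_#|G| =>
  ((a (enum_val k))%:~R * h) *: delta_mx (enum_val k) 0)); last first.
  by move=> k _; rewrite /F valK.
rewrite -(big_enum_val (A := mem G)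
  (fun c => ((a c)%:~R * h) *: (delta_mx c 0 : 'cV[R]_N))) /=.
apply/colP => c; rewrite mxE summxE.
have [cG|cG] := boolP (c \in G); last first.
  rewrite aG // mul0r big1 // => e eG; rewrite !mxE.
  by case: eqP => [ce|]; rewrite ?mulr0 //; rewrite ce eG in cG.
rewrite (bigD1 c) //= !mxE !eqxx mulr1 big1 ?addr0 // => e /andP[_ ec].
by rewrite !mxE eq_sym (negbTE ec) mulr0.
Qed.

(** Rounding toward zero, rather than to the nearest grid point, increases neither the l2 norm nor
    the support. *)
Lemma round_toward_zero (x : R) : exists a : int,
  [/\ `|x - a%:~R * h| <= h, `|a%:~R * h| <= `|x| & (x = 0 -> a = 0)].
Proof.
have pos (y : R) : 0 <= y -> exists a : int,
  [/\ `|y - a%:~R * h| <= h, `|a%:~R * h| <= `|y| & (y = 0 -> a = 0)].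
  move=> y0; exists (Num.floor (y / h)).
  have f1 : (Num.floor (y / h))%:~R * h <= y.
    by rewrite -ler_pdivlMr //; have /andP[] := floor_itv (y / h).
  have f2 : y <= (Num.floor (y / h))%:~R * h + h.
    have : y / h <= (Num.floor (y / h))%:~R + 1.
      by have /andP[_ /ltW] := floor_itv (y / h); rewrite intrD.
    by rewrite ler_pdivrMr // mulrDl mul1r.
  have f0 : 0 <= (Num.floor (y / h))%:~R * h.
    by rewrite mulr_ge0 ?(ltW h0) // ler0z floor_ge0 divr_ge0 // ltW.
  split.
  - by rewrite ger0_norm ?subr_ge0 //; lra.
  - by rewrite !ger0_norm.
  - by move=> ->; rewrite mul0r floor0.
have [x0|x0] := lerP 0 x; first exact: pos.
have [|a [h1 h2 h3]] := pos (- x); first lra.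
exists (- a); rewrite rmorphN /= mulNr; split.
- by rewrite -normrN opprD opprK.
- by rewrite normrN; apply: le_trans h2 _; rewrite normrN.
- by move=> x00; rewrite h3 ?oppr0 // x00 oppr0.
Qed.

Lemma l1_le_sparse (G : {set 'I_N}) (z : 'cV[R]_N) : (#|G| <= s)%N ->
  (forall c, c \notin G -> z c 0 = 0) -> \sum_c z c 0 ^+ 2 <= 4 ->
  \sum_c `|z c 0| <= 2 * Num.sqrt s%:R.
Proof.
move=> Gs zG z4; pose q := Num.sqrt s%:R : R.
have q0 : 0 < q by rewrite sqrtr_gt0 ltr0n.
have q2 : q ^+ 2 = s%:R by rewrite sqr_sqrtr.
rewrite (bigID (mem G)) /= [X in _ + X]big1 ?addr0; last first.
  by move=> c /zG ->; rewrite normr0.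
(* Arithmetic-geometric mean inequality, weighted so that each of the two resulting sums is at most
   [q = sqrt s]. *)
apply: (@le_trans _ _ (\sum_(c in G) (q / 4 * z c 0 ^+ 2 + q^-1))).
  apply: ler_sum => c _.
  have := sqr_ge0 (`|z c 0| * q / 2 - 1).
  rewrite -(real_normK (num_real (z c 0))) => sq.
  rewrite -(ler_pM2r q0) mulrDl mulVf ?gt_eqF // -subr_ge0.
  by apply: le_trans sq _; rewrite le_eqVlt; apply/orP; left; apply/eqP; field.
rewrite big_split /= -mulr_sumr sumr_const -[_ *+ #|_|]mulr_natl.
have z4' : \sum_(c in G) z c 0 ^+ 2 <= 4.
  apply: le_trans z4; rewrite [leRHS](bigID (mem G)) /= lerDl.
  by apply: sumr_ge0 => c _; exact: sqr_ge0.
have GR : #|G|%:R <= q ^+ 2 by rewrite q2 ler_nat.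
have e1 : q / 4 * \sum_(c in G) z c 0 ^+ 2 <= q.
  rewrite -[leRHS](mulr1) -mulrA; apply: ler_wpM2l; [exact: ltW|lra].
have e2 : #|G|%:R / q <= q by rewrite ler_pdivrMr // -expr2.
by rewrite -/q; lra.
Qed.

Section symmetric_matrix.
Context (A : 'M[R]_N).
Hypothesis Asym : A^T = A.

Let B (y x : 'cV[R]_N) : R := (y^T *m A *m x) 0 0.

Let BDl x y z : B (x + y) z = B x z + B y z.
Proof. by rewrite /B raddfD /= !mulmxDl mxE. Qed.
Let BZl k x z : B (k *: x) z = k * B x z.
Proof. by rewrite /B linearZ /= -!scalemxAl mxE. Qed.
Let BC x y : B x y = B y x.
Proof.
have -> : B x y = ((y^T *m A *m x)^T) 0 0.
  by rewrite !trmx_mul trmxK Asym mulmxA.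
by rewrite mxE.
Qed.
Let BDr x y z : B z (x + y) = B z x + B z y.
Proof. by rewrite BC BDl !(BC z). Qed.
Let BZr k x z : B z (k *: x) = k * B z x.
Proof. by rewrite BC BZl BC. Qed.

Let values := [set r : R | exists (G : {set 'I_N}) (x y : 'cV[R]_N),
        (#|G| <= s)%N /\
        (forall i, i \notin G -> x i 0 = 0) /\
        (forall i, i \notin G -> y i 0 = 0) /\
        l2norm x = 1 /\ l2norm y = 1 /\
        r = `|(y^T *m A *m x) 0 0| ].

Let values_nonempty : values !=set0.
Proof.
pose c := Ordinal N0; pose e : 'cV[R]_N := delta_mx c 0.
have e1 : l2norm e = 1.
  rewrite /l2norm (bigD1 c) //= big1 ?addr0; last first.
    by move=> i /negbTE ic; rewrite mxE ic expr0n.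
  by rewrite mxE !eqxx expr1n sqrtr1.
exists `|B e e|, [set c]%SET, e, e; rewrite cards1; do !split => //.
- by move=> i; rewrite inE => /negbTE ic; rewrite mxE ic.
- by move=> i; rewrite inE => /negbTE ic; rewrite mxE ic.
Qed.

Let unit_coord (x : 'cV[R]_N) i : l2norm x = 1 -> `|x i 0| <= 1.
Proof.
move=> x1; rewrite -(@ler_pXn2r _ 2) ?nnegrE // expr1n real_normK ?num_real //.
rewrite -[leRHS](expr1n _ 2) -x1 l2norm_sqr (bigD1 i) //= lerDl.
by apply: sumr_ge0 => j _; exact: sqr_ge0.
Qed.

(** Needed because [sup] is an upper bound only for sets that are nonempty and bounded above. *)
Let values_bounded : has_ubound values.
Proof.
exists (\sum_i \sum_j `|A i j|) => _ [G [x [y [_ [_ [_ [x1 [y1 ->]]]]]]]].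
rewrite mxE; apply: (le_trans (ler_norm_sum _ _ _)).
rewrite exchange_big; apply: ler_sum => j _; rewrite normrM /=.
apply: (@le_trans _ _ (`|(y^T *m A) 0 j| * 1)).
  by rewrite ler_wpM2l // unit_coord.
rewrite mulr1 mxE; apply: (le_trans (ler_norm_sum _ _ _)).
apply: ler_sum => i _; rewrite normrM mxE.
by rewrite -[leRHS]mul1r ler_wpM2r // unit_coord.
Qed.

Let M := sparse_norm s A.

Let le_M r : values r -> r <= M.
Proof. by move=> vr; apply: sup_upper_bound => //; split. Qed.

Lemma sparse_norm_ge0 : 0 <= sparse_norm s A.
Proof.
by have [r vr] := values_nonempty; apply: le_trans (le_M vr);
  have [G [x [y [_ [_ [_ [_ [_ ->]]]]]]]] := vr.
Qed.

Let B_homogeneous (G : {set 'I_N}) (x y : 'cV[R]_N) (a c : R) : (#|G| <= s)%N ->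
  (forall i, i \notin G -> x i 0 = 0) -> (forall i, i \notin G -> y i 0 = 0) ->
  0 <= a -> 0 <= c ->
  \sum_i x i 0 ^+ 2 <= a ^+ 2 -> \sum_i y i 0 ^+ 2 <= c ^+ 2 ->
  `|B y x| <= M * (a * c).
Proof.
move=> Gs xG yG a0 c0 xa yc.
have nx : l2norm x <= a by rewrite -(@ler_pXn2r _ 2) ?nnegrE ?sqrtr_ge0 // l2norm_sqr.
have ny : l2norm y <= c by rewrite -(@ler_pXn2r _ 2) ?nnegrE ?sqrtr_ge0 // l2norm_sqr.
have nz (z : 'cV[R]_N) : l2norm z = 0 -> z = 0.
  move=> z0; apply/colP => i; rewrite mxE.
  have := l2norm_sqr z; rewrite z0 expr0n => /esym zz.
  have /(_ i erefl)/eqP := psumr_eq0P (fun i _ => sqr_ge0 (z i 0)) zz.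
  by rewrite sqrf_eq0 => /eqP.
have Mac : 0 <= M * (a * c) by rewrite !mulr_ge0 ?sparse_norm_ge0.
have [x0|x0] := eqVneq (l2norm x) 0.
  by rewrite (nz _ x0) -(scale0r (0 : 'cV[R]_N)) BZr mul0r normr0.
have [y0|y0] := eqVneq (l2norm y) 0.
  by rewrite (nz _ y0) -(scale0r (0 : 'cV[R]_N)) BZl mul0r normr0.
have px : 0 < l2norm x by rewrite lt_def x0 sqrtr_ge0.
have py : 0 < l2norm y by rewrite lt_def y0 sqrtr_ge0.
have unit (z : 'cV[R]_N) : 0 < l2norm z -> l2norm ((l2norm z)^-1 *: z) = 1.
  move=> pz; apply/eqP; rewrite -(@pexpr_eq1 _ _ 2) ?sqrtr_ge0 // l2norm_sqr.
  under eq_bigr do rewrite mxE exprMn.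
  rewrite -mulr_sumr -l2norm_sqr -exprMn mulVf ?expr1n //.
  by rewrite gt_eqF.
have : `|B ((l2norm y)^-1 *: y) ((l2norm x)^-1 *: x)| <= M.
  apply: le_M; exists G, ((l2norm x)^-1 *: x), ((l2norm y)^-1 *: y).
  split => //; split; first by move=> i iG; rewrite mxE xG // mulr0.
  by split; [move=> i iG; rewrite mxE yG // mulr0|rewrite !unit].
rewrite BZl BZr !normrM [`|(l2norm y)^-1|]gtr0_norm ?invr_gt0 //.
rewrite [`|(l2norm x)^-1|]gtr0_norm ?invr_gt0 //.
rewrite mulrCA !(ler_pdivrMl _ _ px, ler_pdivrMl _ _ py) // => Bxy.
apply: (le_trans Bxy); rewrite [leRHS]mulrC mulrA.
rewrite [l2norm y * _]mulrC.
apply: ler_wpM2r; first exact: sparse_norm_ge0.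
by apply: ler_pM => //; rewrite ltW.
Qed.

(** Rounding moves a unit vector by at most [sqrt s h <= 1/4] within its support, so the two error
    terms cost [M / 4] each by homogeneity. Polarisation bounds the rounded term by [F / 2], whence
    [M <= F / 2 + M / 2]. *)
Lemma sparse_norm_le_net : sparse_norm s A <=
  fmax (fun u : net_index => if net_good u then
    `|((net_vec u)^T *m A *m net_vec u) 0 0| else 0).
Proof.
set F := fmax _; rewrite -/M.
have colDE (v w : 'cV[R]_N) c : (v + w) c 0 = v c 0 + w c 0 by rewrite mxE.
have colZE k (v : 'cV[R]_N) c : (k *: v) c 0 = k * v c 0 by rewrite mxE.
have colBE (v w : 'cV[R]_N) c : (v - w) c 0 = v c 0 - w c 0 by rewrite !mxE.
have half r : values r -> r <= F / 2 + M / 2.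
  move=> [G [x [y [Gs [xG [yG [x1 [y1 ->]]]]]]]].
  have rnd (z : 'cV[R]_N) : l2norm z = 1 -> (forall i, i \notin G -> z i 0 = 0) ->
    exists a : 'I_N -> int, let z' := \col_c ((a c)%:~R * h) in
    [/\ forall c, c \notin G -> a c = 0,
        forall c, `|a c| <= 4 * s%:Z,
        \sum_c z' c 0 ^+ 2 <= 1 &
        \sum_c (z - z') c 0 ^+ 2 <= (4^-1) ^+ 2].
    move=> z1 zG.
    have [a Ha] := choice (fun c => round_toward_zero (z c 0)).
    exists a => z'; split.
    - by move=> c cG; have [_ _ ->] := Ha c; rewrite ?zG.
    - move=> c; have [_ a2 _] := Ha c.
      have : `|(a c)%:~R * h| <= 1 by apply: (le_trans a2); exact: unit_coord.
      rewrite normrM (gtr0_norm h0) /h ler_pdivrMr ?mulr_gt0 ?ltr0n //.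
      rewrite mul1r -intr_norm => a4.
      by rewrite -(ler_int R) intrM.
    - rewrite -[leRHS](expr1n _ 2) -z1 l2norm_sqr; apply: ler_sum => c _.
      have [_ a2 _] := Ha c; rewrite /z' mxE.
      rewrite -(real_normK (num_real (_ * _))) -[leRHS]real_normK ?num_real //.
      by rewrite ler_pXn2r ?nnegrE.
    - rewrite (bigID (mem G)) /= [X in _ + X]big1 ?addr0; last first.
        move=> c cG; rewrite !mxE zG //; have [_ _ ->] := Ha c; rewrite ?zG //.
        by rewrite mul0r subrr expr0n.
      apply: (@le_trans _ _ (\sum_(c in G) h ^+ 2)).
        apply: ler_sum => c _; rewrite !mxE; have [a1 _ _] := Ha c.
        rewrite -real_normK ?num_real // ler_pXn2r ?nnegrE //; exact: ltW.
      rewrite sumr_const -[_ *+ _]mulr_natl.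
      have GR : #|G|%:R <= s%:R :> R by rewrite ler_nat.
      apply: (@le_trans _ _ (s%:R * h ^+ 2)).
        by rewrite ler_wpM2r ?sqr_ge0.
      have := hs; have := h0; have := sR; nra.
  have [ax [ax0 ax4 ax1 axd]] := rnd x x1 xG.
  have [ay [ay0 ay4 ay1 ayd]] := rnd y y1 yG.
  set x' := \col_c ((ax c)%:~R * h) in ax1 axd.
  set y' := \col_c ((ay c)%:~R * h) in ay1 ayd.
  have x'G c : c \notin G -> x' c 0 = 0 by move=> cG; rewrite mxE ax0 // mul0r.
  have y'G c : c \notin G -> y' c 0 = 0 by move=> cG; rewrite mxE ay0 // mul0r.
  have ssum (e : R) : (e = 1) \/ (e = -1) ->
      \sum_c (x' + e *: y') c 0 ^+ 2 <= 4.
    move=> e1; apply: (@le_trans _ _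
      (\sum_c (2 * x' c 0 ^+ 2 + 2 * y' c 0 ^+ 2))).
      apply: ler_sum => c _; rewrite colDE colZE.
      have := sqr_ge0 (x' c 0 - y' c 0); have := sqr_ge0 (x' c 0 + y' c 0).
      by case: e1 => ->; nra.
    by rewrite big_split /= -!mulr_sumr; lra.
  have net (e : R) (ei : int) : e = ei%:~R -> (e = 1) \/ (e = -1) ->
      `|ei| = 1 -> `|B (x' + e *: y') (x' + e *: y')| <= F.
    move=> eE e1 ei1.
    have [] := @net_vec_onto G (fun c => ax c + ei * ay c) Gs.
    - move=> c; apply: (le_trans (ler_normD _ _)); rewrite normrM ei1 mul1r.
      by have := ax4 c; have := ay4 c; lia.
    - by move=> c cG; rewrite ax0 // ay0 // mulr0.
    move=> u uE.
    have zE : net_vec u = x' + e *: y'.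
      by rewrite uE; apply/colP => c; rewrite !mxE intrD intrM eE; ring.
    have gu : net_good u.
      rewrite /net_good zE ssum //=.
      apply: (l1_le_sparse Gs) => [c cG|]; last exact: ssum.
      by rewrite !mxE ax0 // ay0 // !mul0r mulr0 addr0.
    have := le_fmax (fun u : net_index => if net_good u then
      `|((net_vec u)^T *m A *m net_vec u) 0 0| else 0) u.
    by rewrite gu zE.
  have n1 := net 1 1 erefl (or_introl erefl) erefl.
  have n2 := net (-1) (-1) erefl (or_intror erefl) erefl.
  rewrite -/(B y x).
  have -> : B y x = B y' x' + B (y - y') x' + B y (x - x').
    by rewrite -(scaleN1r y') -(scaleN1r x') BDl BDr BZl BZr; ring.
  have e1 : `|B y' x'| <= F / 2.
    have -> : B y' x' = 4^-1 *
       (B (x' + 1 *: y') (x' + 1 *: y') - B (x' + -1 *: y') (x' + -1 *: y')).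
      by rewrite !(BDl, BDr, BZl, BZr) (BC x' y'); field.
    rewrite normrM gtr0_norm //.
    by have := ler_normB (B (x' + 1 *: y') (x' + 1 *: y'))
      (B (x' + -1 *: y') (x' + -1 *: y')); lra.
  have e2 : `|B (y - y') x'| <= M * (1 * 4^-1).
    apply: (B_homogeneous Gs) => //; last by rewrite expr1n.
    by move=> c cG; rewrite colBE yG // y'G // subr0.
  have e3 : `|B y (x - x')| <= M * (4^-1 * 1).
    apply: (B_homogeneous Gs) => //; last by rewrite -l2norm_sqr y1.
    by move=> c cG; rewrite colBE xG // x'G // subr0.
  apply: (le_trans (ler_normD _ _)).
  by have := ler_normD (B y' x') (B (y - y') x'); lra.
have : M <= F / 2 + M / 2 by apply: ge_sup => // r; exact: half.
lra.
Qed.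

End symmetric_matrix.

End sparse_net.

(** * Decoupling and the expected deviation *)

Section decoupling.
Context (R : realFieldType) (I : finType).

Let sgn (S : {ffun I -> bool}) (k : I) : R := if S k then 1 else -1.

Let flip (j : I) (S : {ffun I -> bool}) : {ffun I -> bool} :=
  [ffun k => if k == j then ~~ S k else S k].

Let flipK j : involutive (flip j).
Proof. by move=> S; apply/ffunP => k; rewrite !ffunE; case: eqP => // _; rewrite negbK. Qed.

Let sum_sgn k : \sum_S sgn S k = 0.
Proof.
have e : \sum_S sgn S k = - \sum_S sgn S k.
  rewrite [LHS](reindex_inj (inv_inj (flipK k))) /= -sumrN.
  by apply: eq_bigr => S _; rewrite /sgn ffunE eqxx; case: (S k); rewrite ?opprK.
by lra.
Qed.

Let sum_sgn2 k l : k != l -> \sum_S sgn S k * sgn S l = 0.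
Proof.
move=> kl; have e : \sum_S sgn S k * sgn S l = - \sum_S sgn S k * sgn S l.
  rewrite [LHS](reindex_inj (inv_inj (flipK k))) /= -sumrN.
  apply: eq_bigr => S _; rewrite /sgn !ffunE eqxx eq_sym (negbTE kl).
  by case: (S k); rewrite /= ?mulN1r ?mul1r ?opprK.
by lra.
Qed.

Definition restrict (S : I -> bool) (x : I -> R) (k : I) : R :=
  if S k then x k else 0.

(* A uniformly random subset contains [k] and misses [l] with probability 1/4
   when [k != l], and never when [k = l]. *)
Lemma random_subset_decoupling (M : I -> I -> R) (x : I -> R) :
  \sum_(S : {ffun I -> bool}) 4 * (\sum_k \sum_l
     restrict S x k * restrict (fun j => ~~ S j) x l * M k l) =
  #|{ffun I -> bool}|%:R *
    (\sum_k \sum_l x k * x l * M k l - \sum_k x k ^+ 2 * M k k).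
Proof.
under eq_bigr do rewrite mulr_sumr.
rewrite exchange_big /= -sumrB mulr_sumr; apply: eq_bigr => k _.
under eq_bigr do rewrite mulr_sumr.
rewrite exchange_big /=.
have -> : \sum_l x k * x l * M k l - x k ^+ 2 * M k k =
    \sum_l (if l == k then 0 else x k * x l * M k l).
  rewrite (bigD1 k) //= [RHS](bigD1 k) //= eqxx add0r expr2 addrAC subrr add0r.
  by apply: eq_bigr => l /negbTE ->.
rewrite mulr_sumr; apply: eq_bigr => l _.
(* Indicators become random signs: the factor is [(1 + sgn k)(1 - sgn l)], which averages to 1 for
   [l != k] and vanishes for [l = k]. *)
have E (S : {ffun I -> bool}) :
    4 * (restrict S x k * restrict (fun j => ~~ S j) x l * M k l) =
    (1 + sgn S k - sgn S l - sgn S k * sgn S l) * (x k * x l * M k l).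
  rewrite /restrict /sgn; case: (S k); case: (S l) => /=; ring.
under eq_bigr do rewrite E.
rewrite -mulr_suml; have [->|lk] := eqVneq l k.
  rewrite big1 ?mul0r ?mulr0 // => S _; rewrite /sgn; case: (S k); ring.
rewrite !sumrB big_split /= !sum_sgn sum_sgn2 1?eq_sym // sumr_const.
by rewrite addr0 !subr0.
Qed.

End decoupling.

(** The exponential constant is harmless: only finiteness is drawn from it, in [dev_finite]. *)
Lemma sqr_sum_le (R : realDomainType) (J : Type) (r : seq J) (a : J -> R) :
  (\sum_(j <- r) a j) ^+ 2 <= 2 ^+ size r * \sum_(j <- r) a j ^+ 2.
Proof.
elim: r => [|j r IH]; first by rewrite !big_nil expr0n mulr0.
rewrite !big_cons /= [2 ^+ (size r).+1]exprS.
set S := \sum_(i <- r) a i in IH *; set Q := \sum_(i <- r) _ in IH *.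
have e1 : 1 <= 2 ^+ size r :> R by rewrite exprn_ege1 // ler1n.
set e := 2 ^+ size r in e1 IH *.
have h1 : a j ^+ 2 <= e * a j ^+ 2 by rewrite ler_peMl // sqr_ge0.
by have := sqr_ge0 (a j - S); rewrite sqrrB sqrrD; lra.
Qed.

Section gram_form.
Context (R : realType) (N : nat) (J : finType) (V : J -> 'I_N -> R[i]).

Definition lin_comb (v : 'I_N -> R[i]) (x : 'cV[R]_N) : R[i] :=
  \sum_c ((x c 0)%:C)%C * v c.

Definition gram (x y : 'cV[R]_N) : R :=
  \sum_j rdot (lin_comb (V j) x) (lin_comb (V j) y).

Lemma gramD x y z : gram (x + y) z = gram x z + gram y z.
Proof.
rewrite /gram -big_split; apply: eq_bigr => j _ /=; rewrite -rdotDl.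
congr rdot; rewrite /lin_comb -big_split; apply: eq_bigr => c _ /=.
by rewrite mxE rmorphD mulrDl.
Qed.

Lemma gramZ k x z : gram (k *: x) z = k * gram x z.
Proof.
rewrite /gram mulr_sumr; apply: eq_bigr => j _; rewrite -rdotZl; congr rdot.
rewrite /lin_comb mulr_sumr; apply: eq_bigr => c _.
by rewrite mxE rmorphM mulrA.
Qed.

Lemma gramC x y : gram x y = gram y x.
Proof. by apply: eq_bigr => j _; rewrite rdotC. Qed.

Lemma gram_ge0 x : 0 <= gram x x.
Proof. by apply: sumr_ge0 => j _; exact: nsq_ge0. Qed.

Lemma gram_delta c : gram (delta_mx c 0) (delta_mx c 0) = \sum_j nsq (V j c).
Proof.
apply: eq_bigr => j _; rewrite rdot_nsq /lin_comb (bigD1 c) //= big1 ?addr0.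
  by rewrite mxE !eqxx mul1r.
by move=> e /negbTE ec; rewrite mxE ec mul0r.
Qed.

End gram_form.

(** * The deviation as a quadratic form in the probes *)

Section deviation.
Context (R : realType) (n p m s : nat).
Local Notation I := ('I_p * 'I_m)%type.
Local Notation N := (n * p)%N.
Hypothesis n0 : (0 < n)%N.
Hypothesis p0 : (0 < p)%N.
Hypothesis nm : (n <= m)%N.
Context (zeta : R[i]).
Hypothesis zetaP : m.-primitive_root zeta.

Let m0 : (0 < m)%N. Proof. exact: leq_trans n0 nm. Qed.
Let mR : 0 < m%:R :> R. Proof. by rewrite ltr0n. Qed.

Local Notation U := (net_index N s).
Local Notation vec := (@net_vec R N s).
Local Notation good := (@net_good R N s).

Local Notation act := (act n0 nm).
Local Notation corr := (corr n0 nm).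
Local Notation unit_probe := (@unit_probe R p m).
Local Notation dftr f := (dft zeta (fun t => ((f t)%:C)%C)).

Definition energy (x : rvec R I) (z : 'cV[R]_N) : R := \sum_r act x z r ^+ 2.

Definition net_max (F : 'cV[R]_N -> R) : R :=
  fmax (fun u : U => if good u then F (vec u) else 0).

Definition dev (x : rvec R I) : R :=
  net_max (fun z => `|energy x z - \sum_c z c 0 ^+ 2|).

Definition energy_max (x : rvec R I) : R := net_max (energy x).

(** Two probe arguments, so that the entries in [S] and those off [S] can come from independent
    copies. *)
Definition cross (S : I -> bool) (x y : rvec R I) : R := net_max (fun z =>
  `|\sum_r act (restrict S x) z r * act (restrict (fun k => ~~ S k) y) z r|).

(** Real and imaginary parts are kept apart because each is a real linear form in the probes, to
    which [gaussian_fmax] applies. The summand 1 allows division in [lip_vec]. *)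
Definition spectral_max (x : rvec R I) : R :=
  1 + fmax (fun j : I => `|complex.Re (dftr (fun t => x (j.1, t)) j.2)|)
    + fmax (fun j : I => `|complex.Im (dftr (fun t => x (j.1, t)) j.2)|).

Lemma le_net_max F (u : U) : good u -> F (vec u) <= net_max F.
Proof.
move=> gu; have := le_fmax (fun u : U => if good u then F (vec u) else 0) u.
by rewrite gu.
Qed.

Lemma net_max_le F c : 0 <= c -> (forall u : U, good u -> F (vec u) <= c) ->
  net_max F <= c.
Proof. by move=> c0 H; apply: fmax_le => // u; case: ifPn => // gu; exact: H. Qed.

Lemma net_max_ge0 F : 0 <= net_max F.
Proof. exact: fmax_ge0. Qed.

Lemma good_l2 (u : U) : good u -> \sum_c vec u c 0 ^+ 2 <= 4.
Proof. by move/andP => []. Qed.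

Lemma act_expand x y z : \sum_r act x z r * act y z r =
  \sum_k \sum_l x k * y l *
    (\sum_r act (unit_probe k) z r * act (unit_probe l) z r).
Proof.
under eq_bigr => r _.
  rewrite (act_probe n0 nm x) (act_probe n0 nm y) mulr_suml.
  under eq_bigr do rewrite mulr_sumr; over.
rewrite exchange_big; apply: eq_bigr => k _ /=.
rewrite exchange_big; apply: eq_bigr => l _ /=.
by rewrite mulr_sumr; apply: eq_bigr => r _; ring.
Qed.

(** The diagonal coefficients [q_i] are constant on blocks by [unit_probe_energy] and sum to the
    squared norm of [z] by [block_dft_energy], so subtracting that norm centres each block sum at
    1. *)
Lemma energy_offdiag x z : energy x z - \sum_c z c 0 ^+ 2 =
  #|{ffun I -> bool}|%:R^-1 * (\sum_(S : {ffun I -> bool})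
    4 * \sum_r act (restrict S x) z r * act (restrict (fun k => ~~ S k) x) z r)
  + \sum_i (m%:R^-1 * \sum_(w < m) nsq (block_dft n0 zeta z i w)) *
      (\sum_t x (i, t) ^+ 2 - 1).
Proof.
have c0 : #|{ffun I -> bool}|%:R != 0 :> R.
  by rewrite pnatr_eq0 card_ffun card_bool expn_eq0.
under [X in _ * X + _]eq_bigr do rewrite act_expand.
rewrite random_subset_decoupling mulKf //.
have -> : energy x z = \sum_r act x z r * act x z r.
  by apply: eq_bigr => r _; rewrite expr2.
rewrite act_expand -addrA; congr (_ + _).
have -> : \sum_c z c 0 ^+ 2 =
    \sum_i (m%:R^-1 * \sum_(w < m) nsq (block_dft n0 zeta z i w)).
  rewrite -mulr_sumr exchange_big (block_dft_energy n0 nm zetaP).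
  by rewrite mulKf // gt_eqF.
have -> : \sum_k x k ^+ 2 * (\sum_r act (unit_probe k) z r * act (unit_probe k) z r)
  = \sum_i (m%:R^-1 * \sum_(w < m) nsq (block_dft n0 zeta z i w)) *
      (\sum_t x (i, t) ^+ 2).
  transitivity (\sum_i \sum_t x (i, t) ^+ 2 *
    (\sum_r act (unit_probe (i, t)) z r * act (unit_probe (i, t)) z r)).
    by rewrite pair_bigA; apply: eq_bigr => -[].
  apply: eq_bigr => i _; rewrite mulr_sumr; apply: eq_bigr => t _.
  rewrite -(unit_probe_energy n0 nm zetaP z i t) mulrC.
  by congr (_ * _); apply: eq_bigr => r _; rewrite expr2.
by rewrite -!sumrN -big_split; apply: eq_bigr => i _ /=; ring.
Qed.

Lemma dev_le x : dev x <=
  #|{ffun I -> bool}|%:R^-1 * (\sum_(S : {ffun I -> bool}) 4 * cross S x x)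
  + 4 * fmax (fun i => `|\sum_t x (i, t) ^+ 2 - 1|).
Proof.
have c0 : 0 <= #|{ffun I -> bool}|%:R^-1 :> R by rewrite invr_ge0.
apply: net_max_le => [|u gu].
  rewrite addr_ge0 ?mulr_ge0 ?fmax_ge0 // sumr_ge0 // => S _.
  by rewrite mulr_ge0 ?net_max_ge0.
rewrite energy_offdiag; apply: (le_trans (ler_normD _ _)); apply: lerD.
  rewrite normrM ger0_norm // ler_wpM2l // (le_trans (ler_norm_sum _ _ _)) //.
  apply: ler_sum => S _; rewrite normrM gtr0_norm // ler_wpM2l //.
  exact: (le_net_max (fun z => `|\sum_r act (restrict S x) z r *
    act (restrict (fun k => ~~ S k) x) z r|)).
apply: (le_trans (ler_norm_sum _ _ _)).
set F := fmax _.
have q0 i : 0 <= m%:R^-1 * \sum_(w < m) nsq (block_dft n0 zeta (vec u) i w).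
  by rewrite mulr_ge0 ?invr_ge0 ?sumr_ge0 // => w _; exact: nsq_ge0.
apply: (@le_trans _ _ (\sum_i
  (m%:R^-1 * \sum_(w < m) nsq (block_dft n0 zeta (vec u) i w)) * F)).
  apply: ler_sum => i _; rewrite normrM ger0_norm // ler_wpM2l //.
  exact: (le_fmax (fun i => `|\sum_t x (i, t) ^+ 2 - 1|)).
rewrite -mulr_suml ler_wpM2r ?fmax_ge0 //.
rewrite -mulr_sumr exchange_big (block_dft_energy n0 nm zetaP).
by rewrite mulKf ?gt_eqF // good_l2.
Qed.

Lemma nsq_spectral x i w : nsq (dftr (fun t => x (i, t)) w) <= spectral_max x ^+ 2.
Proof.
rewrite /spectral_max; set A := fmax _; set B := fmax _.
have hA := le_fmax (fun j : I => `|complex.Re (dftr (fun t => x (j.1, t)) j.2)|) (i, w).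
have hB := le_fmax (fun j : I => `|complex.Im (dftr (fun t => x (j.1, t)) j.2)|) (i, w).
rewrite -/A in hA; rewrite -/B in hB; rewrite /= in hA hB.
rewrite /nsq; move: hA hB.
set a := complex.Re _; set b := complex.Im _ => hA hB.
rewrite -(real_normK (num_real a)) -(real_normK (num_real b)).
have := normr_ge0 a; have := normr_ge0 b; nra.
Qed.

Lemma spectral_max_ge1 x : 1 <= spectral_max x.
Proof. by rewrite /spectral_max -addrA lerDl addr_ge0 ?fmax_ge0. Qed.

Definition probe_phase (x : rvec R I) (w : 'I_m) (c : 'I_N) : R[i] :=
  phase zeta c w * dftr (fun t => x (block n0 c, t)) w.

(* [gram (lip_vec x (w, true))] is the energy of the block transforms of [z] at the
   frequency [w]; [gram (lip_vec x (w, false))] is the energy of the transform of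
   [Phi_x z] at [w], divided by [spectral_max x ^+ 2].  The latter is a single
   vector, stored in the first of the [p] slots. *)
Definition lip_vec (x : rvec R I) (a : 'I_m * bool) (i : 'I_p) (c : 'I_N) : R[i] :=
  if a.2 then (if block n0 c == i then phase zeta c a.1 else 0)
  else (if i == Ordinal p0
        then (((spectral_max x)^-1)%:C)%C * probe_phase x a.1 c else 0).

Let nsq_phase (w : 'I_m) (c : 'I_N) : nsq (phase zeta c w) = 1.
Proof. by rewrite /phase nsq_conj (nsq_zetaX zetaP). Qed.

Let nsq0 : nsq (0 : R[i]) = 0.
Proof. by rewrite /nsq /= expr0n addr0. Qed.

Lemma lip_vec_le1 x a c :
  gram (lip_vec x a) (delta_mx c 0) (delta_mx c 0) <= 1.
Proof.
rewrite gram_delta; case: a => w []; rewrite /lip_vec /=.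
  rewrite (bigD1 (block n0 c)) //= eqxx nsq_phase big1 ?addr0 // => i.
  by rewrite eq_sym => /negbTE ->.
rewrite (bigD1 (Ordinal p0)) //= ?eqxx big1 ?addr0; last first.
  by move=> i /negbTE ->; rewrite nsq0.
rewrite nsqM nsq_real /probe_phase nsqM nsq_phase mul1r exprVn.
have k1 := spectral_max_ge1 x.
rewrite ler_pdivrMl ?exprn_gt0 ?mulr1 ?nsq_spectral //; lra.
Qed.

Let gram_true x w z :
  gram (lip_vec x (w, true)) z z = \sum_i nsq (block_dft n0 zeta z i w).
Proof.
apply: eq_bigr => i _; rewrite rdot_nsq; congr nsq.
rewrite /lin_comb /block_dft /lip_vec /= [RHS]big_mkcond.
by apply: eq_bigr => c _; case: eqP; rewrite ?mulr0.
Qed.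

Let gram_false x w z : gram (lip_vec x (w, false)) z z =
  nsq (dftr (act x z) w) / spectral_max x ^+ 2.
Proof.
rewrite /gram (bigD1 (Ordinal p0)) //= big1 ?addr0; last first.
  move=> i /negbTE ip; rewrite /lin_comb /lip_vec /= ip.
  by rewrite big1 ?rdot_nsq ?nsq0 // => c _; rewrite mulr0.
rewrite rdot_nsq (dft_act n0 nm zetaP) mulrC -exprVn -nsq_real -nsqM; congr nsq.
rewrite mulr_sumr; apply: eq_bigr => c _; rewrite /lip_vec /= ?eqxx /probe_phase.
by rewrite mulrCA.
Qed.

(** Product rule: the difference is [corr (act x y1) (y1 - y2)] plus [corr (act x (y1 - y2)) y2].
    The first is controlled by the block transforms of [y1 - y2], the second by the spectrum of its
    image. The constant dominates [sqrt(2 M + 8 K^2)] and is linear in [M] and [K], so that it can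
    be integrated directly. *)
Lemma act_lipschitz x y1 y2 t M : 0 <= t ->
  (forall a, gram (lip_vec x a) (y1 - y2) (y1 - y2) <= t ^+ 2) ->
  energy x y1 <= M -> \sum_c y2 c 0 ^+ 2 <= 4 ->
  \sum_k (corr (act x y1) y1 k - corr (act x y2) y2 k) ^+ 2
    <= ((1 + M + 4 * spectral_max x) * t) ^+ 2.
Proof.
move=> t0 gt xM y24.
have K1 := spectral_max_ge1 x; set K := spectral_max x in K1 *.
have M0 : 0 <= M by apply: le_trans xM; apply: sumr_ge0 => r _; exact: sqr_ge0.
pose A k := corr (act x y1) (y1 - y2) k.
pose B k := corr (act x (y1 - y2)) y2 k.
have E k : corr (act x y1) y1 k - corr (act x y2) y2 k = A k + B k.
  rewrite /A /B /corr -sumrB -big_split; apply: eq_bigr => r _ /=.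
  rewrite !actB; ring.
have hA : \sum_k A k ^+ 2 <= t ^+ 2 * M.
  have h1 : \sum_k A k ^+ 2 <= t ^+ 2 * energy x y1.
    rewrite /A /energy; apply: (@corr_sqr_le_block_dft _ _ _ _ n0 nm _ zetaP) => w.
    by rewrite -(gram_true x); exact: gt.
  by apply: (le_trans h1); rewrite ler_wpM2l ?sqr_ge0.
have hB : \sum_k B k ^+ 2 <= t ^+ 2 * K ^+ 2 * 4.
  have h1 : \sum_k B k ^+ 2 <= t ^+ 2 * K ^+ 2 * \sum_c y2 c 0 ^+ 2.
    rewrite /B; apply: (@corr_sqr_le_dft _ _ _ _ n0 nm _ zetaP) => w.
    rewrite -ler_pdivrMr ?exprn_gt0 //; last by lra.
    by rewrite -gram_false; exact: gt.
  by apply: (le_trans h1); rewrite ler_wpM2l // mulr_ge0 ?sqr_ge0.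
apply: (@le_trans _ _ (2 * \sum_k A k ^+ 2 + 2 * \sum_k B k ^+ 2)).
  rewrite !mulr_sumr -big_split; apply: ler_sum => k _ /=; rewrite E.
  by have := sqr_ge0 (A k - B k); rewrite sqrrB sqrrD; lra.
apply: (@le_trans _ _ ((2 * M + 8 * K ^+ 2) * t ^+ 2)); first lra.
rewrite [leRHS]exprMn ler_wpM2r ?sqr_ge0 //; nra.
Qed.

End deviation.

(* No measurability is needed, since the integral of a nonnegative function is a
   supremum over the simple functions below it; the sparse norm is thus never
   shown to be measurable. *)
Lemma ge0_le_integral_any (R : realType) (d : measure_display)
    (T : measurableType d) (P : probability T R) (f g : T -> \bar R) :
  (forall w, 0 <= f w)%E -> (forall w, f w <= g w)%E ->
  (\int[P]_w f w <= \int[P]_w g w)%E.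
Proof.
move=> f0 fg; have g0 w : (0 <= g w)%E := le_trans (f0 w) (fg w).
rewrite !ge0_integralTE //; apply: ereal_sup_le => _ [h /= hf <-].
by exists h => //= w; exact: le_trans (hf w) (fg w).
Qed.

(** The bound of [chaining] for [sigma = m^(-1/2)], [rho = 2 sqrt s] and [2 m] seminorms, without
    the Lipschitz factor [D]. *)
Definition chain_rate (R : realType) (n p m s J : nat) : R :=
  Num.sqrt (m%:R^-1) * (2 * Num.sqrt s%:R) * Num.sqrt (ln (m * 2)%:R + 1) *
    (192 * J%:R * Num.sqrt (ln (2 * (n * p) + 1)%:R)
     + 32 * (Num.sqrt (ln (2 * #|net_index (n * p) s|%:R) + 1) / 2 ^+ J)).

(** The order of the largest of the [p m] Fourier coefficients of the probes. *)
Definition probe_rate (R : realType) (p m : nat) : R :=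
  Num.sqrt (ln (2 * (p * m)%:R) + 1).

(** * Integrating over the probes and absorbing the expected deviation *)

Section expected_deviation.
Context (R : realType) (d : measure_display) (T : measurableType d)
  (P : probability T R) (n p m s : nat).
Local Notation I := ('I_p * 'I_m)%type.
Local Notation N := (n * p)%N.
Context (X : T -> rvec R I).
Hypothesis n0 : (0 < n)%N.
Hypothesis p0 : (0 < p)%N.
Hypothesis nm : (n <= m)%N.
Hypothesis s0 : (0 < s)%N.
Hypothesis mX : forall k, measurable_fun setT (fun w => X w k).
Hypothesis indepX : mutually_independent P (fun k w => X w k).
Hypothesis lawX : forall k (B : set R), measurable B ->
  P ((fun w => X w k) @^-1` B) = normal_prob 0 (Num.sqrt (m%:R^-1)) B.
Context (zeta : R[i]).
Hypothesis zetaP : m.-primitive_root zeta.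

Let m0 : (0 < m)%N. Proof. exact: leq_trans n0 nm. Qed.
Let N0 : (0 < N)%N. Proof. by rewrite muln_gt0 n0. Qed.
Let mR : 0 < m%:R :> R. Proof. by rewrite ltr0n. Qed.
Let sigma0 : 0 < Num.sqrt (m%:R^-1) :> R.
Proof. by rewrite sqrtr_gt0 invr_gt0. Qed.

Local Notation vec := (@net_vec R N s).
Local Notation good := (@net_good R N s).
Local Notation act := (act n0 nm).
Local Notation corr := (corr n0 nm).
Local Notation energy := (energy n0 nm).
Local Notation dev := (dev s n0 nm).
Local Notation cross := (cross s n0 nm).
Local Notation energy_max := (energy_max s n0 nm).
Local Notation spectral_max := (spectral_max zeta).
Local Notation dftr f := (dft zeta (fun t => ((f t)%:C)%C)).

Let measurable_act (z : 'cV[R]_N) (r : 'I_m) : measurable_fun setT (fun x : rvec R I => act x z r).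
Proof.
apply: measurable_rsum => c; apply: measurable_funM => //.
exact: measurable_coord.
Qed.

Let measurable_net_max (F : rvec R I -> 'cV[R]_N -> R) :
  (forall z, measurable_fun setT (fun x => F x z)) ->
  measurable_fun setT (fun x => net_max s (F x)).
Proof. by move=> mF; apply: measurable_fmax => u; case: (good u). Qed.

Let measurable_energy (z : 'cV[R]_N) :
  measurable_fun setT (fun x : rvec R I => energy x z).
Proof. by apply: measurable_rsum => r; exact: measurable_funX. Qed.

Let measurable_dev : measurable_fun setT (dev : rvec R I -> R).
Proof.
apply: measurable_net_max => z; apply: measurableT_comp => //.
exact: measurable_funB.
Qed.

Let measurable_energy_max : measurable_fun setT (energy_max : rvec R I -> R).
Proof. exact: measurable_net_max. Qed.

Let measurable_restrict S :
  measurable_fun setT (fun x : rvec R I => (restrict S x : rvec R I)).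
Proof.
apply: measurable_to_rvec => k; rewrite /restrict; case: (S k) => //.
exact: measurable_coord.
Qed.

Let measurable_cross S : measurable_fun setT (fun x : rvec R I => cross S x x).
Proof.
apply: measurable_net_max => z; apply: measurableT_comp => //.
apply: measurable_rsum => r; apply: measurable_funM.
  exact: (measurableT_comp (measurable_act z r) (measurable_restrict S)).
exact: (measurableT_comp (measurable_act z r)
  (measurable_restrict (fun k => ~~ S k))).
Qed.

Let Re_dft (f : 'I_m -> R) w : complex.Re (dftr f w) =
  \sum_(t < m) complex.Re (zeta ^+ (w * t)) * f t.
Proof.
rewrite /dft raddf_sum; apply: eq_bigr => t _.
by case: (zeta ^+ (w * t)) => a b /=; rewrite mulr0 subr0.
Qed.

Let Im_dft (f : 'I_m -> R) w : complex.Im (dftr f w) =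
  \sum_(t < m) complex.Im (zeta ^+ (w * t)) * f t.
Proof.
rewrite /dft raddf_sum; apply: eq_bigr => t _.
by case: (zeta ^+ (w * t)) => a b /=; rewrite mulr0 add0r.
Qed.

Let measurable_spectral_max :
  measurable_fun setT (spectral_max : rvec R I -> R).
Proof.
apply: measurable_funD; first apply: measurable_funD => //.
  apply: measurable_fmax => j; apply: measurableT_comp => //.
  under eq_fun do rewrite Re_dft; apply: measurable_rsum => t.
  by apply: measurable_funM => //; exact: measurable_coord.
apply: measurable_fmax => j; apply: measurableT_comp => //.
under eq_fun do rewrite Im_dft; apply: measurable_rsum => t.
by apply: measurable_funM => //; exact: measurable_coord.
Qed.

Let act0 (x : rvec R I) (r : 'I_m) : act x 0 r = 0.
Proof. by rewrite -(scale0r (0 : 'cV[R]_N)) actZ mul0r. Qed.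

Lemma cross_expectation_le S (x : rvec R I) (J : nat) :
  (\int[P]_w (cross S x (X w))%:E <=
   ((1 + energy_max (restrict S x) + 4 * spectral_max (restrict S x)) *
     chain_rate R n p m s J)%:E)%E.
Proof.
pose y : rvec R I := restrict S x.
(* Coefficients set to 0 on [S] encode the restriction of the remaining probes, so [chaining] can
   use the whole vector [X]. *)
pose f (u : net_index N s) (k : I) : R :=
  if S k then 0 else corr (act y (vec u)) (vec u) k.
pose D := 1 + energy_max y + 4 * spectral_max y.
have D0 : 0 < D.
  have h1 := spectral_max_ge1 zeta y.
  have h2 : 0 <= energy_max y by exact: net_max_ge0.
  by rewrite /D; lra.
have s0R : 0 < s%:R :> R by rewrite ltr0n.
have rho0 : 0 < 2 * Num.sqrt s%:R :> R by rewrite mulr_gt0 // sqrtr_gt0.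
have fE u w : \sum_k f u k * X w k =
    \sum_r act y (vec u) r * act (restrict (fun k => ~~ S k) (X w)) (vec u) r.
  under [RHS]eq_bigr => r _.
    rewrite (act_probe n0 nm (restrict (fun k => ~~ S k) (X w))) mulr_sumr; over.
  rewrite exchange_big; apply: eq_bigr => k _ /=; rewrite /f /restrict.
  case: (S k) => /=.
    by rewrite mul0r big1 // => r _; rewrite mul0r mulr0.
  by rewrite /corr mulr_suml; apply: eq_bigr => r _; ring.
pose b (a : 'I_m * bool) := gram (lip_vec n0 p0 zeta y a).
have A0 : (0 < #|{: 'I_m * bool}|)%N.
  by rewrite card_prod card_ord card_bool muln_gt0 m0.
have lip (u v : net_index N s) (t : R) : good u -> good v -> 0 <= t ->
    (forall a, b a (vec u - vec v) (vec u - vec v) <= t ^+ 2) ->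
    \sum_k (f u k - f v k) ^+ 2 <= (D * t) ^+ 2.
  move=> gu gv t0 Ht.
  have := act_lipschitz (nm := nm) zetaP t0 Ht
    (le_net_max (energy y) gu) (good_l2 gv).
  apply: le_trans; apply: ler_sum => k _; rewrite /f; case: (S k) => //.
  by rewrite subrr expr0n /= sqr_ge0.
have f0 k : f (net_center s N0) k = 0.
  rewrite /f net_vec_center; case: (S k) => //.
  by rewrite /corr big1 // => r _; rewrite act0 mul0r.
have l1 (u : net_index N s) : good u -> \sum_c `|vec u c 0| <= 2 * Num.sqrt s%:R.
  by move/andP => [].
have H := chaining sigma0 mX indepX lawX (b := b)
  (fun a => gramD (lip_vec n0 p0 zeta y a))
  (fun a => gramZ (lip_vec n0 p0 zeta y a))
  (fun a => gramC (lip_vec n0 p0 zeta y a))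
  (fun a => gram_ge0 (lip_vec n0 p0 zeta y a))
  (lip_vec_le1 n0 p0 zetaP y) A0 N0
  (net_good_center R s N0) (net_vec_center R s N0) f0 rho0 D0 l1 lip J.
apply: le_trans (le_trans H _).
  rewrite le_eqVlt; apply/orP; left; apply/eqP; apply: eq_integral => w _.
  rewrite /cross /net_max; congr (fmax _)%:E; apply/funext => u.
  by case: (good u) => //; rewrite fE.
rewrite lee_fin /chain_rate card_prod card_ord card_bool -/y -/D.
by rewrite le_eqVlt; apply/orP; left; apply/eqP; ring.
Qed.

Let flip (S : I -> bool) (x : rvec R I) : rvec R I :=
  fun k => if S k then x k else - x k.

(* The restriction to [S] is the half-sum of [x] and of its sign flip off [S],
   which has the same law. *)
Lemma energy_max_restrict S (x : rvec R I) :
  energy_max (restrict S x) <= 2^-1 * (energy_max x + energy_max (flip S x)).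
Proof.
apply: net_max_le => [|u gu].
  by rewrite mulr_ge0 ?invr_ge0 ?addr_ge0 ?net_max_ge0.
have h1 := le_net_max (energy x) gu.
have h2 := le_net_max (energy (flip S x)) gu.
rewrite -/(energy_max x) in h1; rewrite -/(energy_max (flip S x)) in h2.
apply: (@le_trans _ _ (2^-1 * (energy x (vec u) + energy (flip S x) (vec u)))); last first.
  by apply: ler_wpM2l; [rewrite invr_ge0|exact: lerD].
rewrite /energy -big_split mulr_sumr; apply: ler_sum => r _ /=.
have -> : act (restrict S x) (vec u) r =
    2^-1 * (act x (vec u) r + act (flip S x) (vec u) r).
  rewrite /act -big_split mulr_sumr; apply: eq_bigr => c _ /=.
  by rewrite /restrict /flip; case: ifP => _; field.
have := sqr_ge0 (act x (vec u) r - act (flip S x) (vec u) r).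
by rewrite sqrrB exprMn sqrrD; lra.
Qed.

Let measurable_comp_X (F : rvec R I -> R) : measurable_fun setT F ->
  measurable_fun setT (fun w => F (X w)).
Proof.
by move=> mF; apply: (measurableT_comp mF); exact: measurable_to_rvec.
Qed.

Lemma energy_max_expectation S :
  (\int[P]_w (energy_max (restrict S (X w)))%:E
    <= 4%:E + \int[P]_w (dev (X w))%:E)%E.
Proof.
have mflip : measurable_fun setT (fun w => flip S (X w)).
  apply: measurable_to_rvec => k; rewrite /flip; case: (S k) => //.
  exact: measurableT_comp.
have E1 : (\int[P]_w (energy_max (X w))%:E
    <= 4%:E + \int[P]_w (dev (X w))%:E)%E.
  apply: (@le_trans _ _ (\int[P]_w (4 + dev (X w))%:E)%E).
    apply: le_expectation.
    - exact: measurable_comp_X.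
    - by apply: measurable_funD => //; exact: measurable_comp_X.
    - by move=> w; exact: net_max_ge0.
    - move=> w; apply: net_max_le => [|u gu]; first by rewrite addr_ge0 ?net_max_ge0.
      have := le_net_max (fun z => `|energy (X w) z - \sum_c z c 0 ^+ 2|) gu.
      have := good_l2 gu; rewrite -/(dev (X w)).
      by have := ler_norm (energy (X w) (vec u) - \sum_c vec u c 0 ^+ 2); lra.
  rewrite expectationD ?expectation_cst //; first exact: measurable_comp_X.
  by move=> w; exact: net_max_ge0.
have E2 : (\int[P]_w (energy_max (flip S (X w)))%:E =
    \int[P]_w (energy_max (X w))%:E)%E.
  apply/esym; apply: (flip_integral mX indepX S
    (F := fun x => (energy_max x)%:E)).
  - move=> k B mB; exact: (gaussian_sym sigma0 (@lawX k) mB).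
  - exact/measurable_EFinP.
  - by move=> x; rewrite lee_fin net_max_ge0.
apply: le_trans E1.
apply: (@le_trans _ _ (\int[P]_w
   (2^-1 * (energy_max (X w) + energy_max (flip S (X w))))%:E)%E).
  apply: le_expectation.
  - apply: (measurableT_comp measurable_energy_max).
    exact: (measurableT_comp (measurable_restrict S) (measurable_to_rvec mX)).
  - apply: measurable_funM => //; apply: measurable_funD.
      exact: measurable_comp_X.
    exact: (measurableT_comp measurable_energy_max mflip).
  - by move=> w; exact: net_max_ge0.
  - by move=> w; exact: energy_max_restrict.
have mE1 := measurable_comp_X measurable_energy_max.
have mE2 := measurableT_comp measurable_energy_max mflip.
rewrite expectationZ //; last 2 first.
- exact: measurable_funD.
- by move=> w; rewrite addr_ge0 ?net_max_ge0.
rewrite expectationD //; try by move=> w; exact: net_max_ge0.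
rewrite E2; have : (0 <= \int[P]_w (energy_max (X w))%:E)%E.
  by apply: integral_ge0 => w _; rewrite lee_fin net_max_ge0.
move: (\int[P]_w (energy_max (X w))%:E)%E => [r| |] //= r0.
  by rewrite -EFinD -EFinM lee_fin; lra.
exact: leey.
Qed.

Local Notation kappa := (probe_rate R p m).

Let sum_pair (h : I -> R) : \sum_k h k = \sum_i \sum_t h (i, t).
Proof. by rewrite pair_bigA; apply: eq_bigr => -[]. Qed.

(** With [m] coefficients of size at most 1 and probe variance [1 / m], each of the [p m] forms has
    variance at most 1. *)
Let trig_expectation S (c : 'I_m -> 'I_m -> R) :
  (forall w t, c w t ^+ 2 <= 1) ->
  (\int[P]_w (fmax (fun j : I =>
      `|\sum_(t < m) c j.2 t * restrict S (X w) (j.1, t)|))%:E <= (2 * kappa)%:E)%E.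
Proof.
move=> c1.
pose b (j k : I) : R := if (k.1 == j.1) && S k then c j.2 k.2 else 0.
have bE w (j : I) : \sum_(t < m) c j.2 t * restrict S (X w) (j.1, t) =
    \sum_k b j k * X w k.
  rewrite sum_pair /=.
  rewrite (bigD1 j.1) //= [X in _ + X]big1 ?addr0; last first.
    move=> i /negbTE ij; rewrite big1 // => t _.
    by rewrite /b /= ij mul0r.
  apply: eq_bigr => t _; rewrite /b /restrict /= eqxx /=.
  by case: (S (j.1, t)); rewrite ?mulr0 ?mul0r.
under eq_integral => w _.
  rewrite (_ : fmax _ = fmax (fun j => `|\sum_k b j k * X w k|)); last first.
    by congr fmax; apply/funext => j; rewrite bE.
  over.
have sm : 0 < Num.sqrt m%:R :> R by rewrite sqrtr_gt0.
apply: le_trans (gaussian_fmax sigma0 mX indepX lawX sm _) _.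
  move=> j; rewrite sqr_sqrtr ?ler0n //.
  rewrite sum_pair /=.
  rewrite (bigD1 j.1) //= [X in _ + X]big1 ?addr0; last first.
    move=> i /negbTE ij; rewrite big1 // => t _.
    by rewrite /b /= ij expr0n.
  apply: (@le_trans _ _ (\sum_(t < m) 1)).
    apply: ler_sum => t _; rewrite /b /= eqxx /=.
    by case: (S (j.1, t)); rewrite ?expr0n ?ler01.
  by rewrite sumr_const card_ord.
rewrite card_prod !card_ord -/(probe_rate R p m) lee_fin -mulrA [Num.sqrt m%:R * _]mulrC.
rewrite -[X in X <= _]mulrA.
have ss : Num.sqrt (m%:R^-1) * Num.sqrt m%:R = 1 :> R.
  by rewrite -sqrtrM ?invr_ge0 ?ler0n // mulVf ?sqrtr1 // gt_eqF.
rewrite le_eqVlt; apply/orP; left; apply/eqP.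
transitivity (2 * kappa * (Num.sqrt (m%:R^-1) * Num.sqrt m%:R)); first by ring.
by rewrite ss mulr1.
Qed.

Let nsq_zeta_le1 k : complex.Re (zeta ^+ k) ^+ 2 <= 1 /\
  complex.Im (zeta ^+ k) ^+ 2 <= 1.
Proof.
have := nsq_zetaX zetaP k; rewrite /nsq.
by have := sqr_ge0 (complex.Re (zeta ^+ k)); have := sqr_ge0 (complex.Im (zeta ^+ k));
  split; lra.
Qed.

Lemma spectral_max_expectation S :
  (\int[P]_w (spectral_max (restrict S (X w)))%:E <= (1 + 4 * kappa)%:E)%E.
Proof.
have mrX : measurable_fun setT (fun w => (restrict S (X w) : rvec R I)).
  exact: (measurableT_comp (measurable_restrict S) (measurable_to_rvec mX)).
pose FR w := fmax (fun j : I =>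
  `|\sum_(t < m) complex.Re (zeta ^+ (j.2 * t)) * restrict S (X w) (j.1, t)|).
pose FI w := fmax (fun j : I =>
  `|\sum_(t < m) complex.Im (zeta ^+ (j.2 * t)) * restrict S (X w) (j.1, t)|).
have E w : spectral_max (restrict S (X w)) = 1 + FR w + FI w.
  rewrite /spectral_max /FR /FI; congr (_ + _ + _); congr fmax;
    apply/funext => j; by rewrite ?Re_dft ?Im_dft.
have mcoord k : measurable_fun setT (fun w => restrict S (X w) k).
  exact: (measurableT_comp (measurable_coord k) mrX).
have mFR : measurable_fun setT FR.
  apply: measurable_fmax => j; apply: measurableT_comp => //.
  by apply: measurable_rsum => t; exact: measurable_funM.
have mFI : measurable_fun setT FI.
  apply: measurable_fmax => j; apply: measurableT_comp => //.
  by apply: measurable_rsum => t; exact: measurable_funM.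
under eq_integral do rewrite E.
rewrite expectationD //; last 3 first.
- exact: measurable_funD.
- by move=> w; rewrite addr_ge0 ?fmax_ge0.
- by move=> w; exact: fmax_ge0.
rewrite expectationD //; last by move=> w; exact: fmax_ge0.
rewrite expectation_cst.
have hR := trig_expectation S (c := fun w t => complex.Re (zeta ^+ (w * t)))
  (fun w t => (nsq_zeta_le1 _).1).
have hI := trig_expectation S (c := fun w t => complex.Im (zeta ^+ (w * t)))
  (fun w t => (nsq_zeta_le1 _).2).
rewrite (_ : 1 + 4 * kappa = 1 + 2 * kappa + 2 * kappa); last by ring.
by rewrite !EFinD; apply: leeD => //; exact: leeD2l.
Qed.

(** After [mix_integral], [cross_expectation_le] bounds the inner integral, and the Lipschitz factor
    is then integrated over the probes in [S]. The constant is
    [9 + 16 kappa = 1 + 4 + 4 (1 + 4 kappa)]. *)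
Lemma cross_expectation S J :
  (\int[P]_w (cross S (X w) (X w))%:E <= (chain_rate R n p m s J)%:E *
    ((9 + 16 * kappa)%:E + \int[P]_w (dev (X w))%:E))%E.
Proof.
have c0 : 0 <= chain_rate R n p m s J.
  rewrite /chain_rate; apply: mulr_ge0; first by rewrite !mulr_ge0 ?sqrtr_ge0.
  apply: addr_ge0; first by rewrite !mulr_ge0 ?sqrtr_ge0.
  by rewrite mulr_ge0 // divr_ge0 ?sqrtr_ge0 // exprn_ge0.
have mrX : measurable_fun setT (fun w => (restrict S (X w) : rvec R I)).
  exact: (measurableT_comp (measurable_restrict S) (measurable_to_rvec mX)).
rewrite (mix_integral mX indepX S (F := fun x => (cross S x x)%:E)); last 2 first.
- exact/measurable_EFinP.
- by move=> x; rewrite lee_fin net_max_ge0.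
have mixE w w' : cross S (mix S (X w) (X w')) (mix S (X w) (X w')) =
    cross S (X w) (X w').
  congr net_max; apply/funext => z; congr `|_|; apply: eq_bigr => r _.
  by congr (act _ z r * act _ z r); apply/funext => k; rewrite /restrict /mix;
    case: (S k).
pose B w := energy_max (restrict S (X w)).
pose K w := spectral_max (restrict S (X w)).
have mB : measurable_fun setT B by exact: (measurableT_comp measurable_energy_max mrX).
have mK : measurable_fun setT K by exact: (measurableT_comp measurable_spectral_max mrX).
have B0 w : 0 <= B w by exact: net_max_ge0.
have K0 w : 0 <= K w by exact: le_trans ler01 (spectral_max_ge1 _ _).
apply: (@le_trans _ _ (\int[P]_w
    (chain_rate R n p m s J * (1 + (B w + 4 * K w)))%:E)%E).
  apply: ge0_le_integral_any => w.
    by apply: integral_ge0 => w' _; rewrite lee_fin net_max_ge0.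
  under eq_integral do rewrite mixE.
  apply: (le_trans (cross_expectation_le S (X w) J)).
  by rewrite lee_fin le_eqVlt; apply/orP; left; apply/eqP; rewrite /B /K; ring.
have m4K : measurable_fun setT (fun w => 4 * K w) by exact: measurable_funM.
have mBK : measurable_fun setT (fun w => B w + 4 * K w) by exact: measurable_funD.
rewrite expectationZ //; last 2 first.
- exact: measurable_funD.
- by move=> w; rewrite !addr_ge0 ?mulr_ge0.
rewrite expectationD //; last by move=> w; rewrite addr_ge0 ?mulr_ge0.
rewrite expectation_cst expectationD //; last by move=> w; rewrite mulr_ge0.
rewrite expectationZ //.
apply: lee_wpmul2l; first by rewrite lee_fin.
have hB := energy_max_expectation S; have hK := spectral_max_expectation S.
apply: (@le_trans _ _ (1%:E + ((4%:E + \int[P]_w (dev (X w))%:E)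
    + 4%:E * (1 + 4 * kappa)%:E))%E).
  apply: leeD2l; apply: leeD => //.
  by apply: lee_wpmul2l => //; rewrite lee_fin.
have : (0 <= \int[P]_w (dev (X w))%:E)%E.
  by apply: integral_ge0 => w _; rewrite lee_fin net_max_ge0.
move: (\int[P]_w (dev (X w))%:E)%E => [e| |] //= _.
by rewrite -!EFinM -!EFinD lee_fin; lra.
Qed.

(** Without this, moving half of the expected deviation to the other side would be meaningless in
    the extended reals. *)
Lemma dev_finite : (\int[P]_w (dev (X w))%:E < +oo)%E.
Proof.
pose C : R := m%:R * (2 ^+ N * 4).
have C0 : 0 <= C by rewrite !mulr_ge0 ?exprn_ge0.
pose G w := \sum_k X w k ^+ 2.
have mG : measurable_fun setT G.
  by apply: measurable_rsum => k; exact: measurable_funX.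
have G0 w : 0 <= G w by apply: sumr_ge0 => k _; exact: sqr_ge0.
have devG w : dev (X w) <= 4 + C * G w.
  apply: net_max_le => [|u gu]; first by rewrite addr_ge0 ?mulr_ge0.
  have l2 := good_l2 gu.
  have l20 : 0 <= \sum_c vec u c 0 ^+ 2 by apply: sumr_ge0 => c _; exact: sqr_ge0.
  have e0 : 0 <= energy (X w) (vec u) by apply: sumr_ge0 => r _; exact: sqr_ge0.
  have eG : energy (X w) (vec u) <= C * G w.
    rewrite /energy /C -mulrA.
    apply: (@le_trans _ _ (\sum_(r < m) (2 ^+ N * 4 * G w))); last first.
      by rewrite sumr_const card_ord mulr_natl.
    apply: ler_sum => r _; rewrite /act.
    apply: (le_trans (sqr_sum_le _ _)).
    rewrite (_ : size _ = N); last by rewrite /index_enum -enumT size_enum_ord.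
    rewrite -mulrA; apply: ler_wpM2l; first by rewrite exprn_ge0.
    apply: (@le_trans _ _ (\sum_c vec u c 0 ^+ 2 * G w)).
      apply: ler_sum => c _; rewrite exprMn ler_wpM2l ?sqr_ge0 //.
      rewrite /G (bigD1 (block n0 c, sample n0 nm r c)) //= lerDl.
      by apply: sumr_ge0 => k _; exact: sqr_ge0.
    by rewrite -mulr_suml ler_wpM2r.
  by rewrite ler_norml; apply/andP; split; lra.
apply: (@le_lt_trans _ _ (\int[P]_w (4 + C * G w)%:E)%E).
  apply: le_expectation => //.
  - exact: measurable_comp_X.
  - by apply: measurable_funD => //; exact: measurable_funM.
  - by move=> w; exact: net_max_ge0.
rewrite expectationD //; last 2 first.
- exact: measurable_funM.
- by move=> w; rewrite mulr_ge0.
rewrite expectation_cst expectationZ // expectation_sum; last 2 first.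
- by move=> k; exact: measurable_funX.
- by move=> k w; exact: sqr_ge0.
apply: lte_add_pinfty; first exact: ltry.
have Gfin : (\sum_k \int[P]_w (X w k ^+ 2)%:E < +oo)%E.
  apply: lte_sum_pinfty => k _; exact: (gaussian_sqr_bound sigma0 mX lawX).
have : (0 <= \sum_k \int[P]_w (X w k ^+ 2)%:E)%E.
  by apply: sume_ge0 => k _; apply: integral_ge0 => w _; rewrite lee_fin sqr_ge0.
move: Gfin; move: (\sum_k _)%E => [r| |] //= _ _.
by rewrite -EFinM ltry.
Qed.

Lemma dev_expectation J : ln (2 * p%:R) + 1 <= m%:R :> R ->
  8 * chain_rate R n p m s J <= 1 ->
  (\int[P]_w (dev (X w))%:E <= (8 * chain_rate R n p m s J * (9 + 16 * kappa)
     + 40 * Num.sqrt ((ln (2 * p%:R) + 1) / m%:R))%:E)%E.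
Proof.
move=> pm eta8; set eta := chain_rate R n p m s J in eta8 *.
set E := (\int[P]_w (dev (X w))%:E)%E.
set q := Num.sqrt ((ln (2 * p%:R) + 1) / m%:R).
have E0 : (0 <= E)%E.
  by apply: integral_ge0 => w _; rewrite lee_fin net_max_ge0.
have Efin : (E < +oo)%E by exact: dev_finite.
have c0 : 0 < #|{ffun I -> bool}|%:R :> R.
  by rewrite ltr0n card_ffun card_bool expn_gt0.
pose Z w := fmax (fun i => `|\sum_t X w (i, t) ^+ 2 - 1|).
have mZ : measurable_fun setT Z.
  apply: measurable_fmax => i; apply: measurableT_comp => //.
  apply: measurable_funB => //; apply: measurable_rsum => t.
  exact: measurable_funX.
have EZ : (\int[P]_w (Z w)%:E <= (5 * q)%:E)%E.
  have cm : #|'I_m|%:R = m%:R :> R by rewrite card_ord.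
  have := @chi_square_fmax R d T P 'I_p 'I_m X; rewrite !card_ord.
  by apply.
have mcr S : measurable_fun setT (fun w => 4 * cross S (X w) (X w)).
  by apply: measurable_funM => //; exact: (measurable_comp_X (measurable_cross S)).
have cr0 S w : 0 <= 4 * cross S (X w) (X w) by rewrite mulr_ge0 ?net_max_ge0.
(* In [20 = 4 . 5] the 4 bounds the squared norm of net vectors and the 5 comes from
   [chi_square_fmax]. As [8 eta <= 1], the term [4 eta E] is at most [E / 2], and absorbing it
   doubles the rest. *)
have main : (E <= 4%:E * (eta%:E * ((9 + 16 * kappa)%:E + E)) + (20 * q)%:E)%E.
  apply: (@le_trans _ _ (\int[P]_w (#|{ffun I -> bool}|%:R^-1 *
     (\sum_(S : {ffun I -> bool}) 4 * cross S (X w) (X w)) + 4 * Z w)%:E)%E).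
    apply: le_expectation.
    - exact: measurable_comp_X.
    - apply: measurable_funD; last exact: measurable_funM.
      by apply: measurable_funM => //; exact: measurable_rsum.
    - by move=> w; exact: net_max_ge0.
    - by move=> w; exact: (dev_le s n0 nm zetaP).
  have msum : measurable_fun setT (fun w =>
      \sum_(S : {ffun I -> bool}) 4 * cross S (X w) (X w)).
    exact: measurable_rsum.
  have sum0 w : 0 <= \sum_(S : {ffun I -> bool}) 4 * cross S (X w) (X w).
    exact: sumr_ge0.
  rewrite expectationD //; last 4 first.
  - exact: measurable_funM.
  - exact: measurable_funM.
  - by move=> w; rewrite mulr_ge0 ?invr_ge0.
  - by move=> w; rewrite mulr_ge0 ?fmax_ge0.
  apply: leeD; last first.
    rewrite expectationZ //; last by move=> w; exact: fmax_ge0.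
    rewrite (_ : 20 * q = 4 * (5 * q)); last by ring.
    by rewrite EFinM; apply: lee_wpmul2l; rewrite ?lee_fin.
  rewrite expectationZ ?invr_ge0 //.
  rewrite expectation_sum //.
  apply: (@le_trans _ _ ((#|{ffun I -> bool}|%:R^-1)%:E *
     (\sum_(S : {ffun I -> bool}) 4%:E * (eta%:E * ((9 + 16 * kappa)%:E + E))))%E).
    apply: lee_wpmul2l; first by rewrite lee_fin invr_ge0.
    apply: lee_sum => S _; rewrite expectationZ //; last first.
    - by move=> w; exact: net_max_ge0.
    - exact: (measurable_comp_X (measurable_cross S)).
    by apply: lee_wpmul2l; [rewrite lee_fin|exact: cross_expectation].
  move: E0 Efin; move: E => [e| |] //= e0 _.
  rewrite -!EFinD -!EFinM sumEFin -EFinM lee_fin sumr_const.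
  by rewrite -[_ *+ #|_|]mulr_natl mulKf // gt_eqF.
move: E0 Efin main; move: E => [e| |] //= e0 _.
move=> main0; have main : e <= 4 * (eta * ((9 + 16 * kappa) + e)) + 20 * q.
  by rewrite -lee_fin; exact: main0.
rewrite lee_fin in e0; rewrite lee_fin.
have k0 : 0 <= kappa by exact: sqrtr_ge0.
by have := ler_wpM2r e0 eta8; lra.
Qed.

End expected_deviation.

(** * Numerical rates *)

Section logarithms.
Context (R : realType).

Lemma ln_nat_le (k l : nat) : (0 < k)%N -> (k <= l)%N -> ln k%:R <= ln l%:R :> R.
Proof.
move=> k0 kl; rewrite ler_ln ?posrE ?ltr0n ?ler_nat //.
exact: leq_trans k0 kl.
Qed.

(** This lower bound lets additive constants be absorbed into the logarithms throughout; it amounts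
    to [e^(-1/2) >= 1/2]. *)
Lemma half_le_ln (k : nat) : (2 <= k)%N -> 2^-1 <= ln k%:R :> R.
Proof.
move=> k2; apply: (@le_trans _ _ (ln 2%:R)); last exact: ln_nat_le.
rewrite -ler_expR lnK ?posrE ?ltr0n //.
have h := @expR_ge1Dx R (- 2^-1).
have e : expR (- 2^-1) * expR 2^-1 = 1 :> R by rewrite -expRD addNr expR0.
by have := @expR_gt0 R 2^-1; nra.
Qed.

Lemma ln_natX_le (k l e : nat) : (0 < k)%N -> (0 < l)%N -> (k <= l ^ e)%N ->
  ln k%:R <= e%:R * ln l%:R :> R.
Proof.
move=> k0 l0 kl; apply: (le_trans (ln_nat_le k0 kl)).
by rewrite natrX lnXn ?ltr0n // mulr_natl.
Qed.

(** The rounded logarithm exceeds [ln s / ln 2 <= 2 ln s] by at most [1 <= 2 ln s]. *)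
Lemma up_log_le_ln (s : nat) : (2 <= s)%N -> (up_log 2 s)%:R <= 4 * ln s%:R :> R.
Proof.
move=> s2; have [lo _] := andP (up_log_bounds (ltnSn 1) s2).
have l2 := half_le_ln (leqnn 2); have ls := half_le_ln s2.
have : ((up_log 2 s).-1)%:R * ln 2%:R <= ln s%:R :> R.
  rewrite mulr_natl -lnXn ?ltr0n // -natrX.
  by apply: ln_nat_le; [rewrite expn_gt0|exact: ltnW].
have -> : (up_log 2 s)%:R = ((up_log 2 s).-1)%:R + 1 :> R.
  by rewrite natr1 prednK // up_log_gt0.
set k := ((up_log 2 s).-1)%:R => h.
have k0 : 0 <= k by exact: ler0n.
nra.
Qed.

End logarithms.

Section rates.
Context (R : realType) (n p m s : nat).
Hypothesis n0 : (0 < n)%N.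
Hypothesis p0 : (0 < p)%N.
Hypothesis nm : (n <= m)%N.
Hypothesis s2 : (2 <= s)%N.
Hypothesis sN : (s <= n * p)%N.

Local Notation a := (ln (s%:R : R)).
Local Notation b := (ln ((n * p)%:R : R)).
Local Notation c := (ln ((m * p)%:R : R)).

Let N2 : (2 <= n * p)%N. Proof. exact: leq_trans s2 sN. Qed.
Let NM : (n * p <= m * p)%N. Proof. by rewrite leq_mul2r nm orbT. Qed.
Let M2 : (2 <= m * p)%N. Proof. exact: leq_trans N2 NM. Qed.
Let m0 : (0 < m)%N. Proof. exact: leq_trans n0 nm. Qed.
Let a2 : 2^-1 <= a. Proof. exact: half_le_ln. Qed.
Let b2 : 2^-1 <= b. Proof. exact: half_le_ln. Qed.
Let c2 : 2^-1 <= c. Proof. exact: half_le_ln. Qed.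
Let a0 : 0 <= a. Proof. by apply: le_trans a2; rewrite invr_ge0. Qed.
Let b0 : 0 <= b. Proof. by apply: le_trans b2; rewrite invr_ge0. Qed.
Let c0 : 0 <= c. Proof. by apply: le_trans c2; rewrite invr_ge0. Qed.
Let mR : 0 < m%:R :> R. Proof. by rewrite ltr0n. Qed.
Let sR : 2 <= s%:R :> R. Proof. by rewrite ler_nat. Qed.

Let log_dim : ln (2 * (n * p) + 1)%:R <= 3 * b.
Proof.
by apply: ln_natX_le; rewrite ?addn1 //; [lia|move: N2; move: (n * p)%N; nia].
Qed.

(** With [N = n p >= 2] and [s <= N], [16 s + 1 <= 2^5 N <= N^6], so the net has at most [N^(7 s)]
    indices; the leading factor 2 costs one more power of [N]. *)
Let log_net : ln (2 * #|net_index (n * p) s|%:R) + 1 <= 9 * s%:R * b.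
Proof.
have cardU : #|net_index (n * p) s| = ((n * p * (16 * s + 1)) ^ s)%N.
  by rewrite card_ffun card_prod !card_ord.
have h : ln (2 * #|net_index (n * p) s|)%:R <= (7 * s + 1)%:R * b.
  apply: ln_natX_le; [by rewrite cardU muln_gt0 expn_gt0 muln_gt0; lia|lia|].
  rewrite cardU expnD expn1 mulnC leq_mul // expnM leq_exp2r; last by lia.
  rewrite (expnD _ 1 6) expn1 leq_mul //.
  apply: (@leq_trans (2 ^ 5 * (n * p))); first by lia.
  by rewrite -[(6)%N]/(5 + 1)%N expnD expn1 leq_mul // leq_exp2r.
rewrite natrM in h.
have : (7 * s + 1)%:R = 7 * s%:R + 1 :> R by rewrite natrD natrM.
by move=> e; rewrite e in h; have := b2; have := sR; nra.
Qed.

Let log_two (k : nat) : (0 < k)%N -> (k <= m * p)%N ->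
  ln (2 * k)%:R + 1 <= 4 * c.
Proof.
move=> k0 km.
have h : ln (2 * k)%:R <= 2%:R * c.
  by apply: ln_natX_le; [lia|lia|rewrite expnS expn1 leq_mul].
by have := c2; lra.
Qed.

Local Notation W := (Num.sqrt (s%:R * c * b / m%:R)).

(** At [J = up_log 2 s] one has [2^J >= s], so the last hop drops to [3 sqrt b], within the order of
    a single scale. The number of scales supplies the factor [a]. *)
Lemma chain_rate_le : chain_rate R n p m s (up_log 2 s) <= 10 ^+ 4 * (a * W).
Proof.
have s0 : 0 <= s%:R :> R by exact: ler0n.
have e1 : Num.sqrt (ln (m * 2)%:R + 1) <= 2 * Num.sqrt c.
  rewrite -[2 * _]ger0_norm ?mulr_ge0 ?sqrtr_ge0 // -sqrtr_sqr.
  rewrite ler_wsqrtr // exprMn sqr_sqrtr // mulnC (_ : 2 ^+ 2 = 4); last by ring.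
  by apply: log_two => //; exact: leq_pmulr.
have e2 : Num.sqrt (ln (2 * (n * p) + 1)%:R) <= 2 * Num.sqrt b.
  rewrite -[2 * _]ger0_norm ?mulr_ge0 ?sqrtr_ge0 // -sqrtr_sqr.
  rewrite ler_wsqrtr // exprMn sqr_sqrtr // (_ : 2 ^+ 2 = 4); last by ring.
  by have := log_dim; have := b0; lra.
have e3 : Num.sqrt (ln (2 * #|net_index (n * p) s|%:R) + 1) / 2 ^+ up_log 2 s
    <= 3 * Num.sqrt b.
  have s2J : s%:R <= 2 ^+ up_log 2 s :> R.
    by rewrite -natrX ler_nat; have [_ ->] := andP (up_log_bounds (ltnSn 1) s2).
  rewrite ler_pdivrMr ?exprn_gt0 //.
  apply: (@le_trans _ _ (3 * Num.sqrt b * s%:R)); last first.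
    by rewrite ler_wpM2l // mulr_ge0 ?sqrtr_ge0.
  rewrite -[leRHS]ger0_norm ?mulr_ge0 ?sqrtr_ge0 // -sqrtr_sqr.
  rewrite ler_wsqrtr // !exprMn sqr_sqrtr //.
  apply: (le_trans log_net).
  have -> : 3 ^+ 2 * b * s%:R ^+ 2 = 9 * s%:R * b * s%:R by ring.
  rewrite ler_peMr ?mulr_ge0 //; apply: le_trans sR.
  by rewrite ler1n.
have e4 := up_log_le_ln R s2.
have q0 := sqrtr_ge0 b.
have e5 : 192 * (up_log 2 s)%:R * Num.sqrt (ln (2 * (n * p) + 1)%:R)
     + 32 * (Num.sqrt (ln (2 * #|net_index (n * p) s|%:R) + 1) / 2 ^+ up_log 2 s)
    <= 1728 * a * Num.sqrt b.
  apply: (@le_trans _ _ (192 * (4 * a) * (2 * Num.sqrt b) + 32 * (3 * Num.sqrt b))).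
    apply: lerD; last by apply: ler_wpM2l.
    apply: ler_pM => //; rewrite ?mulr_ge0 ?sqrtr_ge0 //.
    by apply: ler_wpM2l.
  by have ha := a2; nra.
have WE : W = Num.sqrt (m%:R^-1) * Num.sqrt s%:R * Num.sqrt c * Num.sqrt b.
  rewrite -!sqrtrM ?mulr_ge0 ?invr_ge0 ?ler0n //; congr Num.sqrt; ring.
rewrite /chain_rate.
apply: (@le_trans _ _ (Num.sqrt (m%:R^-1) * (2 * Num.sqrt s%:R) * (2 * Num.sqrt c)
  * (1728 * a * Num.sqrt b))).
  by apply: ler_pM => //; exact: ler_wpM2l.
have aW : 0 <= a * W by rewrite mulr_ge0 ?sqrtr_ge0.
apply: (@le_trans _ _ (6912 * (a * W))).
  rewrite le_eqVlt; apply/orP; left; apply/eqP; rewrite WE; ring.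
by apply: ler_wpM2r => //; rewrite -natrX ler_nat.
Qed.

Lemma probe_rate_le : probe_rate R p m <= 2 * Num.sqrt c.
Proof.
rewrite -[2 * _]ger0_norm ?mulr_ge0 ?sqrtr_ge0 // -sqrtr_sqr.
rewrite ler_wsqrtr // exprMn sqr_sqrtr // (_ : 2 ^+ 2 = 4); last by ring.
by rewrite -natrM; apply: log_two; rewrite ?muln_gt0 ?p0 // mulnC.
Qed.

Lemma probe_rate_ge1 : 1 <= probe_rate R p m.
Proof.
rewrite -[leLHS]sqrtr1 ler_wsqrtr // lerDr ln_ge0 // -natrM ler1n.
by rewrite !muln_gt0 p0.
Qed.

(** The identity [a W sqrt c = Q] combines the chaining rate with the probe rate, each bringing one
    root of [c]. The smallness of [Q] also makes the chi-square term, of order [sqrt(c / m)], fit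
    below [Q]. *)
Lemma rates_bound (Q : R) :
  Q = Num.sqrt (s%:R * a ^+ 2 * c ^+ 2 * b / m%:R) -> Q <= (10 ^+ 6)^-1 ->
  [/\ ln (2 * p%:R) + 1 <= m%:R :> R,
      8 * chain_rate R n p m s (up_log 2 s) <= 1 &
      8 * chain_rate R n p m s (up_log 2 s) * (9 + 16 * probe_rate R p m)
        + 40 * Num.sqrt ((ln (2 * p%:R) + 1) / m%:R) <= 10 ^+ 7 * Q].
Proof.
move=> QE Q6.
set eta := chain_rate _ _ _ _ _ _.
have W0 : 0 <= W by exact: sqrtr_ge0.
have Q0 : 0 <= Q by rewrite QE sqrtr_ge0.
have aWQ : a * W * Num.sqrt c = Q.
  rewrite QE -[in LHS](ger0_norm a0) -sqrtr_sqr -!sqrtrM ?sqr_ge0 //.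
    by congr Num.sqrt; ring.
  by rewrite mulr_ge0 ?sqr_ge0 // divr_ge0 ?mulr_ge0.
have sc : 2^-1 <= Num.sqrt c.
  rewrite -[2^-1]ger0_norm ?invr_ge0 // -sqrtr_sqr ler_wsqrtr //.
  by have := c2; lra.
have aW0 : 0 <= a * W by rewrite mulr_ge0.
have aW2 : a * W <= 2 * Q by rewrite -aWQ; nra.
have etaW := chain_rate_le; rewrite -/eta in etaW.
have kap := probe_rate_le; have kap1 := probe_rate_ge1.
set k := probe_rate R p m in kap kap1 *.
have hc : ln (2 * p%:R) + 1 <= 4 * c.
  by rewrite -natrM; apply: log_two => //; exact: leq_pmull.
have Q2 : Q ^+ 2 = s%:R * a ^+ 2 * c ^+ 2 * b / m%:R.
  by rewrite QE sqr_sqrtr // divr_ge0 ?mulr_ge0 ?sqr_ge0.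
have cm : c / m%:R <= 8 * Q ^+ 2.
  rewrite Q2 mulrA ler_wpM2r ?invr_ge0 //.
  have h1 : 4^-1 <= a ^+ 2 by have := a2; nra.
  have h2 : 2^-1 <= s%:R * a ^+ 2 by have := sR; nra.
  have h3 : 4^-1 <= s%:R * a ^+ 2 * b by have := b2; nra.
  have h4 : 2^-1 * c <= c ^+ 2 by have := c2; nra.
  have h5 : 0 <= c ^+ 2 by exact: sqr_ge0.
  have := ler_wpM2r h5 h3; lra.
have t6 : 10 ^+ 6 * Q <= 1.
  by rewrite mulrC -ler_pdivlMr ?exprn_gt0 // mul1r.
have Q2le : Q ^+ 2 <= Q.
  have : Q <= 1 by apply: (le_trans Q6); rewrite invf_le1 ?exprn_gt0 // exprn_ege1 // ler1n.
  nra.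
have h0 : 0 <= ln (2 * p%:R) + 1 :> R.
  by rewrite addr_ge0 // ln_ge0 // -natrM ler1n muln_gt0.
have hQ : (ln (2 * p%:R) + 1) / m%:R <= 32 * Q ^+ 2.
  apply: (@le_trans _ _ (4 * (c / m%:R))); last by lra.
  by rewrite mulrA ler_wpM2r ?invr_ge0.
have e6 : 10 ^+ 6 = 100 * 10 ^+ 4 :> R by ring.
have e7 : 10 ^+ 7 = 1000 * 10 ^+ 4 :> R by ring.
have A1 : 1 <= 10 ^+ 4 :> R by rewrite exprn_ege1 // ler1n.
(* Abstracting [10 ^+ 4] leaves inequalities linear in [Q] and [A * Q], with small numeric
   coefficients. *)
rewrite {}e6 in t6; rewrite {}e7; move: (10 ^+ 4) => A in t6 etaW A1 *.
have AQ : Q <= A * Q by rewrite ler_peMl.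
split.
- rewrite -[leRHS]mul1r -ler_pdivrMr //.
  by apply: (le_trans hQ); lra.
- have : A * (a * W) <= A * (2 * Q) by apply: ler_wpM2l => //; lra.
  lra.
have hq : Num.sqrt ((ln (2 * p%:R) + 1) / m%:R) <= 6 * Q.
  rewrite -[6 * _]ger0_norm ?mulr_ge0 // -sqrtr_sqr ler_wsqrtr //.
  by rewrite exprMn; have := sqr_ge0 Q; lra.
have A0 : 0 <= A by lra.
have ek : eta * (9 + 16 * k) <= A * (a * W) * (50 * Num.sqrt c).
  apply: (@le_trans _ _ (A * (a * W) * (9 + 16 * k))).
    by apply: ler_wpM2r => //; lra.
  by apply: ler_wpM2l; [rewrite mulr_ge0|lra].
have : A * (a * W) * (50 * Num.sqrt c) = 50 * (A * Q) by rewrite -aWQ; ring.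
rewrite -mulrA; lra.
Qed.

End rates.

Theorem theorem1 :
  exists C5 C6 : nat, (0 < C5)%N /\ (0 < C6)%N /\
  forall (R : realType) (d : measure_display) (T : measurableType d)
    (P : probability T R) (n p m s : nat) (phi : 'I_p -> 'I_m -> T -> R),
    (1 <= n)%N -> (1 <= p)%N -> (n <= m)%N -> (2 <= s)%N -> (s <= n * p)%N ->
    (forall i t, measurable_fun setT (phi i t)) ->
    (forall i t (B : set R), measurable B ->
        P (phi i t @^-1` B) = normal_prob 0 (Num.sqrt (m%:R^-1)) B) ->
    mutually_independent P (fun k : 'I_p * 'I_m => phi k.1 k.2) ->
    let L := s%:R * ln (s%:R : R) ^+ 2 * ln ((m * p)%:R : R) ^+ 2
             * ln ((n * p)%:R : R) in
    C6%:R * L <= m%:R ->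
    (\int[P]_w (sparse_norm s
        (1%:M - (mc_circulant n (fun i t => phi i t w))^T
                  *m mc_circulant n (fun i t => phi i t w)))%:E
     <= (Num.sqrt (C5%:R * L / m%:R))%:E)%E.
Proof.
(* Squares of the constants in [rates_bound]: [10^7] multiplies [Q] in its conclusion, and
   [Q <= 10^-6] is its smallness condition. *)
exists (10 ^ 14)%N, (10 ^ 12)%N.
split; [by rewrite expn_gt0|split; [by rewrite expn_gt0|]].
move=> R d T P n p m s phi n0 p0 nm s2 sN mphi lawphi indphi L Lm.
have m0 : (0 < m)%N := leq_trans n0 nm.
have mR : 0 < m%:R :> R by rewrite ltr0n.
have s0 : (0 < s)%N := ltnW s2.
have N0 : (0 < n * p)%N by rewrite muln_gt0 n0.
have [zeta zetaP] := @exists_prim_root R m m0.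
pose X (w : T) : rvec R ('I_p * 'I_m)%type := fun k => phi k.1 k.2 w.
pose Q := Num.sqrt (L / m%:R).
have QE : Q = Num.sqrt (s%:R * ln s%:R ^+ 2 * ln (m * p)%:R ^+ 2 *
    ln (n * p)%:R / m%:R) by [].
have Q6 : Q <= (10 ^+ 6)^-1.
  rewrite -[leRHS]ger0_norm ?invr_ge0 ?exprn_ge0 // -sqrtr_sqr ler_wsqrtr //.
  rewrite ler_pdivrMr // exprVn -exprM [leRHS]mulrC ler_pdivlMr ?exprn_gt0 //.
  by rewrite mulrC -natrX.
have [h1 h2 h3] := rates_bound n0 p0 nm s2 sN QE Q6.
have QC : Num.sqrt ((10 ^ 14)%N%:R * L / m%:R) = 10 ^+ 7 * Q.
  rewrite -mulrA natrX (exprM _ 7 2) sqrtrM ?sqr_ge0 // sqrtr_sqr.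
  by rewrite ger0_norm ?exprn_ge0.
rewrite QC.
have := @dev_expectation R d T P n p m s X n0 p0 nm s0 _ indphi _ zeta zetaP
  (up_log 2 s) h1 h2.
move=> /(_ (fun k => mphi k.1 k.2) (fun k => lawphi k.1 k.2)) E.
apply: le_trans (le_trans E _); last by rewrite lee_fin.
apply: ge0_le_integral_any => w; rewrite lee_fin.
  exact: sparse_norm_ge0.
set Phi := mc_circulant _ _.
apply: (le_trans (sparse_norm_le_net s0 N0 _)).
  by rewrite linearB /= trmx1 trmx_mul trmxK.
rewrite /dev /net_max le_eqVlt; apply/orP; left; apply/eqP; congr fmax.
apply/funext => u; case: ifP => // _.
set z := net_vec R u.
have PhiE r : (Phi *m z) r 0 = act n0 nm (X w) z r.
  exact: (mc_circulant_act n0 nm (X w) z r).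
(* [dev] measures [Phi^T Phi - I], the opposite of the matrix in the sparse norm. *)
rewrite -normrN; congr `|_|.
have -> : z^T *m (1%:M - Phi^T *m Phi) *m z = z^T *m z - (Phi *m z)^T *m (Phi *m z).
  by rewrite mulmxBr mulmx1 mulmxBl trmx_mul !mulmxA.
rewrite !mxE opprB; congr (_ - _); apply: eq_bigr => r _.
  by rewrite mxE PhiE expr2.
by rewrite mxE expr2.
Qed.
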